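(* Let $\beta>1$ be a Yrrap number, i.e. the orbit of $1$ under the $(-\beta)$-transformation $T_{-\beta}$ is eventually periodic. Let $L$ be Lebesgue measure on $[0,1]$ and $\varphi\equiv\log\beta$. Then $([0,1],T_{-\beta})$ satisfies a level-2 large deviation principle with reference measure $L$ and rate function the free energy $\mathcal{F}_\varphi(\mu)=h(\mu)-\log\beta$ for $T_{-\beta}$-invariant $\mu$ and $\mathcal{F}_\varphi(\mu)=-\infty$ otherwise.
   Context: $(-\beta)$-transformation $T_{-\beta}\colon[0,1]\to[0,1]$: let $b=\max\{k\in\mathbb{Z}:k<\beta\}$, $I_i=(i/\beta,(i+1)/\beta)$ for $0\le i\le b-1$, $I_b=(b/\beta,1)$, and $T_{-\beta}(x)=-\beta x+(i+1)$ for $x\in I_i$. For $x\notin\bigcup_{i\ge0}T_{-\beta}^{-i}\{0,1/\beta,\dots,b/\beta,1\}$ let $i'(x)\in\{0,\dots,b\}^{\mathbb{Z}_+}$, $(i'(x))_k=j$ iff $T_{-\beta}^k(x)\in I_j$, and let $i'(1)=\lim_{x\to1^-}i'(x)$. Case 1: $i'(1)=(w0)^\infty$ for some finite word $w$; then $T_{-\beta}(0)=1$, $T_{-\beta}(i/\beta)=0$ for $1\le i\le b$, $T_{-\beta}(1)=\lim_{x\to1^-}T_{-\beta}(x)$. Case 2: otherwise; then $T_{-\beta}(0)=1$, $T_{-\beta}(i/\beta)=1$ for $1\le i\le b$, $T_{-\beta}(1)=\lim_{x\to1^-}T_{-\beta}(x)$. $\mathcal{M}([0,1])$: Borel probability measures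 with weak topology; $\mathcal{E}_n(x)=\frac1n\sum_{j=0}^{n-1}\delta_{T_{-\beta}^j(x)}$; $h$ = metric entropy. Level-2 LDP with reference $L$ and rate $q$: $q\colon\mathcal{M}([0,1])\to[-\infty,0]$ upper semicontinuous, $\liminf_n\frac1n\log L(\{x:\mathcal{E}_n(x)\in G\})\ge\sup_G q$ for every open $G$ and $\limsup_n\frac1n\log L(\{x:\mathcal{E}_n(x)\in F\})\le\sup_F q$ for every closed $F$. *)

(* Defs.v *)
(* Everything is stated over an arbitrary
   R : realType.  Measures on [0,1] are Borel measures on R concentrated
   on [0,1]. *)
From HB Require Import structures.
From mathcomp Require Import all_boot all_order all_algebra.
From mathcomp Require Import all_classical all_reals all_analysis.
Set Implicit Arguments. Unset Strict Implicit. Unset Printing Implicit Defensive.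
Import Order.TTheory GRing.Theory Num.Theory.
Import numFieldNormedType.Exports.
Local Open Scope classical_set_scope.
Local Open Scope ring_scope.

Section MinusBeta.
Variable R : realType.
Implicit Types (beta x y : R).

(* b = max {k in Z : k < beta} *)
Definition bdig beta : int := (Num.ceil beta - 1)%R.

Definition disc beta x : Prop :=
  x = 0 \/ x = 1 \/
  exists j : int, (1 <= j)%R /\ (j <= bdig beta)%R /\ x = j%:~R / beta.

Definition Tgen beta x : R := - beta * x + ((Num.floor (beta * x))%:~R + 1).

(* digit i such that y in I_i (for y in (0,1) off the discontinuity set) *)
Definition digit beta y : nat := `|Num.floor (beta * y)|%N.

(* x is in [0,1] and outside U_{k>=0} T^{-k}{0,1/beta,...,b/beta,1}.
   Along such an orbit only the generic formula is used. *)
Definition good beta x : Prop :=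
  0 <= x <= 1 /\ forall k : nat, ~ disc beta (iter k (Tgen beta) x).

Definition itin beta x : nat -> nat := fun k => digit beta (iter k (Tgen beta) x).

(* d = i'(1) = lim_{x -> 1^-} i'(x) (product topology on {0..b}^N) *)
Definition itin_one beta (d : nat -> nat) : Prop :=
  forall N : nat, exists2 delta : R, 0 < delta &
    forall x, 1 - delta < x < 1 -> good beta x ->
      forall k : nat, (k < N)%N -> itin beta x k = d k.

(* Case 1: i'(1) = (w0)^oo for some finite word w *)
Definition case1 beta : Prop :=
  exists d, itin_one beta d /\
    exists w : seq nat, forall k : nat,
      d k = nth 0%N (rcons w 0%N) (k %% size (rcons w 0%N)).

(* The (-beta)-transformation on [0,1] (extended by 0 outside [0,1]).
   T(1) = lim_{x->1^-} T(x) = lim_{x->1^-} (-beta x + b + 1) = b + 1 - beta. *)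
Definition Tmb beta x : R :=
  if `[< x = 0 >] then 1
  else if `[< x = 1 >] then (bdig beta)%:~R + 1 - beta
  else if `[< disc beta x >] then (if `[< case1 beta >] then 0 else 1)
  else if `[< 0 < x < 1 >] then Tgen beta x
  else 0.

Definition yrrap beta : Prop :=
  exists m p : nat, (0 < p)%N /\ iter (m + p) (Tmb beta) 1 = iter m (Tmb beta) 1.

Definition ninv (n : nat) : {nonneg R} := (n%:R^-1 : R)%:nng.

Local Open Scope ereal_scope.

Definition prob01 (mu : {measure set R -> \bar R}) : Prop :=
  mu setT = 1 /\ mu (~` `[0%R, 1%R]) = 0.

(* open set of M([0,1]) in the weak topology: every point has a basic
   neighbourhood {nu : |int f_i dnu - int f_i dmu| < eps, i < k},
   f_i in C([0,1]) *)
Definition wopen (G : set {measure set R -> \bar R}) : Prop :=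
  forall mu, prob01 mu -> G mu ->
    exists (k : nat) (f : nat -> R -> R) (eps : R), (0 < eps)%R /\
      (forall i, (i < k)%N -> {within `[0%R, 1%R], continuous (f i)}) /\
      forall nu, prob01 nu ->
        (forall i, (i < k)%N ->
           (`| fine (\int[nu]_(x in `[0%R, 1%R]) (f i x)%:E)
             - fine (\int[mu]_(x in `[0%R, 1%R]) (f i x)%:E) | < eps)%R) ->
        G nu.

Definition wclosed (F : set {measure set R -> \bar R}) : Prop :=
  wopen (fun mu => ~ F mu).

Definition invariant (T : R -> R) (mu : {measure set R -> \bar R}) : Prop :=
  forall A : set R, measurable A -> mu (T @^-1` A) = mu A.

Definition mpartition (k : nat) (P : 'I_k -> set R) : Prop :=
  (forall i, measurable (P i)) /\
  (forall i j, i != j -> P i `&` P j = set0) /\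
  (forall x, exists i, P i x).

(* cell of  \/_{i<n} T^{-i} P  indexed by the word w *)
Definition cell (T : R -> R) (k n : nat) (P : 'I_k -> set R)
  (w : {ffun 'I_n -> 'I_k}) : set R :=
  [set x | forall i : 'I_n, P (w i) (iter i T x)].

(* H_mu(\/_{i<n} T^{-i} P), with 0 log 0 = 0 *)
Definition Hn (T : R -> R) (mu : {measure set R -> \bar R}) (k : nat)
  (P : 'I_k -> set R) (n : nat) : R :=
  (- \sum_(w : {ffun 'I_n -> 'I_k})
       (let m := fine (mu (cell T P w)) in
        if m == 0 then 0 else m * ln m))%R.

Definition hpart T mu k (P : 'I_k -> set R) : R :=
  limn (fun n : nat => (Hn T mu P n / n%:R)%R).

Definition hmetric T mu : \bar R :=
  ereal_sup [set e | exists (k : nat) (P : 'I_k -> set R),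
                       mpartition P /\ e = (hpart T mu P)%:E].

Definition empirical (T : R -> R) (n : nat) (x : R) : {measure set R -> \bar R} :=
  mscale (ninv n) (msum (fun j => \d_(iter j T x)) n).

Definition eln (e : \bar R) : \bar R :=
  if e == 0 then -oo else if e == +oo then +oo else (ln (fine e))%:E.

Definition level2_LDP (L : set R -> \bar R) (T : R -> R)
    (q : {measure set R -> \bar R} -> \bar R) : Prop :=
  (forall mu, prob01 mu -> q mu <= 0) /\
  (* q upper semicontinuous on M([0,1]) *)
  (forall c : \bar R, wclosed [set mu | c <= q mu]) /\
  (forall G, wopen G ->
     ereal_sup (q @` [set mu | prob01 mu /\ G mu]) <=
     limn_einf (fun n : nat => ((n%:R^-1)%R)%:E *
        eln (L [set x : R | (0 <= x <= 1)%R /\ G (empirical T n x)]))) /\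
  (forall F, wclosed F ->
     limn_esup (fun n : nat => ((n%:R^-1)%R)%:E *
        eln (L [set x : R | (0 <= x <= 1)%R /\ F (empirical T n x)]))
     <= ereal_sup (q @` [set mu | prob01 mu /\ F mu])).

Definition free_energy beta (mu : {measure set R -> \bar R}) : \bar R :=
  if `[< invariant (Tmb beta) mu >] then hmetric (Tmb beta) mu - (ln beta)%:E
  else -oo.

End MinusBeta.

(* Main.v *)
(**
On [0,1] the map is T x = d + 1 - beta x, where d is the digit of x, and points sharing their
first n digits are at distance at most beta^-n.  Both bounds are local.

Upper bound near mu.  The orbit of a point visits the bad side of a discontinuity rarely, so
the frequencies of digit words depend continuously on the empirical measure although
cylinders are not continuity sets.  If mu is not invariant its neighbourhood is eventually
unreachable.  If it is, the n-words whose (q+1)-word frequencies are close to those of mu are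
counted by a Markov kernel fitted to mu, which gives at most exp(n (H_{q+1} - H_q + e)) words,
each of which carries a set of diameter at most beta^-n.

Lower bound near mu.  When the orbit of 1 is finite, the discontinuities and this orbit cut
[0,1] into the cells of a Markov partition.  T need not be transitive, but images of a cell
grow until they straddle a discontinuity and then cover a neighbourhood of 1; hence the cells
are preordered by a rank which is monotone along orbits and decides reachability.  Typical
independent m-blocks of mu are sorted by rank and glued by connectors of bounded length; this
loses only a factor exp(O(n/m)) and yields exp(n (h(mu) - e)) words, each carrying an interval
of length at least a constant times beta^-n.

Compactness of the space of probability measures then globalises the local upper bound, and
the two local bounds together give upper semicontinuity.
*)
Require Import Defs.
From HB Require Import structures.
From mathcomp Require Import all_boot all_order all_algebra.
From mathcomp Require Import all_classical all_reals all_analysis.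
From mathcomp Require Import measurable_realfun.
From mathcomp Require Import ring lra.
From mathcomp Require Import zify.
Set Implicit Arguments. Unset Strict Implicit. Unset Printing Implicit Defensive.
Import Order.TTheory GRing.Theory Num.Theory.
Import numFieldNormedType.Exports.
Local Open Scope classical_set_scope.
Local Open Scope ring_scope.

(** * Finite entropy and typical sequences *)

Section FiniteEntropy.
Variable R : realType.

(** Cases 1 and 2 fix the values of [T] at the discontinuities so that the orbit of 1, and not only
    its left limit, describes the points just below 1. A point on the side of a discontinuity where
    the digit jumps is carried next to 1 within two steps and then follows the orbit of 1, staying
    off all such sides for any prescribed time. This makes bad visits rare uniformly in the starting
    point.

    For the lower bound, blocks cannot be concatenated in their sampled order, since a cell need not
    reach every other. But the thresholds above which a cell reaches everything are nested from cell
    to cell, so counting them orders the cells. Invariance of [mu] makes the resulting rank constant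
    along almost every orbit, and a block is realised without increase of rank between its ends.
    Reordering blocks does not change frequencies, and the original order is recovered from the
    ranks and connector lengths, a bounded number of choices per block; long blocks make this cost
    negligible. *)

Lemma ln_le_subr1 (y : R) : 0 < y -> ln y <= y - 1.
Proof.
move=> y0; have := expR_ge1Dx (ln y); rewrite lnK ?posrE//; lra.
Qed.

Definition ent (A : finType) (p : A -> R) : R := - \sum_a p a * ln (p a).

(** Termwise [ln (q / p) <= q / p - 1]. The two total masses are kept because it is also applied to
    smoothed weights, whose sum exceeds one. *)
Lemma gibbs (A : finType) (p q : A -> R) :
  (forall a, 0 <= p a) -> (forall a, 0 <= q a) -> (forall a, q a = 0 -> p a = 0) ->
  \sum_a p a * ln (q a) <= \sum_a p a * ln (p a) + (\sum_a q a - \sum_a p a).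
Proof.
move=> p0 q0 qp; rewrite -sumrB -big_split/=; apply: ler_sum => a _.
have [pa|pa] := eqVneq (p a) 0; first by rewrite pa !mul0r; have := q0 a; lra.
have pa0 : 0 < p a by rewrite lt_neqAle eq_sym pa p0.
have qa0 : 0 < q a.
  by rewrite lt_neqAle q0 andbT eq_sym; apply/eqP => /qp; exact/eqP.
have := ln_le_subr1 (divr_gt0 qa0 pa0); rewrite ln_div ?posrE// => h.
have {h} := ler_wpM2l (ltW pa0) h; rewrite !mulrBr mulr1 (mulrC _ (q a / p a)) divfK//; lra.
Qed.

Lemma ent_le_cross (A : finType) (p q : A -> R) :
  (forall a, 0 <= p a) -> (forall a, 0 <= q a) -> (forall a, q a = 0 -> p a = 0) ->
  \sum_a q a <= \sum_a p a -> ent p <= - \sum_a p a * ln (q a).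
Proof. by move=> p0 q0 qp h; have := gibbs p0 q0 qp; rewrite /ent; lra. Qed.

Lemma ent_ge0 (A : finType) (p : A -> R) :
  (forall a, 0 <= p a) -> (forall a, p a <= 1) -> 0 <= ent p.
Proof.
move=> p0 p1; rewrite /ent -sumrN; apply: sumr_ge0 => a _.
by rewrite -mulrN mulr_ge0// oppr_ge0 ln_le0.
Qed.

(** Cross entropy of [r] against the product of its marginals. *)
Lemma ent_pair_le (A B : finType) (r : A * B -> R) :
  (forall x, 0 <= r x) -> \sum_x r x = 1 ->
  ent r <= ent (fun a => \sum_b r (a, b)) + ent (fun b => \sum_a r (a, b)).
Proof.
move=> r0 r1.
set pa := fun a => \sum_b r (a, b); set pb := fun b => \sum_a r (a, b).
have pa0 a : 0 <= pa a by apply: sumr_ge0.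
have pb0 b : 0 <= pb b by apply: sumr_ge0.
have rpa a b : r (a, b) <= pa a by rewrite /pa (bigD1 b)//= lerDl sumr_ge0.
have rpb a b : r (a, b) <= pb b by rewrite /pb (bigD1 a)//= lerDl sumr_ge0.
have spa : \sum_a pa a = 1 by rewrite pair_bigA/= -r1; apply: eq_bigr => -[].
have spb : \sum_b pb b = 1.
  by rewrite exchange_big/= pair_bigA/= -r1; apply: eq_bigr => -[].
have sq : \sum_x pa x.1 * pb x.2 = 1.
  rewrite -(pair_bigA _ (fun a b => pa a * pb b))/=.
  by under eq_bigr do rewrite -mulr_sumr spb mulr1.
apply: le_trans (@ent_le_cross _ r (fun x => pa x.1 * pb x.2) _ _ _ _) _ => //.
- by move=> [a b] /=; rewrite mulr_ge0.
- move=> [a b] /= /eqP; rewrite mulf_eq0 => /orP[]/eqP h; apply/eqP;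
  by rewrite eq_le r0 andbT -h.
- by rewrite sq r1.
have -> : - (\sum_a r a * ln (pa a.1 * pb a.2)) =
  - (\sum_a (r a * ln (pa a.1) + r a * ln (pb a.2))).
  congr (- _); apply: eq_bigr => -[a b] _ /=.
  have [->|nz] := eqVneq (r (a, b)) 0; first by rewrite !mul0r addr0.
  have rp : 0 < r (a, b) by rewrite lt_neqAle eq_sym nz r0.
  by rewrite lnM ?posrE ?mulrDr// (lt_le_trans rp).
rewrite big_split/= opprD lerD// /ent lerN2.
- rewrite (eq_bigr (fun x => r (x.1, x.2) * ln (pa x.1))); last by move=> [].
  rewrite -(pair_bigA _ (fun a b => r (a,b) * ln (pa a)))/=.
  by under [leRHS]eq_bigr do rewrite -mulr_suml.
- rewrite (eq_bigr (fun x => r (x.1, x.2) * ln (pb x.2))); last by move=> [].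
  rewrite -(pair_bigA _ (fun a b => r (a,b) * ln (pb b)))/= exchange_big/=.
  by under [leRHS]eq_bigr do rewrite -mulr_suml.
Qed.

Lemma fekete (a : nat -> R) :
  (forall m n, a (m + n)%N <= a m + a n) -> (forall n, 0 <= a n) ->
  exists l : R, ((fun n => a n / n%:R) @ \oo --> l) /\
    forall m, (0 < m)%N -> l <= a m / m%:R.
Proof.
move=> sub a0.
pose E := [set a m / m%:R | m in [set m | (0 < m)%N]].
have lbE : lbound E 0 by move=> _ [m /= m0 <-]; rewrite divr_ge0.
have hiE : has_inf E by split; [exists (a 1%N / 1%:R), 1%N | exists 0].
exists (inf E); split; last first.
  by move=> m m0; apply: ge_inf; [exists 0 | exists m].
apply/cvgrPdist_le => e e0.
have e20 : 0 < e / 2 by lra.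
have [_ [m /= m0 <-] hm] := inf_adherent e20 hiE.
have amn k i : a (k * m + i)%N <= k%:R * a m + a i.
  elim: k => [|k IH]; first by rewrite mul0n mul0r !add0r add0n.
  by rewrite mulSn -addnA (le_trans (sub _ _))// -(natr1 k) mulrDl mul1r; move: IH; lra.
(* [M] bounds the value of [a] at every remainder modulo [m], and [M / n] tends to 0. *)
pose M := \sum_(i < m) a i.
have aM i : (i < m)%N -> a i <= M.
  by move=> im; rewrite /M (bigD1 (Ordinal im))//= lerDl sumr_ge0.
have m0' : 0 < m%:R :> R by rewrite ltr0n.
near=> n.
have n0 : (0 < n)%N by near: n; exists 1%N.
have n0' : 0 < n%:R :> R by rewrite ltr0n.
have nM : M <= n%:R * (e / 2).
  rewrite -ler_pdivrMr//; near: n; exact: nbhs_infty_ger.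
have infn : inf E <= a n / n%:R by apply: ge_inf; [exists 0 | exists n].
rewrite ler_distlC; apply/andP; split; first by lra.
rewrite ler_pdivrMr// {1}(divn_eq n m).
have h1 := amn (n %/ m)%N (n %% m)%N; have h2 := aM _ (ltn_pmod n m0).
have h3 : (n %/ m)%:R * a m <= n%:R * (a m / m%:R).
  rewrite mulrA ler_pdivlMr// -mulrA (mulrC (a m)) mulrA ler_wpM2r//.
  by rewrite -natrM ler_nat leq_divM.
have h4 : n%:R * (a m / m%:R) <= n%:R * (inf E + e / 2).
  by apply: ler_wpM2l; rewrite ?ltW.
lra.
Unshelve. all: by end_near. Qed.

Lemma sum_ffun_prod (A : finType) n (F : 'I_n -> A -> R) :
  \sum_(s : {ffun 'I_n -> A}) \prod_i F i (s i) = \prod_i \sum_a F i a.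
Proof. by rewrite bigA_distr_bigA. Qed.

Lemma second_moment (A : finType) (p g : A -> R) N :
  \sum_a p a = 1 -> \sum_a p a * g a = 0 ->
  \sum_(s : {ffun 'I_N -> A}) (\prod_i p (s i)) * (\sum_i g (s i)) ^+ 2 =
  N%:R * \sum_a p a * g a ^+ 2.
Proof.
move=> p1 pg.
(* Writing the two factors [g] through indicators of [k == i] and [k == j] makes each term a product
   over coordinates, so the sum over [s] factorises; off the diagonal a factor
   [\sum_a p a * g a = 0] appears. *)
transitivity (\sum_(i < N) \sum_(j < N) \sum_(s : {ffun 'I_N -> A})
   \prod_k (p (s k) * (if k == i then g (s k) else 1) * (if k == j then g (s k) else 1))).
  under [RHS]eq_bigr do rewrite exchange_big/=.
  rewrite [RHS]exchange_big/=; apply: eq_bigr => s _.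
  rewrite expr2 mulr_suml mulr_sumr; apply: eq_bigr => i _.
  rewrite mulrCA mulr_sumr mulr_sumr; apply: eq_bigr => j _.
  rewrite !big_split/= -!big_mkcond/= !big_pred1_eq; ring.
transitivity (\sum_(i < N) \sum_a p a * g a ^+ 2); last first.
  by rewrite sumr_const card_ord mulr_natl.
apply: eq_bigr => i _; rewrite (bigD1 i)//= [X in _ + X]big1 ?addr0; last first.
  move=> j ji; rewrite (sum_ffun_prod (fun k a => p a * (if k == i then g a else 1) * (if k == j then g a else 1))).
  rewrite (bigD1 i)//= eqxx eq_sym (negbTE ji).
  by under eq_bigr do rewrite mulr1; rewrite pg mul0r.
rewrite (sum_ffun_prod (fun k a => p a * (if k == i then g a else 1) * (if k == i then g a else 1))).
rewrite (bigD1 i)//= eqxx [X in _ * X]big1 ?mulr1.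
  by apply: eq_bigr => a _; rewrite expr2 mulrA.
by move=> k /negbTE ->; under eq_bigr do rewrite !mulr1.
Qed.

Lemma chebyshev_ffun (A : finType) (p g : A -> R) N (e : R) :
  0 < e -> (0 < N)%N -> (forall a, 0 <= p a) -> \sum_a p a = 1 ->
  \sum_(s : {ffun 'I_N -> A} |
      N%:R * e < `|\sum_i g (s i) - N%:R * \sum_a p a * g a|) \prod_i p (s i) <=
  (\sum_a p a * (g a - \sum_b p b * g b) ^+ 2) / e ^+ 2 / N%:R.
Proof.
move=> e0 N0 p0 p1; set m := \sum_b p b * g b.
have N0' : 0 < N%:R :> R by rewrite ltr0n.
pose g' a := g a - m.
have pg' : \sum_a p a * g' a = 0.
  under eq_bigr do rewrite mulrBr; rewrite sumrB -mulr_suml p1 mul1r; exact: subrr.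
have := second_moment N p1 pg'; rewrite /g' => sm.
rewrite -mulrA -invfM ler_pdivlMr ?mulr_gt0 ?exprn_gt0//.
rewrite -(ler_pM2l N0') -sm -ler_pdivlMl//.
rewrite [X in _ <= X](_ : _ = \sum_(s : {ffun 'I_N -> A})
  N%:R^-1 * ((\prod_i p (s i)) * (\sum_i (g (s i) - m)) ^+ 2)); last by rewrite mulr_sumr.
rewrite mulr_suml [X in X <= _]big_mkcond/=; apply: ler_sum => s _.
have w0 : 0 <= \prod_i p (s i) by apply: prodr_ge0.
case: ifPn => [h|_]; last first.
  by apply: mulr_ge0; [rewrite invr_ge0 | apply: mulr_ge0; [|exact: sqr_ge0]].
rewrite [leRHS]mulrCA ler_wpM2l// ler_pdivlMl// sumrB sumr_const card_ord -[m *+ N]mulr_natl.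
rewrite -[X in _ <= X]real_normK ?num_real//.
have -> : N%:R * (e ^+ 2 * N%:R) = (N%:R * e) ^+ 2 by ring.
apply: lerXn2r; [|exact: normr_ge0|exact: ltW].
by rewrite nnegrE ltW// mulr_gt0.
Qed.

Lemma ln_prod (I : finType) (F : I -> R) : (forall i, 0 < F i) ->
  ln (\prod_i F i) = \sum_i ln (F i).
Proof.
move=> F0; suff: 0 < \prod_i F i /\ ln (\prod_i F i) = \sum_i ln (F i) by case.
apply: (big_rec2 (fun x y => 0 < x /\ ln x = y)); first by rewrite ln1.
by move=> i x y _ [x0 <-]; rewrite mulr_gt0// lnM ?posrE.
Qed.

(** Asymptotic equipartition. The weak law is applied at once to every [g j] and to the information
    function [- ln p], filed under [None]. The sequences obeying all bounds carry at least half of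
    the mass, and each has mass at most [expR (- (N%:R * (ent p - e)))]. *)
Lemma typical_count (A J : finType) (p : A -> R) (g : J -> A -> R) (e : R) :
  0 < e -> (forall a, 0 <= p a) -> \sum_a p a = 1 ->
  exists N0, forall N, (N0 <= N)%N -> exists X : {set {ffun 'I_N -> A}},
    [/\ forall s, s \in X -> forall i, 0 < p (s i),
       forall s, s \in X -> forall j,
         `|\sum_i g j (s i) - N%:R * \sum_a p a * g j a| <= N%:R * e &
       expR (N%:R * (ent p - e)) <= 2 * #|X|%:R].
Proof.
move=> e0 p0 p1.
pose h (o : option J) a := if o is Some j then g j a else - ln (p a).
pose V o := \sum_a p a * (h o a - \sum_b p b * h o b) ^+ 2.
(* From here on the Chebyshev bounds, summed over all observables, stay below 1/2. *)
pose N0 := (Num.truncn (2 * (\sum_o V o / e ^+ 2))).+1.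
exists N0 => N NN0.
have V0 o : 0 <= V o by apply: sumr_ge0 => a _; rewrite mulr_ge0 ?sqr_ge0.
have N0' : (0 < N)%N by apply: leq_trans NN0.
have NR : 0 < N%:R :> R by rewrite ltr0n.
have NV : 2 * (\sum_o V o / e ^+ 2) <= N%:R.
  by apply/ltW/(lt_le_trans (truncnS_gt _)); rewrite ler_nat.
pose bad o (s : {ffun 'I_N -> A}) :=
  N%:R * e < `|\sum_i h o (s i) - N%:R * \sum_a p a * h o a|.
pose wt (s : {ffun 'I_N -> A}) := \prod_i p (s i).
have wt0 s : 0 <= wt s by apply: prodr_ge0.
have wt1 : \sum_s wt s = 1.
  by rewrite /wt (sum_ffun_prod (fun _ => p)) big1.
have badw : \sum_(s | [exists o, bad o s]) wt s <= 1 / 2.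
  apply: (@le_trans _ _ (\sum_o \sum_(s | bad o s) wt s)).
    rewrite (exchange_big_dep xpredT)//= [X in X <= _]big_mkcond/=.
    apply: ler_sum => s _; case: ifPn => [/existsP[i bi]|_]; last exact: sumr_ge0.
    by rewrite (bigD1 i)//= lerDl sumr_ge0.
  apply: (@le_trans _ _ (\sum_o V o / e ^+ 2 / N%:R)).
    by apply: ler_sum => o _; exact: chebyshev_ffun.
  by rewrite -mulr_suml ler_pdivrMr//; move: NV; lra.
exists [set s : {ffun 'I_N -> A} | ~~ [exists o, bad o s] && [forall i, 0 < p (s i)]]%SET; split.
- by move=> s; rewrite inE => /andP[_ /forallP].
- move=> s; rewrite inE => /andP[+ _] j; rewrite negb_exists => /forallP/(_ (Some j)).
  by rewrite /bad -leNgt.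
set X := finset _.
have wX : 1 / 2 <= \sum_(s in X) wt s.
  have : \sum_s wt s <= \sum_(s | [exists o, bad o s]) wt s + \sum_(s in X) wt s.
    rewrite [in X in _ <= X]big_mkcond [in X in _ <= _ + X]big_mkcond/= -big_split/=.
    apply: ler_sum => s _; rewrite inE.
    case: ifPn => /= b; first by rewrite addr0.
    case: ifPn => [_|]; first by rewrite add0r.
    rewrite negb_forall => /existsP[i]; rewrite -leNgt => pi0.
    by rewrite addr0 /wt (bigD1 i)//= (_ : p (s i) = 0) ?mul0r//; apply/eqP; rewrite eq_le pi0 p0.
  by rewrite wt1; lra.
have wle s : s \in X -> wt s <= expR (- (N%:R * (ent p - e))).
  rewrite inE => /andP[nb /forallP pp].
  have wp : 0 < wt s by apply: prodr_gt0.
  rewrite -[wt s]lnK ?posrE// ler_expR.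
  have -> : ln (wt s) = - \sum_i h None (s i).
    by rewrite /wt /= sumrN opprK ln_prod.
  move: nb; rewrite negb_exists => /forallP/(_ None); rewrite /bad -leNgt.
  have -> : \sum_a p a * h None a = ent p.
    by rewrite /ent -sumrN; apply: eq_bigr => a _; rewrite mulrN.
  by rewrite ler_norml => /andP[]; lra.
have : 1 / 2 <= #|X|%:R * expR (- (N%:R * (ent p - e))).
  apply: le_trans wX _; apply: le_trans (ler_sum _ wle) _.
  by rewrite sumr_const -[leLHS]mulr_natl.
by rewrite expRN ler_pdivlMr ?expR_gt0//; lra.
Qed.

(** * Counting words by means of a kernel *)

Section WordCount.
Variable (A : finType) (a0 : A) (q : nat).

Fixpoint allwords n : seq (seq A) :=
  if n is n'.+1 then [seq a :: s | a <- enum A, s <- allwords n'] else [:: [::]].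

Lemma mem_allwords n s : (s \in allwords n) = (size s == n).
Proof.
elim: n s => [|n IH] [|a s] //=.
  by apply/negbTE/allpairsP => -[[? ?] []].
rewrite eqSS -IH; apply/allpairsP/idP => [[[b t]/= [_ ts [_ ->]]]//|h].
by exists (a, s); rewrite mem_enum.
Qed.

Lemma allwords_uniq n : uniq (allwords n).
Proof.
elim: n => //= n IH; apply: allpairs_uniq => //; first exact: enum_uniq.
by move=> [a s] [b t] _ _ /= [-> ->].
Qed.

Definition blk m (s : seq A) : {ffun 'I_m -> A} := [ffun i : 'I_m => nth a0 s i].

Variable K : {ffun 'I_q.+1 -> A} -> R.

(** A Markov weight run backwards, to fit the recursion on lists: [K] weighs the first letter given
    the next [q], and the last [q] letters are uniform. *)
Fixpoint wordweight (s : seq A) : R :=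
  if s is a :: s' then
    (if (size s' < q)%N then #|A|%:R^-1 else K (blk q.+1 s)) * wordweight s'
  else 1.

Hypothesis K0 : forall w, 0 < K w.
Hypothesis K1 : forall s, \sum_a K (blk q.+1 (a :: s)) <= 1.

Let A0 : (0 < #|A|)%N. Proof. by apply/card_gt0P; exists a0. Qed.

Lemma wordweight_gt0 s : 0 < wordweight s.
Proof.
elim: s => //= a s IH; rewrite mulr_gt0//; case: ifP => // _.
by rewrite invr_gt0 ltr0n.
Qed.

Lemma sum_wordweight n : \sum_(s <- allwords n) wordweight s <= 1.
Proof.
elim: n => [|n IH]; first by rewrite big_seq1.
rewrite /= big_flatten/= big_map; under eq_bigr do rewrite big_map/=.
rewrite exchange_big/=; apply: le_trans IH; apply: ler_sum => s _.
rewrite -mulr_suml -[leRHS]mul1r ler_wpM2r ?(ltW (wordweight_gt0 _))//.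
rewrite big_enum/=; have [_|_] := ltnP (size s) q; last exact: K1.
by rewrite sumr_const -[_ *+ _]mulr_natl divff// pnatr_eq0 -lt0n.
Qed.

Lemma ln_wordweight_short s : (size s <= q)%N ->
  ln (wordweight s) = - ((size s)%:R * ln #|A|%:R).
Proof.
elim: s => [|a s IH] /=; first by rewrite ln1 mul0r oppr0.
move=> sq; rewrite sq lnM ?posrE ?wordweight_gt0 ?invr_gt0 ?ltr0n// (IH (ltnW sq)).
by rewrite lnV ?posrE ?ltr0n// -(natr1 (size s)) mulrDl mul1r opprD addrC.
Qed.

Lemma ln_wordweight s : (q <= size s)%N -> ln (wordweight s) =
  \sum_(j < size s - q) ln (K (blk q.+1 (drop j s))) - q%:R * ln #|A|%:R.
Proof.
elim: s => [|a s IH] qs.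
  rewrite ln_wordweight_short//= sub0n big_ord0 add0r mul0r oppr0.
  by move: qs; rewrite leqn0 => /eqP ->; rewrite mul0r oppr0.
move: qs; rewrite leq_eqVlt => /orP[/eqP qs|qs].
  by rewrite ln_wordweight_short -?qs// subnn big_ord0 add0r.
have {}qs : (q <= size s)%N := qs.
rewrite /= ltnNge qs/= lnM ?posrE ?wordweight_gt0// IH// subSn// big_ord_recl/=.
by rewrite addrA.
Qed.

(** The weights of all words of length [n] add up to at most 1, and each word of [X] has weight at
    least [expR (- (c + q%:R * ln #|A|%:R))]. *)
Lemma word_count n (X : seq (seq A)) (c : R) : (q <= n)%N -> uniq X ->
  (forall s, s \in X -> size s = n /\
     \sum_(j < n - q) - ln (K (blk q.+1 (drop j s))) <= c) ->
  (size X)%:R <= expR (c + q%:R * ln #|A|%:R).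
Proof.
move=> qn uX hX.
suff h : (size X)%:R * expR (- (c + q%:R * ln #|A|%:R)) <= 1.
  by move: h; rewrite expRN ler_pdivrMr ?expR_gt0// mul1r.
apply: le_trans (sum_wordweight n).
apply: (@le_trans _ _ (\sum_(s <- X) wordweight s)).
  rewrite -sum1_size natr_sum mulr_suml big_seq [leRHS]big_seq.
  apply: ler_sum => s sX; have [sn hs] := hX _ sX.
  rewrite mul1r -[leRHS]lnK ?posrE ?wordweight_gt0// ler_expR ln_wordweight ?sn//.
  by move: hs; rewrite sumrN; lra.
rewrite (perm_big (seq.filter (mem X) (allwords n))); last first.
  apply: uniq_perm => //; first exact: filter_uniq (allwords_uniq n).
  move=> s; rewrite mem_filter mem_allwords; apply/idP/andP => [sX|[]//].
  by split=> //; case: (hX _ sX) => ->.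
rewrite big_filter big_mkcond/=; apply: ler_sum => s _.
by case: ifP => // _; exact/ltW/wordweight_gt0.
Qed.

End WordCount.
End FiniteEntropy.

(** * Entropy of finite partitions *)

Section FiniteLabels.
Variable R : realType.
Implicit Types (mu : {measure set R -> \bar R}) (A B : set R).

Definition pr mu A : R := fine (mu A).

Section Pr.
Variables (mu : {measure set R -> \bar R}) (mu1 : mu setT = 1%E).

Lemma prE A : measurable A -> mu A = (pr mu A)%:E.
Proof.
move=> mA; rewrite /pr fineK// ge0_fin_numE//.
by rewrite (@le_lt_trans _ _ (mu setT))// ?le_measure ?inE// mu1 ltry.
Qed.

Lemma pr_ge0 A : 0 <= pr mu A. Proof. exact: fine_ge0. Qed.

Lemma pr_setT : pr mu setT = 1. Proof. by rewrite /pr mu1. Qed.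

Lemma pr_set0 : pr mu set0 = 0. Proof. by rewrite /pr measure0. Qed.

Lemma prU A B : measurable A -> measurable B -> A `&` B = set0 ->
  pr mu (A `|` B) = pr mu A + pr mu B.
Proof.
move=> mA mB AB; apply: EFin_inj.
by rewrite EFinD -!prE ?measureU//; exact: measurableU.
Qed.

Lemma pr_le A B : measurable A -> measurable B -> A `<=` B -> pr mu A <= pr mu B.
Proof. by move=> mA mB AB; rewrite -lee_fin -!prE// le_measure ?inE. Qed.

Lemma pr_le1 A : measurable A -> pr mu A <= 1.
Proof. by move=> mA; rewrite -pr_setT pr_le. Qed.

Lemma prD A B : measurable A -> measurable B ->
  pr mu A = pr mu (A `&` B) + pr mu (A `\` B).
Proof.
move=> mA mB; rewrite -prU ?setUIDK//; [exact: measurableI|exact: measurableD|].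
by rewrite setDE setIACA setICr !setI0.
Qed.

Lemma prC A : measurable A -> pr mu (~` A) = 1 - pr mu A.
Proof.
move=> mA; have := prD measurableT mA; rewrite setTI setTD pr_setT; lra.
Qed.

Lemma prU_le A B : measurable A -> measurable B -> pr mu (A `|` B) <= pr mu A + pr mu B.
Proof.
move=> mA mB; rewrite (prD (measurableU _ _ mA mB) mA) setUK lerD2l.
apply: pr_le => //; first by apply: measurableD => //; exact: measurableU.
by rewrite setDUl setDv set0U; apply: subDsetl.
Qed.

End Pr.

(** A finite measurable partition is handled through its labelling function, so that joins are pairs
    of labels and preimages under iterates are compositions. *)
Definition mlab (K : finType) (X : R -> K) := forall a, measurable (X @^-1` [set a]).
Definition dist mu (K : finType) (X : R -> K) a : R := pr mu (X @^-1` [set a]).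

Lemma mlab_pred (K : finType) (X : R -> K) (P : pred K) : mlab X ->
  measurable [set x | P (X x)].
Proof.
move=> mX; rewrite (_ : [set x | _] = \bigcup_(a in [set a | P a]) (X @^-1` [set a])).
  by apply: fin_bigcup_measurable => // a _; exact: mX.
by apply/seteqP; split=> [x /= h|x [a /= h ->]//]; exists (X x).
Qed.

Lemma mlab_pair (K L : finType) (X : R -> K) (Y : R -> L) : mlab X -> mlab Y ->
  mlab (fun x => (X x, Y x)).
Proof.
move=> mX mY [a b]; have := measurableI _ _ (mX a) (mY b).
by congr measurable; apply/seteqP; split=> x /= [-> ->].
Qed.

Section Dist.
Variables (mu : {measure set R -> \bar R}) (mu1 : mu setT = 1%E).

Lemma pr_sum (K : finType) (X : R -> K) (P : pred K) A : mlab X -> measurable A ->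
  pr mu (A `&` [set x | P (X x)]) = \sum_(a | P a) pr mu (A `&` X @^-1` [set a]).
Proof.
move=> mX mA.
suff h : forall s : seq K, uniq s ->
   pr mu (A `&` [set x | X x \in s]) = \sum_(a <- s) pr mu (A `&` X @^-1` [set a]).
  rewrite -big_filter -h ?filter_uniq ?index_enum_uniq//; congr (pr mu (_ `&` _)).
  by apply/seteqP; split=> x /=; rewrite mem_filter mem_index_enum andbT.
elim=> [_|a s IH /= /andP[as_ us]].
  by rewrite big_nil (_ : _ `&` _ = set0) ?pr_set0//; apply/seteqP; split=> // x [].
rewrite big_cons -IH// -prU//.
- congr (pr mu _); rewrite -setIUr; congr (_ `&` _); apply/seteqP; split=> x /=.
    by rewrite inE => /orP[/eqP|]; [left|right].
  by case=> [->|xs]; rewrite inE ?eqxx// xs orbT.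
- by apply: measurableI => //; exact: mX.
- by apply: measurableI => //; exact: (mlab_pred (mem s) mX).
- by apply/seteqP; split=> // x /= [[_ ->] [_]]; exact/negP.
Qed.

Lemma pr_sumT (K : finType) (X : R -> K) (P : pred K) : mlab X ->
  pr mu [set x | P (X x)] = \sum_(a | P a) dist mu X a.
Proof.
move=> mX; rewrite -(setTI [set _ | _]) pr_sum//.
by apply: eq_bigr => a _; rewrite setTI.
Qed.

Lemma dist_ge0 (K : finType) (X : R -> K) a : 0 <= dist mu X a.
Proof. exact: pr_ge0. Qed.

Lemma dist_le1 (K : finType) (X : R -> K) a : mlab X -> dist mu X a <= 1.
Proof. by move=> mX; apply: pr_le1. Qed.

Lemma sum_dist (K : finType) (X : R -> K) : mlab X -> \sum_a dist mu X a = 1.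
Proof.
move=> mX; rewrite -(pr_setT mu1) -(pr_sumT xpredT mX); congr pr.
exact/seteqP.
Qed.

Lemma dist_comp (K L : finType) (X : R -> K) (f : K -> L) b : mlab X ->
  dist mu (f \o X) b = \sum_(a | f a == b) dist mu X a.
Proof.
move=> mX; rewrite -(pr_sumT (fun a => f a == b) mX); congr pr.
by apply/seteqP; split=> x /eqP.
Qed.

Lemma expect_comp (K L : finType) (X : R -> K) (f : K -> L) (F : L -> R) : mlab X ->
  \sum_a dist mu X a * F (f a) = \sum_b dist mu (f \o X) b * F b.
Proof.
move=> mX; rewrite (partition_big f xpredT)//=; apply: eq_bigr => b _.
by rewrite dist_comp// mulr_suml; apply: eq_bigr => a /eqP ->.
Qed.

Lemma ent_comp_le (K L : finType) (X : R -> K) (f : K -> L) : mlab X ->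
  ent (dist mu (f \o X)) <= ent (dist mu X).
Proof.
move=> mX; rewrite /ent lerN2 -(expect_comp f (fun b => ln (dist mu (f \o X) b)))//.
apply: ler_sum => a _; have [->|nz] := eqVneq (dist mu X a) 0; first by rewrite !mul0r.
have rp : 0 < dist mu X a by rewrite lt_neqAle eq_sym nz dist_ge0.
have le1 : dist mu X a <= dist mu (f \o X) (f a).
  by rewrite dist_comp// (bigD1 a)//= lerDl sumr_ge0// => *; exact: dist_ge0.
by apply: ler_wpM2l; rewrite ?ler_ln ?posrE ?dist_ge0// (lt_le_trans rp).
Qed.

Lemma dist_fst (K L : finType) (X : R -> K) (Y : R -> L) a : mlab X -> mlab Y ->
  \sum_b dist mu (fun x => (X x, Y x)) (a, b) = dist mu X a.
Proof.
move=> mX mY; rewrite -[RHS]/(dist mu (fst \o (fun x => (X x, Y x))) a) dist_comp//; last exact: mlab_pair.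
rewrite (reindex (fun b => (a, b)))/=; last first.
  by exists snd => // -[a' b] /=; rewrite inE/= => /eqP ->.
by apply: eq_bigl => b; rewrite /= eqxx.
Qed.

Lemma dist_snd (K L : finType) (X : R -> K) (Y : R -> L) b : mlab X -> mlab Y ->
  \sum_a dist mu (fun x => (X x, Y x)) (a, b) = dist mu Y b.
Proof.
move=> mX mY; rewrite -[RHS]/(dist mu (snd \o (fun x => (X x, Y x))) b) dist_comp//; last exact: mlab_pair.
rewrite (reindex (fun a => (a, b)))/=; last first.
  by exists fst => // -[a b'] /=; rewrite inE/= => /eqP ->.
by apply: eq_bigl => a; rewrite /= eqxx.
Qed.

Lemma ent_dist_pair (K L : finType) (X : R -> K) (Y : R -> L) : mlab X -> mlab Y ->
  ent (dist mu (fun x => (X x, Y x))) <= ent (dist mu X) + ent (dist mu Y).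
Proof.
move=> mX mY.
have h := @ent_pair_le R _ _ (dist mu (fun x => (X x, Y x))) (@dist_ge0 _ _)
  (sum_dist (mlab_pair mX mY)).
apply: (le_trans h).
rewrite (_ : (fun a => _) = dist mu X); last by apply/funext => a; exact: dist_fst.
by rewrite (_ : (fun b => _) = dist mu Y)//; apply/funext => b; exact: dist_snd.
Qed.

End Dist.

Definition word (T : R -> R) (K : finType) (X : R -> K) n (x : R) : {ffun 'I_n -> K} :=
  [ffun i : 'I_n => X (iter i T x)].

Lemma wordE T (K : finType) (X : R -> K) n x y :
  word T X n x = word T X n y <-> forall i, (i < n)%N -> X (iter i T x) = X (iter i T y).
Proof.
split=> [/ffunP h i ilt|h]; first by have := h (Ordinal ilt); rewrite !ffunE.
by apply/ffunP => i; rewrite !ffunE; exact: h.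
Qed.

Lemma word_le T (K : finType) (X : R -> K) m n x y : (m <= n)%N ->
  word T X n x = word T X n y -> word T X m x = word T X m y.
Proof.
by move=> mn /wordE h; apply/wordE => i im; apply: h; exact: leq_trans mn.
Qed.

Lemma word_shift T (K : finType) (X : R -> K) m n x y :
  word T X (n + m) x = word T X (n + m) y ->
  word T X n (iter m T x) = word T X n (iter m T y).
Proof.
move=> /wordE h; apply/wordE => i im; rewrite -!iterD; apply: h.
by rewrite ltn_add2r.
Qed.

Section Dynamics.
Variables (mu : {measure set R -> \bar R}) (mu1 : mu setT = 1%E).
Variables (T : R -> R) (mT : forall A, measurable A -> measurable (T @^-1` A)).

Lemma measurable_iter n A : measurable A -> measurable (iter n T @^-1` A).
Proof.
elim: n A => [|n IH] A mA //.
exact: (IH _ (mT mA)).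
Qed.

Lemma mlab_iter (K : finType) (X : R -> K) n : mlab X -> mlab (X \o iter n T).
Proof. by move=> mX a; exact: (measurable_iter n (mX a)). Qed.

Lemma mlab_word (K : finType) (X : R -> K) n : mlab X -> mlab (word T X n).
Proof.
move=> mX w.
rewrite (_ : _ @^-1` _ = \bigcap_(i in [set: 'I_n]) ((X \o iter i T) @^-1` [set w i])).
  by apply: fin_bigcap_measurable => // i _; exact: mlab_iter.
apply/seteqP; split=> [x /= <- i _ /=|x h]; first by rewrite ffunE.
by apply/ffunP => i; rewrite ffunE; exact: h.
Qed.

Lemma measurable_word (K : finType) (X : R -> K) n (P : pred {ffun 'I_n -> K}) :
  mlab X -> measurable [set x | P (word T X n x)].
Proof. by move=> mX; apply: mlab_pred; exact: mlab_word. Qed.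

Hypothesis muT : Defs.invariant T mu.

Lemma invariant_iter n A : measurable A -> mu (iter n T @^-1` A) = mu A.
Proof.
elim: n A => [|n IH] A mA //.
by rewrite -(muT mA) -(IH _ (mT mA)).
Qed.

Lemma dist_iter (K : finType) (X : R -> K) n : mlab X ->
  dist mu (X \o iter n T) = dist mu X.
Proof.
by move=> mX; apply/funext => a; rewrite /dist /pr -(invariant_iter n (mX a)).
Qed.

Section Label.
Variables (K : finType) (X : R -> K) (mX : mlab X).

Definition wordent n := ent (dist mu (word T X n)).

(** A word of length [m + n] is a function of its first [m] letters and of the [n]-word at time [m],
    whose law is that at time 0 by invariance. *)
Lemma wordent_sub m n : wordent (m + n) <= wordent m + wordent n.
Proof.
rewrite /wordent -[X in _ <= _ + X](_ : ent (dist mu (word T X n \o iter m T)) = _); last first.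
  by rewrite dist_iter//; exact: mlab_word.
have mW := @mlab_word _ _ n mX; have mW' := @mlab_iter _ _ m mW.
apply: le_trans (ent_dist_pair mu1 (@mlab_word _ _ m mX) mW').
pose f (u : {ffun 'I_m -> K} * {ffun 'I_n -> K}) : {ffun 'I_(m + n) -> K} :=
  [ffun i => match fintype.split i with inl a => u.1 a | inr b => u.2 b end].
have -> : word T X (m + n) = f \o (fun x => (word T X m x, (word T X n \o iter m T) x)).
  apply/funext => x; apply/ffunP => i; rewrite !ffunE; case: splitP => j ->.
    by rewrite ffunE.
  by rewrite ffunE/= -iterD addnC.
by apply: ent_comp_le => //; apply: mlab_pair => //; exact: mlab_word.
Qed.

Lemma wordent_ge0 n : 0 <= wordent n.
Proof.
apply: ent_ge0 => w; first exact: dist_ge0.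
by apply: dist_le1 => //; exact: mlab_word.
Qed.

Lemma wordent_cvg : exists l : R, ((fun n => wordent n / n%:R) @ \oo --> l) /\
    forall m, (0 < m)%N -> l <= wordent m / m%:R.
Proof. exact: (fekete wordent_sub wordent_ge0). Qed.

End Label.
End Dynamics.

Lemma mpartition_label k (P : 'I_k -> set R) : mpartition P ->
  exists X : R -> 'I_k, mlab X /\ forall i, P i = X @^-1` [set i].
Proof.
move=> [mP [dP eP]]; have [X hX] := choice eP.
have PE i : P i = X @^-1` [set i].
  apply/seteqP; split=> [x Px|x /= <-]//=.
  apply: contrapT => /eqP/dP h.
  have : (P (X x) `&` P i) x by [].
  by rewrite h.
by exists X; split=> // i; rewrite -PE.
Qed.

Lemma label_mpartition k (X : R -> 'I_k) : mlab X -> mpartition (fun i => X @^-1` [set i]).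
Proof.
move=> mX; split=> //; split=> [i j ij|x]; last by exists (X x).
by apply/seteqP; split=> // x /= [-> /eqP]; rewrite (negbTE ij).
Qed.

Lemma Hn_wordent mu T k (X : R -> 'I_k) n :
  Hn T mu (fun i => X @^-1` [set i]) n = wordent mu T X n.
Proof.
rewrite /Hn /wordent /ent; congr (- _); apply: eq_bigr => w _ /=.
have -> : cell T (fun i => X @^-1` [set i]) w = word T X n @^-1` [set w].
  apply/seteqP; split=> x /=.
    by move=> h; apply/ffunP => i; rewrite ffunE; exact: h.
  by move=> <- i; rewrite ffunE.
by case: eqP => // h; rewrite /dist /pr h mul0r.
Qed.

End FiniteLabels.

(** * Generators and the Kolmogorov-Sinai theorem *)

Section Generator.
Variable R : realType.
Implicit Types (A B : set R) (d x y : R).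
Variables (T : R -> R) (mT : forall A : set R, measurable A -> measurable (T @^-1` A)).
Variables (L : finType) (D : R -> L) (mD : mlab D).

(** Generation in metric form: cells shrink uniformly. It is asked only on [[0,1]], where the
    measures live. *)
Definition generating := forall e : R, 0 < e -> exists k0, forall k, (k0 <= k)%N ->
  forall x y, 0 <= x <= 1 -> 0 <= y <= 1 -> word T D k x = word T D k y -> `|x - y| < e.
Hypothesis gen : generating.

(** [U a k] is the union of the [k]-cells whose trace on [[0,1]] lies left of [a]: an inner
    approximation of the ray by cylinders. *)
Let inray (a : R) k : pred {ffun 'I_k -> L} :=
  fun w => `[< forall y, 0 <= y <= 1 -> word T D k y = w -> y < a >].
Let U a k := [set x | inray a (word T D k x)].

Let mU a k : measurable (U a k). Proof. exact: measurable_word. Qed.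
Let mray (a : R) : measurable `]-oo, a[. Proof. exact: measurable_itv. Qed.
Let m01 : measurable (`[0, 1] : set R). Proof. exact: measurable_itv. Qed.

Section One.
Variables (nu : {measure set R -> \bar R}) (nu01 : prob01 nu).
Let nu1 := nu01.1.

Lemma pr_out A : measurable A -> A `&` `[0, 1] = set0 -> pr nu A = 0.
Proof.
move=> mA A0; apply/eqP; rewrite eq_le pr_ge0 andbT.
rewrite -(_ : pr nu (~` `[0, 1]) = 0); last by rewrite /pr nu01.2.
apply: pr_le => //; first exact: measurableC.
by move=> x Ax I; have : (A `&` `[0, 1]) x by []; rewrite A0.
Qed.

Lemma pr_eq01 A B : measurable A -> measurable B ->
  (forall x, 0 <= x <= 1 -> A x <-> B x) -> pr nu A = pr nu B.
Proof.
move=> mA mB AB; rewrite (prD nu1 mA m01) (prD nu1 mB m01).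
rewrite !(@pr_out (_ `\` _)) ?setDE; try exact: measurableI _ (measurableC _);
  try by rewrite -setIA setICl setI0.
congr (pr nu _ + _); apply/seteqP; split=> x [h1 h2]; split=> //;
by move: (h2); rewrite /= in_itv/= => x01; apply/(AB x x01).
Qed.

(** A point [x < a] leaves the difference as soon as the cells are shorter than [a - x]; hence the
    differences decrease to the empty set on [[0,1]]. *)
Lemma ray_minus_U a (d : R) : 0 < d -> exists k0, forall k, (k0 <= k)%N ->
  pr nu (`]-oo, a[ `\` U a k) <= d.
Proof.
move=> d0; pose F k := (`]-oo, a[ `&` `[0, 1]) `\` U a k.
have mF k : measurable (F k) by apply: measurableD => //; exact: measurableI.
have F0 : \bigcap_k F k = set0.
  apply/seteqP; split=> // x Fx.
  have [[/=]] := Fx 0%N I; rewrite in_itv/= => xa; rewrite in_itv/= => x01 _.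
  have [k0 hk] := gen (e := a - x) ltac:(by rewrite subr_gt0).
  have [_] := Fx k0 I; apply; rewrite /U/=; apply/asboolP => y y01 wxy.
  by have := hk k0 (leqnn _) y x y01 x01 wxy; rewrite ltr_norml; lra.
have niF : nonincreasing_seq F.
  move=> k k' kk'; apply/subsetPset => x [xa nU]; split=> // Uk; apply: nU.
  rewrite /U/=; apply/asboolP => y y01 wy; move/asboolP : Uk; apply => //.
  exact: word_le wy.
have cF : nu \o F @ \oo --> 0%:E.
  rewrite -[0%:E]/0%E -(measure0 nu) -F0; apply: nonincreasing_cvg_mu => //.
  - by rewrite prE// ltry.
  - exact: bigcapT_measurable.
have /fine_cvgP[_ /cvgrPdist_le/(_ _ d0)[k0 _ hk0]] := cF.
exists k0 => k kk0; have := hk0 k kk0; rewrite sub0r normrN/=.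
rewrite (_ : pr nu _ = pr nu (F k)); first by rewrite ger0_norm ?pr_ge0.
apply: pr_eq01 => //; first exact: measurableD.
move=> x x01; rewrite /F/=; split=> -[h1 h2]; split=> //; by [case: h1 | split=> //; rewrite /= in_itv].
Qed.

Lemma pr_U_minus_ray a k : pr nu (U a k `\` `]-oo, a[) = 0.
Proof.
apply: pr_out; first exact: measurableD.
apply/seteqP; split=> // x [[/asboolP Ux nx]]; rewrite /= in_itv/= => x01; apply: nx.
by rewrite /= in_itv/=; exact: Ux.
Qed.

Lemma pr_ray_approx a (d : R) : 0 < d -> exists k0, forall k, (k0 <= k)%N ->
  `|pr nu `]-oo, a[ - pr nu (U a k)| <= d.
Proof.
move=> d0; have [k0 hk0] := @ray_minus_U a _ d0; exists k0 => k /hk0.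
rewrite (prD nu1 (mray a) (mU a k)) [X in _ - X](prD nu1 (mU a k) (mray a)).
rewrite pr_U_minus_ray (setIC (U a k)) addr0 [X in `|X|]addrC addKr.
by rewrite ger0_norm ?pr_ge0.
Qed.

(** Mass of the symmetric difference between [A] and the best approximating union of [k]-cells, each
    cell being assigned by majority. *)
Definition defect (A : set R) k : R :=
  \sum_w Num.min (pr nu (A `&` word T D k @^-1` [set w]))
                 (pr nu (~` A `&` word T D k @^-1` [set w])).

Let cls : set (set R) := [set A | measurable A /\ forall d : R, 0 < d ->
  exists k0, forall k, (k0 <= k)%N -> defect A k <= d].

Let mW k := @mlab_word R T mT L D k mD.

Let defect_ray a : cls `]-oo, a[%classic.
Proof.
split=> // d d0; have [k0 hk0] := @ray_minus_U a _ d0; exists k0 => k /hk0.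
apply: le_trans.
apply: (@le_trans _ _ (\sum_w
    ((if inray a w then pr nu (~` `]-oo, a[ `&` word T D k @^-1` [set w]) else 0) +
     if ~~ inray a w then pr nu (`]-oo, a[ `&` word T D k @^-1` [set w]) else 0))).
  by apply: ler_sum => w _; case: ifP => _; rewrite ?addr0 ?add0r ge_min lexx ?orbT.
rewrite big_split/= -!big_mkcond/= -!pr_sum//; last exact: measurableC.
rewrite (setIC (~` _)) -setDE pr_U_minus_ray add0r.
apply: pr_le => //; [|exact: measurableD|by move=> x [? /negP]].
by apply: measurableI => //; exact: (@measurable_word _ _ mT _ _ _ (fun w => ~~ inray a w)).
Qed.

Let defectC A k : defect (~` A) k = defect A k.
Proof. by apply: eq_bigr => w _; rewrite setCK minC. Qed.

Let defectU A B k : measurable A -> measurable B ->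
  defect (A `|` B) k <= defect A k + defect B k.
Proof.
move=> mA mB; rewrite -big_split/=; apply: ler_sum => w _.
have mw := @mW k w; have mIA E : measurable E -> measurable (E `&` word T D k @^-1` [set w]).
  by move=> mE; exact: measurableI.
have mCA := measurableC mA; have mCB := measurableC mB.
have h1 : pr nu ((A `|` B) `&` word T D k @^-1` [set w]) <=
    pr nu (A `&` word T D k @^-1` [set w]) + pr nu (B `&` word T D k @^-1` [set w]).
  by rewrite setIUl; apply: prU_le => //; exact: mIA.
have h2 : pr nu (~` (A `|` B) `&` word T D k @^-1` [set w]) <=
    pr nu (~` A `&` word T D k @^-1` [set w]).
  apply: pr_le => //; [apply: mIA; apply: measurableC; exact: measurableU|exact: mIA|].
  by apply: setSI; rewrite setCU; exact: subIsetl.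
have h3 : pr nu (~` (A `|` B) `&` word T D k @^-1` [set w]) <=
    pr nu (~` B `&` word T D k @^-1` [set w]).
  apply: pr_le => //; [apply: mIA; apply: measurableC; exact: measurableU|exact: mIA|].
  by apply: setSI; rewrite setCU; exact: subIsetr.
have := pr_ge0 nu (A `&` word T D k @^-1` [set w]).
have := pr_ge0 nu (B `&` word T D k @^-1` [set w]).
have := pr_ge0 nu (~` A `&` word T D k @^-1` [set w]).
have := pr_ge0 nu (~` B `&` word T D k @^-1` [set w]).
rewrite /Num.min; repeat case: ifP => ?; lra.
Qed.

Let defect_le A k : measurable A -> defect A k <= pr nu A.
Proof.
move=> mA; rewrite -[X in pr nu X]setIT.
rewrite (_ : [set: R] = [set x | (fun=> true) (word T D k x)]); last exact/seteqP.
rewrite (pr_sum nu1 (fun=> true) (@mW k) mA).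
by apply: ler_sum => w _; rewrite ge_min lexx.
Qed.

Let cls_sigma : sigma_algebra setT cls.
Proof.
split.
- split=> // d d0; exists 0%N => k _; apply: le_trans (defect_le _ _) _ => //.
  by rewrite pr_set0 ltW.
- by move=> A [mA hA]; rewrite setTD; split; [exact: measurableC|move=> d /hA[k0 h];
    exists k0 => k /h; rewrite defectC].
- move=> F cF; have mF n : measurable (F n) by case: (cF n).
  have mUF : measurable (\bigcup_n F n) by exact: bigcupT_measurable.
  split=> // d d0; have d20 : 0 < d / 2 by lra.
  (* A finite union exhausts all but [d / 2] of the mass; the rest contributes at most its own mass
     by [defect_le]. *)
  pose G n := \bigcup_(i < n) F i.
  have mG n : measurable (G n) by apply: bigcup_measurable.
  have GU : \bigcup_n G n = \bigcup_n F n.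
    apply/seteqP; split=> [x [n _ [i _ Fi]]|x [n _ Fn]]; first by exists i.
    by exists n.+1 => //; exists n => //=.
  have ndG : nondecreasing_seq G.
    move=> n n' nn'; apply/subsetPset => x [i /= ilt Fi]; exists i => //=.
    exact: leq_trans nn'.
  have cG : nu \o G @ \oo --> (pr nu (\bigcup_n F n))%:E.
    by rewrite -prE// -GU; apply: nondecreasing_cvg_mu => //; rewrite GU.
  have /fine_cvgP[_ /cvgrPdist_le/(_ _ d20)[n _ hn]] := cG.
  have {}hn : pr nu (\bigcup_n F n `\` G n) <= d / 2.
    have := hn n (leqnn _); rewrite /= ger0_norm.
      rewrite (prD nu1 mUF (mG n)) setIidr -/(pr nu (G n)); first by lra.
      by rewrite -GU => x ?; exists n.
    rewrite subr_ge0; apply: pr_le => //.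
    by rewrite -GU => x ?; exists n.
  have hG : exists k0, forall k, (k0 <= k)%N -> defect (G n) k <= d / 2.
    elim: n {hn} (d / 2) d20 => [|n IH] e e0.
      exists 0%N => k _; apply: le_trans (defect_le _ _) _ => //.
      by rewrite (_ : G 0%N = set0) ?pr_set0 ?ltW//; apply/seteqP; split=> // x [].
    have e20 : 0 < e / 2 by lra.
    have [k1 h1] := IH _ e20; have [_ /(_ _ e20)[k2 h2]] := cF n.
    exists (maxn k1 k2) => k; rewrite geq_max => /andP[/h1 ? /h2 ?].
    rewrite (_ : G n.+1 = G n `|` F n); first by have := defectU k (mG n) (mF n); lra.
    apply/seteqP; split=> [x [i /= + Fi]|x [[i /= ilt Fi]|Fn]].
    + by rewrite ltnS leq_eqVlt => /orP[/eqP <-|ilt]; [right|left; exists i].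
    + by exists i => //=; exact: ltnW.
    + by exists n => //=.
  have [k0 h0] := hG; exists k0 => k /h0 hk.
  have mDG : measurable (\bigcup_n F n `\` G n) by exact: measurableD.
  have := defectU k (mG n) mDG; rewrite (_ : _ `|` _ = \bigcup_n F n).
    by have := defect_le k mDG; lra.
  by rewrite setDUK// -GU => x ?; exists n.
Qed.

(** The sets approximable by cells form a sigma-algebra that contains the rays. *)
Lemma defect_cvg0 A : measurable A -> forall d, 0 < d ->
  exists k0, forall k, (k0 <= k)%N -> defect A k <= d.
Proof.
move=> mA; suff : cls A by case.
have : (@ocitv R).-sigma.-measurable A := mA; rewrite RGenInftyO.measurableE.
by apply: (smallest_sub cls_sigma) => _ [x ->]; exact: defect_ray.
Qed.

End One.

(** Rays are limits in measure of unions of cells, and they form a generating pi-system. *)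
Lemma prob01_eq_words (mu nu : {measure set R -> \bar R}) : prob01 mu -> prob01 nu ->
  (forall k w, mu (word T D k @^-1` [set w]) = nu (word T D k @^-1` [set w])) ->
  forall A, measurable A -> mu A = nu A.
Proof.
move=> mu01 nu01 h.
have hray a : mu `]-oo, a[%classic = nu `]-oo, a[%classic.
  rewrite (prE mu01.1 (mray a)) (prE nu01.1 (mray a)); congr EFin; apply/eqP; rewrite -subr_eq0 -normr_le0.
  apply/ler_addgt0Pl => d d0; rewrite addr0; have d20 : 0 < d / 2 by lra.
  have [k1 /(_ (maxn k1 _) (leq_maxl _ _)) h1] := pr_ray_approx mu01 a d20.
  have [k2 /(_ _ (leq_maxr k1 _)) h2] := pr_ray_approx nu01 a d20.
  move: (h1 k2) h2.
  have -> : pr mu (U a (maxn k1 k2)) = pr nu (U a (maxn k1 k2)).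
    rewrite (pr_sumT mu01.1 (@inray a _) (mlab_word mT mD)) (pr_sumT nu01.1 (@inray a _) (mlab_word mT mD)).
    by apply: eq_bigr => w _; rewrite /dist /pr h.
  by rewrite !ler_norml; lra.
move=> A mA; have : (@ocitv R).-sigma.-measurable A := mA; rewrite RGenInftyO.measurableE.
apply: (@g_sigma_algebra_measure_unique _ _ _ (@RGenInftyO.G R) _ (fun n => `]-oo, n%:R[%classic)).
- by move=> _ [x ->].
- by move=> n; exists n%:R.
- apply/seteqP; split=> // x _; exists (Num.truncn x).+1 => //=.
  by rewrite in_itv/= truncnS_gt.
- move=> _ _ [x ->] [y ->]; exists (Num.min x y).
  by apply/seteqP; split=> z /=; rewrite !in_itv/= lt_min => /andP.
- by move=> _ [x ->].
- by move=> n; rewrite (prE mu01.1) ?ltry.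
Qed.

(** * Comparison of an arbitrary partition with the generator *)

Section Kolmogorov_Sinai.
Variables (mu : {measure set R -> \bar R}) (mu01 : prob01 mu).
Hypothesis muT : Defs.invariant T mu.
Let mu1 := mu01.1.
Variables (K : finType) (X : R -> K) (mX : mlab X).

Let XW k x := (X x, word T D k x).
Let mW k : mlab (word T D k). Proof. exact: mlab_word. Qed.
Let mXW k : mlab (XW k). Proof. by apply: mlab_pair => //; exact: mW. Qed.

Let K0 : (0 < #|K|)%N. Proof. by apply/card_gt0P; exists (X 0). Qed.

(** Conditional law of the label given the [k]-word; on null words the uniform law keeps it a
    probability vector. *)
Definition condprob k (aw : K * {ffun 'I_k -> L}) : R :=
  if dist mu (word T D k) aw.2 == 0 then #|K|%:R^-1
  else dist mu (XW k) aw / dist mu (word T D k) aw.2.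

Definition condent k : R := - \sum_aw dist mu (XW k) aw * ln (condprob aw).

Let XW_le k a w : dist mu (XW k) (a, w) <= dist mu (word T D k) w.
Proof.
rewrite -(dist_snd mu1 w mX (@mW k)) (bigD1 a)//= lerDl sumr_ge0// => *; exact: dist_ge0.
Qed.

Let cond_ge0 k (aw : K * {ffun 'I_k -> L}) : 0 <= condprob aw.
Proof.
by rewrite /condprob; case: ifP => _; rewrite ?invr_ge0// divr_ge0 ?dist_ge0.
Qed.

Let sum_cond k (w : {ffun 'I_k -> L}) : \sum_a condprob (a, w) = 1.
Proof.
rewrite /condprob/=; have [_|nz] := eqVneq (dist mu (word T D k) w) 0.
  by rewrite sumr_const -[_ *+ _]mulr_natl divff// pnatr_eq0 -lt0n.
by rewrite -mulr_suml (dist_snd mu1 w mX (@mW k)) divff.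
Qed.

Let cond_eq0 k (aw : K * {ffun 'I_k -> L}) : condprob aw = 0 -> dist mu (XW k) aw = 0.
Proof.
case: aw => a w; rewrite /condprob/=; case: eqP => [_ /eqP|/eqP nz /eqP].
  by rewrite invr_eq0 pnatr_eq0 gtn_eqF.
by rewrite mulf_eq0 invr_eq0 (negbTE nz) orbF => /eqP.
Qed.

Definition window m j k (v : {ffun 'I_m -> L}) : {ffun 'I_k -> L} :=
  [ffun i : 'I_k => if insub (j + i)%N is Some t then v t else D 0].

Let windowE m j k x : (j + k <= m)%N ->
  window j k (word T D m x) = word T D k (iter j T x).
Proof.
move=> jk; apply/ffunP => i; rewrite !ffunE.
have im : (j + i < m)%N by rewrite (leq_trans _ jk)// ltn_add2l.
by rewrite insubT ffunE/= -iterD addnC.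
Qed.

(** The joint law of both words is compared with the model in which the [D]-word has its true law
    and each [X]-letter is drawn independently given its window of [k] digits. The last [k] letters
    have no full window and are drawn uniformly, which costs [k%:R * ln #|K|%:R]. *)
Lemma wordent_le_cond m k : (k <= m)%N ->
  wordent mu T X m <= wordent mu T D m + (m - k)%:R * condent k + k%:R * ln #|K|%:R.
Proof.
move=> km.
pose Y x := (word T X m x, word T D m x).
have mWX : mlab (word T X m) := mlab_word mT mX.
have mY : mlab Y by apply: mlab_pair => //; exact: mW.
apply: (@le_trans _ _ (ent (dist mu Y))).
  exact: (ent_comp_le mu1 fst mY).
pose kap (j : 'I_m) (a : K) (v : {ffun 'I_m -> L}) : R :=
  if (j < m - k)%N then condprob (a, window j k v) else #|K|%:R^-1.
have kap0 j a v : 0 <= kap j a v by rewrite /kap; case: ifP; rewrite ?invr_ge0.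
have sum_kap j v : \sum_a kap j a v = 1.
  rewrite /kap; case: (j < m - k)%N; first exact: sum_cond.
  by rewrite sumr_const -[_ *+ _]mulr_natl divff// pnatr_eq0 -lt0n.
pose q (uv : {ffun 'I_m -> K} * {ffun 'I_m -> L}) : R :=
  dist mu (word T D m) uv.2 * \prod_j kap j (uv.1 j) uv.2.
have jkm (j : 'I_m) : (j < m - k)%N -> (j + k <= m)%N by lia.
have compE (j : 'I_m) : (j < m - k)%N ->
  (fun uv : {ffun 'I_m -> K} * {ffun 'I_m -> L} => (uv.1 j, window j k uv.2)) \o Y =
  XW k \o iter j T.
  by move=> jm; apply/funext => x; rewrite /= windowE ?jkm// /XW ffunE.
have Y_le (j : 'I_m) u v : (j < m - k)%N -> dist mu Y (u, v) <= dist mu (XW k) (u j, window j k v).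
  move=> jm; rewrite -(dist_iter mT muT j (@mXW k)) -compE//.
  by rewrite (dist_comp mu1 _ _ mY) (bigD1 (u, v))//= lerDl sumr_ge0// => *; exact: dist_ge0.
have qY uv : q uv = 0 -> dist mu Y uv = 0.
  case: uv => u v /eqP; rewrite /q mulf_eq0/= => /orP[/eqP h|].
    apply/eqP; rewrite eq_le dist_ge0 andbT -h -(dist_snd mu1 v mWX (@mW m)).
    by rewrite (bigD1 u)//= lerDl sumr_ge0// => *; exact: dist_ge0.
  rewrite prodf_seq_eq0 => /hasP[j _ /=]; rewrite /kap; case: ifP => [jm /eqP/cond_eq0 h|_].
    by apply/eqP; rewrite eq_le dist_ge0 andbT -h Y_le.
  by rewrite invr_eq0 pnatr_eq0 gtn_eqF.
have sq : \sum_uv q uv = 1.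
  rewrite -(pair_bigA _ (fun u v => q (u, v)))/= exchange_big/= -[RHS](sum_dist mu1 (@mW m)).
  apply: eq_bigr => v _; rewrite /q/= -mulr_sumr (sum_ffun_prod (fun j a => kap j a v)).
  by rewrite big1 ?mulr1.
apply: le_trans (@ent_le_cross _ _ (dist mu Y) q _ _ qY _) _.
- by move=> uv; exact: dist_ge0.
- by move=> uv; rewrite /q mulr_ge0 ?dist_ge0 ?prodr_ge0.
- by rewrite sq sum_dist.
have -> : \sum_a dist mu Y a * ln (q a) =
  \sum_uv dist mu Y uv * ln (dist mu (word T D m) uv.2) +
  \sum_(j < m) \sum_uv dist mu Y uv * ln (kap j (uv.1 j) uv.2).
  rewrite exchange_big/= -big_split/=; apply: eq_bigr => uv _.
  have [->|nz] := eqVneq (dist mu Y uv) 0.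
    by rewrite !mul0r add0r big1// => *; rewrite mul0r.
  rewrite -mulr_sumr -mulrDr; congr (_ * _).
  have qnz : q uv != 0 by apply: contra_neq nz; exact: qY.
  have := qnz; rewrite /q mulf_eq0 negb_or => /andP[dn pn].
  have kp j : 0 < kap j (uv.1 j) uv.2.
    by rewrite lt_neqAle kap0 andbT eq_sym; move/prodf_neq0: pn; exact.
  by rewrite lnM ?posrE ?ln_prod ?prodr_gt0// lt_neqAle eq_sym dn dist_ge0.
rewrite opprD -addrA lerD//.
  rewrite (expect_comp mu1 snd (fun v => ln (dist mu (word T D m) v)) mY) /wordent /ent.
  exact: lexx.
rewrite -sumrN.
have -> : (m - k)%:R * condent k + k%:R * ln #|K|%:R =
   \sum_(j < m) (if (j < m - k)%N then condent k else ln #|K|%:R).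
  rewrite -(big_mkord xpredT (fun j => if (j < m - k)%N then condent k else ln #|K|%:R)).
  rewrite (@big_cat_nat _ _ _ (m - k)) ?leq_subr//=; congr (_ + _).
    rewrite big_nat (eq_bigr (fun=> condent k)); last by move=> i /andP[_ ->].
    by rewrite -big_nat sumr_const_nat subn0 mulr_natl.
  rewrite big_nat (eq_bigr (fun=> ln #|K|%:R)); last by move=> i /andP[]; rewrite leqNgt => /negbTE ->.
  by rewrite -big_nat sumr_const_nat subKn// mulr_natl.
apply: ler_sum => j _; rewrite /kap; case: ifP => jm.
  rewrite /condent lerN2.
  rewrite (expect_comp mu1 (fun uv : {ffun 'I_m -> K} * {ffun 'I_m -> L} => (uv.1 j, window j k uv.2))
    (fun aw => ln (condprob aw)) mY) compE// dist_iter//; exact: mXW.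
by rewrite -mulr_suml sum_dist// mul1r lnV ?opprK ?posrE ?ltr0n.
Qed.

(** The bound is linear in the distance of [t] to 0 or 1, so that it can be summed over cells into a
    [defect]. The two halves come from [ln y <= y - 1] at [e / t] and [1 / e], and at [1 / t]. *)
Lemma entropy_term_le (e t : R) : 0 < e -> e <= 1 -> 0 <= t -> t <= 1 ->
  - (t * ln t) <= e + Num.min t (1 - t) / e.
Proof.
move=> e0 e1 t0 t1.
have [->|tn] := eqVneq t 0.
  by rewrite mul0r oppr0 addr_ge0 ?(ltW e0)// divr_ge0 ?(ltW e0)// le_min lexx subr0 ler01.
have {tn}t0 : 0 < t by rewrite lt_neqAle eq_sym tn t0.
have ei : 1 <= e^-1 by rewrite invf_ge1.
have h1 : - (t * ln t) <= e + t / e.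
  have := ln_le_subr1 (divr_gt0 e0 t0); rewrite ln_div ?posrE// => h.
  have := ln_le_subr1 (_ : 0 < e^-1); rewrite invr_gt0 lnV ?posrE// => /(_ e0) h'.
  have : - ln t <= e / t + e^-1 by lra.
  move=> /(ler_wpM2l (ltW t0)); rewrite mulrN mulrDr [X in _ <= X + _]mulrC divfK ?gt_eqF//.
have h2 : - (t * ln t) <= e + (1 - t) / e.
  have := ln_le_subr1 (_ : 0 < t^-1); rewrite invr_gt0 lnV ?posrE// => /(_ t0).
  move=> /(ler_wpM2l (ltW t0)); rewrite mulrN mulrBr divff ?gt_eqF// mulr1.
  have : 1 - t <= (1 - t) / e by rewrite ler_peMr// subr_ge0.
  lra.
by rewrite /Num.min; case: ifP.
Qed.

Lemma condent_le k (e : R) : 0 < e -> e <= 1 ->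
  condent k <= #|K|%:R * e + (\sum_a defect mu (X @^-1` [set a]) k) / e.
Proof.
move=> e0 e1; rewrite /condent -sumrN.
rewrite (eq_bigr (fun aw => - (dist mu (XW k) (aw.1, aw.2) * ln (condprob (aw.1, aw.2))))); last by case.
rewrite -(pair_bigA _ (fun a w => - (dist mu (XW k) (a, w) * ln (condprob (a, w)))))/=.
have -> : #|K|%:R * e = \sum_(a : K) e by rewrite sumr_const mulr_natl.
rewrite mulr_suml -big_split/=; apply: ler_sum => a _.
rewrite [X in _ <= X + _](_ : e = \sum_w dist mu (word T D k) w * e); last first.
  by rewrite -mulr_suml sum_dist// mul1r.
rewrite /defect mulr_suml -big_split/=; apply: ler_sum => w _.
have XWE : dist mu (XW k) (a, w) = pr mu (X @^-1` [set a] `&` word T D k @^-1` [set w]).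
  by congr pr; apply/seteqP; split=> x [<- <-].
have XWC : dist mu (word T D k) w - dist mu (XW k) (a, w) =
    pr mu (~` (X @^-1` [set a]) `&` word T D k @^-1` [set w]).
  rewrite XWE /dist (prD mu1 (@mW k w) (mX a)) (setIC (word _ _ _ @^-1` _)) addrC addKr.
  by rewrite setDE setIC.
rewrite -XWE -XWC.
have [w0|wn] := eqVneq (dist mu (word T D k) w) 0.
  have := XW_le a w; rewrite w0 => h.
  have -> : dist mu (XW k) (a, w) = 0 by apply/eqP; rewrite eq_le h dist_ge0.
  by rewrite subr0 minxx !mul0r oppr0 addr0.
rewrite /condprob/= (negbTE wn).
set p := dist mu (word T D k) w in wn *; set r := dist mu (XW k) (a, w).
have p0 : 0 < p by rewrite lt_neqAle eq_sym wn dist_ge0.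
have r0 : 0 <= r by exact: dist_ge0.
have rp : r <= p by exact: XW_le.
have := @entropy_term_le e (r / p) e0 e1 (divr_ge0 r0 (ltW p0)) _.
rewrite ler_pdivrMr// mul1r => /(_ rp) /(ler_wpM2l (ltW p0)).
rewrite mulrN mulrA (mulrC p (r / p)) divfK// mulrDr.
rewrite mulrA (minr_pMr _ _ (ltW p0)) mulrBr mulr1 (mulrC p (r / p)) divfK//.
Qed.

(** Choose [k] so large that the fibres of [X] are almost unions of [k]-cells: then the label is
    almost determined by the [k]-word and [condent k] is small. *)
Lemma kolmogorov_sinai (eta : R) : 0 < eta -> exists m0, forall m, (m0 <= m)%N ->
  wordent mu T X m <= wordent mu T D m + m%:R * eta.
Proof.
move=> eta0; have KR : 0 < #|K|%:R :> R by rewrite ltr0n.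
pose e := Num.min 1 (eta / 4 / #|K|%:R).
have e0 : 0 < e by rewrite lt_min ltr01 !divr_gt0.
have e1 : e <= 1 by rewrite ge_min lexx.
have Ke : #|K|%:R * e <= eta / 4 by rewrite mulrC -ler_pdivlMr// ge_min lexx orbT.
have d0 : 0 < eta / 4 * e / #|K|%:R by rewrite !(divr_gt0, mulr_gt0).
have [f hf] := choice (fun a => defect_cvg0 mu01 (mX a) d0).
pose k := \max_a f a.
have ck : condent k <= eta / 2.
  apply: le_trans (condent_le k e0 e1) _.
  have : (\sum_a defect mu (X @^-1` [set a]) k) <= eta / 4 * e.
    apply: (@le_trans _ _ (\sum_(a : K) eta / 4 * e / #|K|%:R)).
      by apply: ler_sum => a _; apply: hf; exact: leq_bigmax.
    by rewrite sumr_const -[_ *+ _]mulr_natl mulrC divfK ?gt_eqF.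
  rewrite -ler_pdivrMr// => h; move: Ke h; lra.
have l0 : 0 <= ln #|K|%:R :> R by rewrite ln_ge0// ler1n.
exists (maxn k (Num.truncn (k%:R * ln #|K|%:R / (eta / 2))).+1) => m.
rewrite geq_max => /andP[km mm].
apply: le_trans (wordent_le_cond km) _; rewrite -addrA lerD2l.
have h1 : (m - k)%:R * condent k <= m%:R * (eta / 2).
  apply: (@le_trans _ _ ((m - k)%:R * (eta / 2))); first exact: ler_wpM2l.
  by rewrite ler_wpM2r ?ler_nat ?leq_subr//; lra.
have h2 : k%:R * ln #|K|%:R <= m%:R * (eta / 2).
  rewrite -ler_pdivrMr; last by lra.
  by apply/ltW/(lt_le_trans (truncnS_gt _)); rewrite ler_nat.
lra.
Qed.

End Kolmogorov_Sinai.
End Generator.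

(** * Digits of the minus-beta transformation *)

Section MinusBetaDigits.
Variables (R : realType) (beta : R).
Hypothesis beta1 : 1 < beta.
Implicit Types (x y t : R).

Let b0 : 0 < beta. Proof. exact: lt_trans beta1. Qed.

Definition bnat : nat := `|bdig beta|%N.
Local Notation b := bnat.
Local Notation T := (Tmb beta).

Lemma bdigE : bdig beta = b%:Z.
Proof.
rewrite /b gez0_abs// /bdig subr_ge0.
have : (0 < Num.ceil beta) by rewrite ceil_gt0.
by lia.
Qed.

Lemma b_bounds : b%:R < beta <= b.+1%:R.
Proof.
have h := real_ceil_itv (num_real beta).
have E : (b%:R : R) = (Num.ceil beta)%:~R - 1.
  by rewrite -[b%:R]/((Posz b)%:~R) -bdigE /bdig intrD.
by rewrite -natr1 E subrK; move: h; rewrite intrD.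
Qed.

(** A point has at most one preimage per branch [c n], so orbits meeting a countable set start in a
    countable set. Avoiding it yields good and generic points. *)
Lemma countable_iter_preimage (D : set R) (f : R -> R) (c : int -> R -> R) (A : set R) :
  countable A -> (forall x, D x -> D (f x) /\ exists n, x = c n (f x)) ->
  countable [set x | D x /\ exists k, A (iter k f x)].
Proof.
move=> cA hD; pose B k := [set x | D x /\ A (iter k f x)].
have cB k : countable (B k).
  elim: k => [|k IH]; first by apply: sub_countable cA; apply: subset_card_le => x [].
  apply: (@sub_countable _ _ _ (\bigcup_(n in [set: int]) (c n @` B k))).
    apply: subset_card_le => x [Dx]; rewrite iterSr => Ax.
    by have [Df [n E]] := hD x Dx; exists n => //; exists (f x).
  apply: bigcup_countable => // n _.
  exact: sub_countable (card_image_le _ _) IH.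
apply: (@sub_countable _ _ _ (\bigcup_k B k)); last exact: bigcup_countable.
by apply: subset_card_le => x [Dx [k Ak]]; exists k.
Qed.

Lemma itv_avoid_countable (A : set R) x y : countable A -> x < y ->
  exists2 z : R, x < z < y & ~ A z.
Proof.
move=> cA xy; apply: contrapT => h.
have : countable (`]x, y[ : set R).
  apply: sub_countable cA; apply: subset_card_le => z; rewrite /= in_itv/= => zxy.
  by apply: contrapT => nA; apply: h; exists z.
move/countable_lebesgue_measure0; rewrite lebesgue_measure_itv/= lte_fin xy.
by rewrite -EFinD => -[] /eqP; rewrite subr_eq0 gt_eqF.
Qed.

Lemma seq_gap (S : seq R) (a : R) : exists2 eta : R, 0 < eta &
  forall s, s \in S -> s != a -> eta <= `|s - a|.
Proof.
elim: S => [|s S [eta eta0 h]]; first by exists 1.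
have [sa|sa] := eqVneq s a.
  by exists eta => // s'; rewrite inE => /orP[/eqP ->|/h//]; rewrite sa eqxx.
exists (Num.min eta `|s - a|); first by rewrite lt_min eta0 normr_gt0 subr_eq0.
move=> s'; rewrite inE => /orP[/eqP -> _|s'S s'a]; first by rewrite ge_min lexx orbT.
by rewrite ge_min h.
Qed.

Definition dpoints : seq R := [seq i%:R / beta | i <- iota 1 b].

Lemma dpointsP x : reflect (exists2 i : nat, (1 <= i <= b)%N & x = i%:R / beta) (x \in dpoints).
Proof.
apply: (iffP mapP) => [[i]|[i ib ->]].
  by rewrite mem_iota add1n ltnS => ib ->; exists i.
by exists i => //; rewrite mem_iota add1n ltnS.
Qed.

Lemma discP x : disc beta x <-> x \in [:: 0, 1 & dpoints].
Proof.
rewrite /disc bdigE !inE; split=> [[->|[->|[j [j1 [jb ->]]]]]|].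
- by rewrite eqxx.
- by rewrite eqxx orbT.
- case: j j1 jb => // n n1 nb; rewrite orbA; apply/orP; right; apply/dpointsP.
  by exists n => //; move: n1 nb; lia.
move=> /orP[/eqP ->|/orP[/eqP ->|/dpointsP[i ib ->]]]; [by left|by right; left|].
by right; right; exists i; split; [|split=> //]; lia.
Qed.

Lemma Tgen_digit (n : nat) y : n%:R <= beta * y < n.+1%:R ->
  Tgen beta y = n.+1%:R - beta * y /\ digit beta y = n.
Proof.
move=> h; have E : Num.floor (beta * y) = n%:Z.
  by apply: floor_def; rewrite intrD/= natr1.
by rewrite /Tgen /digit E absz_nat -[in LHS]/(n%:R) -natr1 mulNr addrC.
Qed.

(** Without good points near 1 the predicate [itin_one] would hold vacuously for every sequence;
    their existence makes the limit itinerary unique. *)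
Lemma good_near1 (d : R) : 0 < d -> exists2 x : R, 1 - d < x < 1 & good beta x.
Proof.
move=> d0; pose A := [set x | x \in [:: 0, 1 & dpoints]].
have cA : countable A by apply: finite_set_countable; exact: finite_seq.
have cB : countable [set x | [set: R] x /\ exists k, A (iter k (Tgen beta) x)].
  apply: (@countable_iter_preimage setT (Tgen beta) (fun n y => ((n%:~R + 1) - y) / beta)) => //.
  move=> x _; split=> //; exists (Num.floor (beta * x)); rewrite /Tgen.
  by apply/eqP; rewrite eq_sym -(inj_eq (mulIf (lt0r_neq0 b0))) divfK ?lt0r_neq0//; apply/eqP; ring.
have m1 : Num.max 0 (1 - d) < 1 by rewrite gt_max ltr01; lra.
have [x /andP[x1 x2] nx] := itv_avoid_countable cB m1.
exists x; first by rewrite x2 andbT; move: x1; rewrite gt_max => /andP[].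
split; first by move: x1; rewrite gt_max => /andP[/ltW -> _]; exact: ltW.
by move=> k /discP h; apply: nx; split=> //; exists k.
Qed.

(** * Periodic itineraries from a one-sided return to 1 *)

Section Return.
Variables (P : nat) (dd : nat -> nat) (d0 : R).
Hypotheses (P0 : (0 < P)%N) (d0p : 0 < d0).
Hypothesis ret : forall t, 0 < t < d0 ->
  (forall r, (r < P)%N -> digit beta (iter r (Tgen beta) (1 - t)) = dd r) /\
  iter P (Tgen beta) (1 - t) = 1 - beta ^+ P * t.

(** Each return multiplies the distance to 1 by [beta ^+ P], so points close enough to 1 return [N]
    times with the same digits. *)
Lemma return_itin N : exists2 d : R, 0 < d & forall t, 0 < t < d ->
  forall k, (k < N)%N -> itin beta (1 - t) k = dd (k %% P).
Proof.
have bX n : 0 < beta ^+ n by exact: exprn_gt0.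
exists (d0 / beta ^+ (P * N)); first exact: divr_gt0.
move=> t /andP[t0]; rewrite ltr_pdivlMr// => tN.
have step i : (i <= N)%N -> 0 < beta ^+ (P * i) * t < d0 /\
   iter (i * P) (Tgen beta) (1 - t) = 1 - beta ^+ (P * i) * t.
  move=> iN; split.
    rewrite mulr_gt0//= (le_lt_trans _ tN)// mulrC ler_wpM2l ?(ltW t0)//.
    by rewrite ler_weXn2l ?(ltW beta1)// leq_mul2l iN orbT.
  elim: i iN => [|i IH] iN; first by rewrite muln0 mul1r.
  rewrite mulSn iterD IH ?(ltnW iN)//.
  rewrite (proj2 (ret _)) ?mulnS ?exprD ?mulrA//.
  rewrite mulr_gt0//= (le_lt_trans _ tN)// mulrC ler_wpM2l ?(ltW t0)//.
  by rewrite ler_weXn2l ?(ltW beta1)// leq_mul2l (ltnW iN) orbT.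
move=> k kN; rewrite /itin {1}(divn_eq k P) addnC iterD.
have [tt ->] := step (k %/ P)%N (leq_trans (leq_div _ _) (ltnW kN)).
by have [-> //] := ret tt; rewrite ltn_pmod.
Qed.

Lemma return_itin_one : itin_one beta (fun k => dd (k %% P)).
Proof.
move=> N; have [d dp h] := return_itin N; exists d => // x /andP[x1 x2] _ k kN.
rewrite -[x](subKr 1); apply: h => //; apply/andP; split; lra.
Qed.

Lemma return_unique d : itin_one beta d -> forall k, d k = dd (k %% P).
Proof.
move=> hd k; have [e1 e10 h1] := return_itin k.+1; have [e2 e20 h2] := hd k.+1.
have [x /andP[x1 x2] gx] := @good_near1 (Num.min e1 e2) ltac:(by rewrite lt_min e10).
have xm : 1 - x < e1 /\ 1 - x < e2.
  have : 1 - x < Num.min e1 e2 by lra.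
  by rewrite lt_min => /andP[].
have [xm1 xm2] := xm.
have t1 : 0 < 1 - x < e1 by apply/andP; split; lra.
have x12 : 1 - e2 < x < 1 by apply/andP; split; lra.
by rewrite -(h2 x x12 gx k (ltnSn k)) -(h1 _ t1 k (ltnSn k)) subKr.
Qed.

Lemma return_case1 : dd P.-1 = 0%N -> case1 beta.
Proof.
move=> h; exists (fun k => dd (k %% P)); split; first exact: return_itin_one.
exists (mkseq dd P.-1) => k; rewrite size_rcons size_mkseq prednK//.
have kP : (k %% P < P)%N by rewrite ltn_pmod.
rewrite nth_rcons size_mkseq; case: ltngtP => [kl|kg|ke].
- by rewrite nth_mkseq.
- by move: kP kg; lia.
- by rewrite ke h.
Qed.

Lemma return_ncase1 : dd P.-1 <> 0%N -> ~ case1 beta.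
Proof.
move=> h [d [hd [w hw]]]; apply: h.
(* This index is the last one of a period for both [P] and the length of [rcons w 0], so both
   descriptions can be read there. *)
have := return_unique hd (P * size (rcons w 0%N)).-1; rewrite hw.
have sw : (0 < size (rcons w 0%N))%N by rewrite size_rcons.
set n := size (rcons w 0%N) in sw *.
have E m p : (0 < m)%N -> (0 < p)%N -> ((m * p).-1 %% p = p.-1)%N.
  case: m p => // m [|p] // _ _; rewrite mulSn addSn/= addnC modnMDl modn_small//.
rewrite E// mulnC E//; first by rewrite /n size_rcons/= nth_rcons ltnn eqxx => ->.
Qed.

End Return.

(** For integer [beta] a point just below 1 goes to just above 0 and back, with digits [b] and [0].
    Hence [beta < b.+1%:R] in Case 2, which keeps the digit of 1 at most [b]. *)
Lemma case1_int : beta = b.+1%:R -> case1 beta.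
Proof.
move=> bE; pose dd (r : nat) := if r == 0%N then b else 0%N.
have bp : 0 < beta ^+ 2 by exact: exprn_gt0.
apply: (@return_case1 2 dd (beta ^+ 2)^-1) => //; first by rewrite invr_gt0.
move=> t /andP[t0]; rewrite -div1r ltr_pdivlMr// => tb.
have bt : beta * t < 1.
  rewrite (le_lt_trans _ tb)// mulrC ler_wpM2l ?(ltW t0)// expr2 ler_peMl ?(ltW b0)//; exact: ltW.
have bt0 : 0 < beta * t by exact: mulr_gt0.
have h1 : b%:R <= beta * (1 - t) < b.+1%:R by rewrite -natr1 in bE *; apply/andP; split; lra.
have [T1 D1] := Tgen_digit h1.
have T1' : Tgen beta (1 - t) = beta * t by rewrite T1 -bE; ring.
have h2 : 0%:R <= beta * (beta * t) < 1%:R.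
  by rewrite mulr_ge0 ?(ltW b0) ?(ltW bt0)//= mulrA -expr2 mulrC.
have [T2 D2] := Tgen_digit h2.
split; last by rewrite /= T1' T2; ring.
by case=> [|[|//]] _ //=; rewrite T1' D2.
Qed.

Let c1 : bool := `[< case1 beta >].

Lemma case2_lt : ~~ c1 -> beta < b.+1%:R.
Proof.
move=> nc; have /andP[_] := b_bounds; rewrite le_eqVlt => /orP[/eqP/case1_int h|//].
by move/asboolP: nc.
Qed.

(** Assigns the endpoints of the intervals to branches so that the branch formula reproduces the
    prescribed values: a discontinuity joins the branch on its left in Case 1, with value 0, and the
    branch on its right in Case 2, with value 1. *)
Definition inD (i : nat) x : bool := (0 <= x <= 1) &&
  if c1 then ((i%:R < beta * x) || ((x == 0) && (i == 0)%N)) && (beta * x <= i.+1%:R)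
  else (i%:R <= beta * x) && (beta * x < i.+1%:R).

Lemma inD_inj i j x : inD i x -> inD j x -> i = j.
Proof.
rewrite /inD => /andP[/andP[x0 x1] +] /andP[_].
case: c1 => /andP[+ h1] /andP[+ h2].
  have [->|xn] := eqVneq x 0.
    by rewrite mulr0 !ltrn0/= => /eqP -> /eqP ->.
  rewrite /= !orbF => h3 h4.
  have := lt_le_trans h3 h2; have := lt_le_trans h4 h1; rewrite !ltr_nat !ltnS => ? ?.
  by apply/eqP; rewrite eqn_leq; apply/andP.
move=> h3 h4.
have := le_lt_trans h3 h2; have := le_lt_trans h4 h1; rewrite !ltr_nat !ltnS => ? ?.
by apply/eqP; rewrite eqn_leq; apply/andP.
Qed.

Lemma inD_open i x : 0 <= x <= 1 -> i%:R < beta * x -> beta * x < i.+1%:R -> inD i x.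
Proof. by rewrite /inD => -> h1 h2; case: c1; rewrite ?h1 ?h2 ?(ltW h1) ?(ltW h2). Qed.

Lemma inD_le i x : inD i x -> (i <= b)%N.
Proof.
rewrite /inD => /andP[/andP[x0 x1] h]; have /andP[bb1 bb2] := b_bounds.
have bxb : beta * x <= beta by rewrite ler_piMr// ltW.
rewrite -ltnS -(ltr_nat R); move: h; case: ifPn => [_|c] /andP[].
  by move=> /orP[h _|/andP[_ /eqP ->]]; rewrite ?ltr0n// (lt_le_trans h)// (le_trans bxb).
by move=> h _; rewrite (le_lt_trans h)// (le_lt_trans bxb)// case2_lt.
Qed.

Definition dg x : 'I_b.+1 :=
  if [pick i : 'I_b.+1 | inD i x] is Some i then i else ord0.

Lemma dg_eq i x : inD i x -> dg x = i :> nat.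
Proof.
move=> h; have ib := inD_le h.
rewrite /dg; case: pickP => [j hj|/(_ (Ordinal (ib : (i < b.+1)%N)))].
  exact: inD_inj hj h.
by rewrite /= h.
Qed.

Lemma inD_dg x : 0 <= x <= 1 -> inD (dg x) x.
Proof.
move=> x01; suff [i h] : exists i, inD i x by rewrite (dg_eq h).
have /andP[x0 x1] := x01.
have bx0 : 0 <= beta * x by rewrite mulr_ge0// ltW.
have /andP[t1 t2] := truncn_itv bx0.
have [c|c] := boolP c1; last first.
  by exists (Num.truncn (beta * x)); rewrite /inD (negbTE c) x01 t1.
have [->|xn] := eqVneq x 0.
  by exists 0%N => //; rewrite /inD c lexx ler01 eqxx mulr0 ler0n orbT.
have bxp : 0 < beta * x by rewrite mulr_gt0// lt_neqAle eq_sym xn.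
have [E|E] := eqVneq (Num.truncn (beta * x))%:R (beta * x).
  case n: (Num.truncn (beta * x)) E => [|n'] E; first by rewrite -E ltxx in bxp.
  by exists n'; rewrite /inD c x01 -E ltr_nat ltnSn lexx.
by exists (Num.truncn (beta * x)); rewrite /inD c x01 (ltW t2) lt_neqAle E t1.
Qed.

Lemma dg_open i x : 0 <= x <= 1 -> i%:R < beta * x -> beta * x < i.+1%:R -> dg x = i :> nat.
Proof. by move=> x01 h1 h2; apply/dg_eq/inD_open. Qed.

Lemma dgW x : 0 <= x <= 1 -> (dg x)%:R <= beta * x <= (dg x).+1%:R.
Proof.
move=> x01; have := inD_dg x01; have /andP[x0 _] := x01; rewrite /inD x01/=.
have bx0 : 0 <= beta * x by rewrite mulr_ge0// ltW.
case: c1 => /andP[].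
  by move=> /orP[/ltW -> ->//|/andP[_ /eqP ->] ->]; rewrite bx0.
by move=> -> /ltW ->.
Qed.

(** One affine formula replaces the case distinction in [Tmb] from here on: the conventions of [inD]
    give the right value at 0, at 1 and at the discontinuities. *)
Lemma TmbE x : 0 <= x <= 1 -> T x = (dg x).+1%:R - beta * x.
Proof.
move=> x01; have /andP[x0 x1] := x01; have D := inD_dg x01.
have /andP[bb1 bb2] := b_bounds.
rewrite /Tmb; case: asboolP => [x0E|xn0].
  rewrite (_ : nat_of_ord (dg x) = 0%N) ?x0E ?mulr0 ?subr0//.
  by apply/dg_eq; rewrite /inD lexx ler01 eqxx mulr0 /=; case: c1; rewrite ?ler0n ?ltr0n ?lexx ?orbT.
case: asboolP => [x1E|xn1].
  rewrite (_ : nat_of_ord (dg x) = b) ?x1E ?mulr1 ?bdigE ?natr1//.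
  apply/dg_eq; rewrite /inD ler01 lexx mulr1/=; case: ifPn => [_|c].
    by rewrite bb1 bb2.
  by rewrite (ltW bb1) case2_lt.
have xi : 0 < x < 1 by rewrite !lt_neqAle x0 x1 !andbT eq_sym; apply/andP; split; apply/eqP.
case: asboolP => [|nd].
  case=> [//|[//|[[j|j] [j1 [jb xE]]]]]; last by [].
  have jE : beta * x = j%:R by rewrite xE mulrC divfK// lt0r_neq0.
  move: D; rewrite /inD x01/= jE /c1; case: asboolP => _ /andP[].
    move=> /orP[|/andP[/eqP //]]; rewrite ltr_nat ler_nat => h1 h2.
    by rewrite (_ : (dg x).+1 = j) ?subrr//; apply/eqP; rewrite eqn_leq h1 h2.
  rewrite ler_nat ltr_nat ltnS => h1 h2.
  rewrite (_ : nat_of_ord (dg x) = j); first by rewrite -natr1 addrAC subrr add0r.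
  by apply/eqP; rewrite eqn_leq h1 h2.
case: asboolP => // _.
suff h : (dg x)%:R <= beta * x < (dg x).+1%:R by have [] := Tgen_digit h.
have /andP[-> h2] := dgW x01; rewrite lt_neqAle h2 andbT/=; apply/eqP => E.
apply: nd; apply/discP; rewrite !inE; apply/orP; right; apply/orP; right; apply/dpointsP.
exists (dg x).+1; last by rewrite -E mulrC mulKf ?lt0r_neq0.
rewrite /= -ltnS -(ltr_nat R) -E (lt_le_trans _ bb2)// -[ltRHS]mulr1 ltr_pM2l//.
by case/andP: xi.
Qed.

Lemma Tmb01 x : 0 <= x <= 1 -> 0 <= T x <= 1.
Proof.
move=> x01; rewrite TmbE//; have /andP[h1 h2] := dgW x01; rewrite -natr1 in h2 *.
by apply/andP; split; lra.
Qed.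

Lemma iter01 n x : 0 <= x <= 1 -> 0 <= iter n T x <= 1.
Proof. by move=> x01; elim: n => //= n; exact: Tmb01. Qed.

Lemma TmbB x y : 0 <= x <= 1 -> 0 <= y <= 1 -> dg x = dg y -> T x - T y = - beta * (x - y).
Proof. by move=> x01 y01 E; rewrite !TmbE// E; ring. Qed.

Lemma dg_sep x y : 0 <= x <= 1 -> 0 <= y <= 1 -> x < y -> dg x != dg y ->
  exists2 s, s \in dpoints & if c1 then x <= s < y else x < s <= y.
Proof.
move=> x01 y01 xy nE.
have bxy : beta * x < beta * y by rewrite ltr_pM2l.
have nE' : nat_of_ord (dg x) != dg y by apply: contra nE => /eqP/val_inj ->.
have := inD_dg x01; have := inD_dg y01; rewrite /inD x01 y01/=.
have y0 : y != 0 by rewrite gt_eqF// (le_lt_trans _ xy)//; case/andP: x01.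
have db z : (dg z <= b)%N by rewrite -ltnS.
case: c1; rewrite ?(negbTE y0)/= ?orbF => /andP[h1 h2] /andP[h3 h4].
  have lxy : (dg x < dg y)%N.
    rewrite ltn_neqAle nE'/= -ltnS -(ltr_nat R).
    case/orP: h3 => [h3|/andP[_ /eqP ->]]; last by rewrite ltr0n.
    by rewrite (lt_le_trans h3)// (le_trans (ltW bxy)).
  exists ((dg x).+1%:R / beta).
    by apply/dpointsP; exists (dg x).+1 => //=; rewrite (leq_trans lxy).
  rewrite ler_pdivlMr// ltr_pdivrMr// ![_ * beta]mulrC h4 (le_lt_trans _ h1)// ler_nat//.
have lxy : (dg x < dg y)%N.
  by rewrite ltn_neqAle nE'/= -ltnS -(ltr_nat R) (le_lt_trans h3)// (lt_trans bxy).
exists ((dg y)%:R / beta).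
  by apply/dpointsP; exists (dg y) => //=; rewrite db (leq_ltn_trans _ lxy).
rewrite ltr_pdivlMr// ler_pdivrMr// ![_ * beta]mulrC h1 andbT (lt_le_trans h4)// ler_nat//.
Qed.

(* Points on the side of a discontinuity from which the digit is not continuous. *)
Definition wrong (e : R) x : Prop := 0 <= x <= 1 /\
  exists2 s, s \in dpoints & if c1 then s < x < s + e else s - e < x < s.

(** A discontinuity separates the points, and it shares the branch next to it on one side only; the
    point on the other side is the wrong one. *)
Lemma wrong_of_dg (e : R) x y : 0 <= x <= 1 -> 0 <= y <= 1 -> `|x - y| < e ->
  dg x != dg y -> wrong e x \/ wrong e y.
Proof.
move=> x01 y01; wlog xy : x y x01 y01 / x < y => [hw|].
  have [xy|xy|->] := ltgtP x y; [exact: hw| |by rewrite eqxx].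
  by rewrite distrC eq_sym => h1 h2; case: (hw y x y01 x01 xy h1 h2); [right|left].
rewrite ltr_norml => /andP[d1 d2] nE; have [s sd] := dg_sep x01 y01 xy nE.
rewrite /wrong; case: c1 => /andP[h1 h2].
  by right; split=> //; exists s => //; apply/andP; split; lra.
by left; split=> //; exists s => //; apply/andP; split; lra.
Qed.

Lemma dg_near (a eta : R) : 0 <= a <= 1 -> (forall s, s \in dpoints -> s != a -> eta <= `|s - a|) ->
  forall y, 0 <= y <= 1 -> `|y - a| < eta ->
    (a \in dpoints -> if c1 then y <= a else a <= y) -> dg y = dg a.
Proof.
move=> a01 heta y y01 ya side; apply/eqP/negPn/negP => nE.
have [ya'|ya'|E] := ltgtP y a; last by rewrite E eqxx in nE.
  have [s sd h] := dg_sep y01 a01 ya' nE.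
  have [sa|sa] := eqVneq s a.
    by rewrite sa in sd h; move: (side sd) h; case: c1; lra.
  have := heta s sd sa; rewrite ler_normr; move: ya h; rewrite ltr_norml.
  by case: c1; lra.
have [s sd h] := dg_sep a01 y01 ya' (contra_neq esym nE).
have [sa|sa] := eqVneq s a.
  by rewrite sa in sd h; move: (side sd) h; case: c1; lra.
have := heta s sd sa; rewrite ler_normr; move: ya h; rewrite ltr_norml.
by case: c1; lra.
Qed.

Local Notation a_ j := (iter j T 1).

Let a01 j : 0 <= a_ j <= 1. Proof. by apply: iter01; rewrite ler01 lexx. Qed.

(* One-sided orbit of 1: for small t the orbit of 1 - t follows that of 1, since the
   choice of the values of T at the discontinuities is the one-sided one along it. *)
Definition shadow n := exists2 d : R, 0 < d & forall t, 0 < t < d -> 0 <= 1 - t <= 1 /\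
  forall j, (j <= n)%N -> iter j T (1 - t) = a_ j - (- beta) ^+ j * t /\
    ((j < n)%N -> dg (iter j T (1 - t)) = dg (a_ j)).

Lemma shadow_normXt j t : 0 < t -> `|(- beta) ^+ j * t| = beta ^+ j * t.
Proof. by move=> t0; rewrite normrM normrX normrN !gtr0_norm. Qed.

Lemma signX j : (- beta) ^+ j = if odd j then - (beta ^+ j) else beta ^+ j.
Proof. by rewrite exprNn -signr_odd; case: odd; rewrite ?expr1 ?expr0; ring. Qed.

Lemma Tgen_Tmb y : 0 <= y <= 1 -> y != 0 -> y != 1 -> y \notin dpoints ->
  Tgen beta y = T y /\ digit beta y = dg y.
Proof.
move=> y01 y0 y1 yd; rewrite TmbE//; apply: Tgen_digit.
have /andP[-> h2] := dgW y01; rewrite lt_neqAle h2 andbT/=; apply/eqP => E.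
move/negP: yd; apply; apply/dpointsP.
exists (dg y).+1; last by rewrite -E mulrC mulKf ?lt0r_neq0.
have /andP[bb1 bb2] := b_bounds.
rewrite /= -ltnS -(ltr_nat R) -E (lt_le_trans _ bb2)// -[ltRHS]mulr1 ltr_pM2l//.
by rewrite lt_neqAle y1; case/andP: y01.
Qed.

(* If the orbit of 1 reached a discontinuity from the wrong side, the one-sided orbit
   would return to 1, contradicting the definition of case 1. *)
Lemma shadow_side n : shadow n -> a_ n \in dpoints -> odd n = ~~ c1.
Proof.
move=> [d d0 hd] /dpointsP[i /andP[i1 ib] aE].
have bX k : 0 < beta ^+ k by exact: exprn_gt0.
have [h hp hgap] : exists2 h : R, 0 < h & forall j, (j <= n)%N ->
    forall s, s \in [:: 0, 1 & dpoints] -> s != a_ j -> h <= `|s - a_ j|.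
  elim: n {hd aE} => [|k [h h0 hh]].
    have [h h0 hh] := seq_gap [:: 0, 1 & dpoints] (a_ 0).
    by exists h => // j; rewrite leqn0 => /eqP ->.
  have [h' h0' hh'] := seq_gap [:: 0, 1 & dpoints] (a_ k.+1).
  exists (Num.min h h'); first by rewrite lt_min h0.
  move=> j; rewrite leq_eqVlt => /orP[/eqP -> s sd sa|]; rewrite ?ge_min.
    by rewrite hh' ?orbT.
  by rewrite ltnS => jk s sd sa; rewrite ge_min (hh j).
(* Small enough that for [n.+2] steps, the longest return below, the displacement stays under the
   gap [h]. *)
pose d1 := Num.min d (h / beta ^+ n.+2).
have d10 : 0 < d1 by rewrite lt_min d0 divr_gt0.
have bb m1 m2 : (m1 <= m2)%N -> beta ^+ m1 <= beta ^+ m2.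
  by move=> ?; rewrite ler_weXn2l ?(ltW beta1).
have h1 : h <= 1.
  have := hgap 0%N isT 0; rewrite inE eqxx sub0r normrN normr1; apply => //.
  by rewrite /= eq_sym oner_eq0.
have track t : 0 < t < d1 -> [/\ beta ^+ n.+2 * t < h,
    forall j, (j <= n)%N -> iter j (Tgen beta) (1 - t) = a_ j - (- beta) ^+ j * t &
    forall j, (j < n)%N -> digit beta (iter j (Tgen beta) (1 - t)) = dg (a_ j)].
  move=> /andP[t0]; rewrite lt_min => /andP[td]; rewrite ltr_pdivlMr// mulrC => tb.
  have [t01 ht] := hd t ltac:(by rewrite t0).
  have small j : (j <= n)%N -> 0 < beta ^+ j * t < h.
    move=> jn; rewrite mulr_gt0//= (le_lt_trans _ tb)// ler_wpM2r ?(ltW t0)//.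
    by apply: bb; rewrite -addn2 (leq_trans jn)// leq_addr.
  have np j : (j <= n)%N -> [/\ iter j T (1 - t) != 0, iter j T (1 - t) != 1 &
      iter j T (1 - t) \notin dpoints].
    move=> jn; have [E _] := ht j jn; have /andP[s1 s2] := small j jn.
    have ne s : s \in [:: 0, 1 & dpoints] -> iter j T (1 - t) != s.
      move=> sd; apply/eqP => E'; have : `|s - a_ j| = beta ^+ j * t.
        by rewrite -E' E addrAC subrr add0r normrN shadow_normXt.
      have [->|sa] := eqVneq s (a_ j); first by rewrite subrr normr0 => h0; rewrite -h0 ltxx in s1.
      by have := hgap j jn s sd sa; lra.
    split; [by apply: ne; rewrite !inE eqxx|by apply: ne; rewrite !inE eqxx orbT|].
    by apply/negP => /[dup] sd; apply/negP; rewrite -[_ \in _]/(_ \in _); have := ne (iter j T (1 - t)); rewrite !inE sd !orbT eqxx => /(_ isT).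
  have gen j : (j <= n)%N -> iter j (Tgen beta) (1 - t) = iter j T (1 - t).
    elim: j => // j IH jn; rewrite !iterS IH ?(ltnW jn)//.
    have [? ? ?] := np j (ltnW jn).
    by have [] := @Tgen_Tmb (iter j T (1 - t)) (iter01 _ t01).
  split=> // j jn; first by rewrite gen//; case: (ht j jn).
  have [n0 n1 nd] := np j (ltnW jn).
  rewrite gen ?(ltnW jn)//; have [_ ->] := Tgen_Tmb (iter01 j t01) n0 n1 nd.
  by have [_ ->] := ht j (ltnW jn).
have biE : beta * (i%:R / beta) = i%:R by rewrite mulrC divfK ?lt0r_neq0.
apply/eqP; case on: (odd n); case c: c1 => //=.
(* For odd [n] in Case 1 the orbit arrives just right of [i / beta] and returns to 1 after [n.+1]
   steps with last digit [i <> 0], which excludes Case 1. *)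
- move: c; rewrite /c1 => /asboolP cc; exfalso; move: cc.
  pose dd r := if (r < n)%N then dg (a_ r) : nat else i.
  apply: (@return_ncase1 n.+1 dd d1) => //; last by rewrite /= /dd ltnn => E; rewrite E in i1.
  move=> t td; have [tb tr trd] := track t td; have /andP[t0 _] := td.
  have bnt : 0 < beta ^+ n.+1 * t < 1.
    by rewrite mulr_gt0//= (lt_le_trans _ h1)// (le_lt_trans _ tb)// ler_wpM2r ?(ltW t0)// bb.
  have nE : iter n (Tgen beta) (1 - t) = i%:R / beta + beta ^+ n * t.
    by rewrite tr// aE signX on mulNr opprK.
  have hh : i%:R <= beta * iter n (Tgen beta) (1 - t) < i.+1%:R.
    by rewrite nE mulrDr biE mulrA -exprS -natr1; apply/andP; split; lra.
  have [TE DE] := Tgen_digit hh.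
  split; last by rewrite iterS TE nE mulrDr biE mulrA -exprS -natr1; ring.
  move=> r; rewrite ltnS leq_eqVlt /dd => /orP[/eqP ->|rn]; first by rewrite ltnn.
  by rewrite rn trd.
(* For even [n] in Case 2 the orbit arrives just left of [i / beta], passes next to 0 and returns to
   1 after [n.+2] steps with last digit 0, which forces Case 1. *)
- move: c; rewrite /c1 => /asboolP cc; exfalso; apply: cc.
  pose dd r := if (r < n)%N then dg (a_ r) : nat else if (r == n)%N then i.-1 else 0%N.
  apply: (@return_case1 n.+2 dd d1) => //; last by rewrite /= /dd ltnNge leqnSn/= eqn_leq ltnn.
  move=> t td; have [tb tr trd] := track t td; have /andP[t0 _] := td.
  have bnt : 0 < beta ^+ n.+1 * t < 1.
    by rewrite mulr_gt0//= (lt_le_trans _ h1)// (le_lt_trans _ tb)// ler_wpM2r ?(ltW t0)// bb.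
  have bnt2 : 0 < beta ^+ n.+2 * t < 1 by rewrite mulr_gt0//= (lt_le_trans tb).
  have nE : iter n (Tgen beta) (1 - t) = i%:R / beta - beta ^+ n * t.
    by rewrite tr// aE signX on.
  have i1E : (i.-1%:R : R) + 1 = i%:R by rewrite natr1 prednK.
  have hh : i.-1%:R <= beta * iter n (Tgen beta) (1 - t) < i.-1.+1%:R.
    by rewrite nE mulrBr biE mulrA -exprS -natr1; apply/andP; split; lra.
  have [TE DE] := Tgen_digit hh.
  have TE' : iter n.+1 (Tgen beta) (1 - t) = beta ^+ n.+1 * t.
    by rewrite iterS TE nE mulrBr biE mulrA -exprS -natr1 i1E; ring.
  have hh2 : 0%:R <= beta * iter n.+1 (Tgen beta) (1 - t) < 1%:R.
    by rewrite TE' mulrA -exprS; apply/andP; split; lra.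
  have [TE2 DE2] := Tgen_digit hh2.
  split; last by rewrite iterS TE2 TE' mulrA -exprS.
  move=> r; rewrite ltnS leq_eqVlt /dd => /orP[/eqP ->|].
    by rewrite ltnNge leqnSn/= eqn_leq ltnn.
  rewrite ltnS leq_eqVlt => /orP[/eqP ->|rn]; first by rewrite ltnn eqxx.
  by rewrite rn trd.
Qed.

Lemma shadowS n : shadow n -> shadow n.+1.
Proof.
move=> sh; have side := shadow_side sh; have [d d0 hd] := sh.
have [h h0 hh] := seq_gap dpoints (a_ n).
have bX k : 0 < beta ^+ k by exact: exprn_gt0.
exists (Num.min d (h / beta ^+ n)); first by rewrite lt_min d0 divr_gt0.
move=> t /andP[t0]; rewrite lt_min => /andP[td]; rewrite ltr_pdivlMr// mulrC => tb.
have [t01 ht] := hd t ltac:(by rewrite t0); split=> //.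
have [En _] := ht n (leqnn n).
have dgE : dg (iter n T (1 - t)) = dg (a_ n).
  apply: (dg_near (a01 n) hh (iter01 _ t01)).
    by rewrite En addrAC subrr add0r normrN shadow_normXt.
  move=> /side; rewrite En signX => ->; have := mulr_gt0 (bX n) t0.
  by case: c1 => /=; lra.
move=> j; rewrite leq_eqVlt => /orP[/eqP ->|]; last first.
  rewrite ltnS => jn; have [E1 E2] := ht j jn; split=> // _.
  by move: jn; rewrite leq_eqVlt => /orP[/eqP ->//|/E2].
rewrite ltnn; split=> //; rewrite !iterS.
have := TmbB (iter01 n t01) (a01 n) dgE; rewrite En exprS; lra.
Qed.

Lemma shadow_all n : shadow n.
Proof.
elim: n => [|n]; last exact: shadowS.
exists 1 => // t /andP[t0 t1]; split; first by apply/andP; split; lra.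
by move=> j; rewrite leqn0 => /eqP ->; rewrite expr0 mul1r.
Qed.

Lemma dpoint_dg s : s \in dpoints -> 0 <= s <= 1 ->
  beta * s = (if c1 then (dg s).+1%:R else (dg s)%:R).
Proof.
move=> /dpointsP[i /andP[i1 ib] sE] s01.
have biE : beta * s = i%:R by rewrite sE mulrC divfK ?lt0r_neq0.
have s0 : s != 0 by rewrite sE mulf_neq0 ?invr_neq0 ?lt0r_neq0// ltr0n.
have := inD_dg s01; rewrite /inD s01/= biE; case: ifP => _.
  rewrite (negbTE s0) orbF ltr_nat ler_nat => /andP[h1 h2].
  by congr (_%:R); apply/eqP; rewrite eqn_leq h1 h2.
rewrite ler_nat ltr_nat ltnS => /andP[h1 h2].
by congr (_%:R); apply/eqP; rewrite eqn_leq h1 h2.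
Qed.

Definition sided n x := exists sg : bool, exists2 d : R, 0 < d & forall t, 0 < t < d ->
  let y := x + (-1) ^+ sg * t in
  0 <= y <= 1 /\ forall j, (j < n)%N -> dg (iter j T y) = dg (iter j T x).

Lemma sided1 n : exists2 d : R, 0 < d & forall t, 0 < t < d ->
  0 <= 1 - t <= 1 /\ forall j, (j < n)%N -> dg (iter j T (1 - t)) = dg (a_ j).
Proof.
have [d d0 h] := shadow_all n; exists d => // t /h[t01 ht]; split=> // j jn.
by have [_ ->] := ht j (ltnW jn).
Qed.

Lemma sided_step n x y t : 0 <= x <= 1 -> 0 <= y <= 1 -> dg y = dg x ->
  (forall j, (j < n)%N -> dg (iter j T (T x + t)) = dg (iter j T (T x))) ->
  T y = T x + t ->
  forall j, (j < n.+1)%N -> dg (iter j T y) = dg (iter j T x).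
Proof. by move=> x01 y01 E h TE [|j] jn //; rewrite !iterSr TE h. Qed.

Lemma dg0 : dg 0 = 0%N :> nat.
Proof.
by apply/dg_eq; rewrite /inD lexx ler01 eqxx mulr0 /=; case: c1; rewrite ?ler0n ?ltr0n ?lexx ?orbT.
Qed.

Lemma T0 : T 0 = 1.
Proof. by rewrite TmbE ?dg0 ?mulr0 ?subr0// lexx ler01. Qed.

Lemma sided0 n : exists2 d : R, 0 < d & forall t, 0 < t < d ->
  0 <= t <= 1 /\ forall j, (j < n)%N -> dg (iter j T t) = dg (iter j T 0).
Proof.
case: n => [|n].
  by exists 1 => // t /andP[t0 t1]; split; [apply/andP; split; lra|].
have [d d0 h] := sided1 n.
have bi : beta^-1 < 1 by rewrite invf_lt1.
exists (Num.min beta^-1 (d / beta)); first by rewrite lt_min invr_gt0 b0 divr_gt0.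
move=> t /andP[t0]; rewrite lt_min => /andP[t1]; rewrite ltr_pdivlMr// mulrC => td.
have bt1 : beta * t < 1 by rewrite mulrC -ltr_pdivlMr// div1r.
have bt0 : 0 < beta * t by exact: mulr_gt0.
have t01 : 0 <= t <= 1 by apply/andP; split; lra.
split=> //; have E : dg t = dg 0.
  by apply/val_inj; rewrite /= dg0; apply: dg_open.
have [_ ht] := h (beta * t) ltac:(by rewrite bt0).
apply: (@sided_step _ _ _ (- (beta * t))) => //; first by rewrite lexx ler01.
  by rewrite T0.
by rewrite T0 TmbE// E dg0.
Qed.

(** No digit cell of a point of [[0,1]] reduces to that point. At a discontinuity the good side is
    sent to the inner side of 0 or 1, where the one-sided orbit of 1 decides; elsewhere [T] is a
    local homeomorphism reversing the side. *)
Lemma sided_all n x : 0 <= x <= 1 -> sided n x.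
Proof.
elim: n x => [|n IH] x x01.
  have [x0|x0] := ltP x 1.
    exists false; exists (1 - x); first by lra.
    by move=> t /andP[t0 t1]; rewrite expr0 mul1r; split=> //; apply/andP; split; case/andP: x01; lra.
  exists true; exists 1 => // t /andP[t0 t1]; rewrite expr1; split=> //.
  by case/andP: x01 => *; apply/andP; split; lra.
have [->|xn1] := eqVneq x 1.
  by exists true; have [d d0 h] := sided1 n.+1; exists d => // t /h; rewrite expr1 mulN1r.
have [->|xn0] := eqVneq x 0.
  by exists false; have [d d0 h] := sided0 n.+1; exists d => // t /h; rewrite expr0 mul1r add0r.
have xi : 0 < x < 1 by rewrite !lt_neqAle eq_sym xn0 xn1.
have [h h0 hh] := seq_gap [:: 0, 1 & dpoints] x.
have hh' s : s \in dpoints -> s != x -> h <= `|s - x|.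
  by move=> sd; apply: hh; rewrite !inE sd !orbT.
have hx : h <= x by have := hh 0; rewrite inE eqxx sub0r normrN gtr0_norm; [apply=> //; rewrite eq_sym|case/andP: xi].
have hx1 : h <= 1 - x by have := hh 1; rewrite !inE eqxx orbT gtr0_norm; [apply=> //; rewrite eq_sym|case/andP: xi; lra].
have y01 sg t : 0 < t < h -> 0 <= x + (-1) ^+ (sg : bool) * t <= 1.
  by case: sg; rewrite ?expr1 ?expr0 => /andP[? ?]; apply/andP; split; lra.
have yx sg t : 0 < t < h -> `|x + (-1) ^+ (sg : bool) * t - x| < h.
  by case: sg; rewrite ?expr1 ?expr0 addrAC subrr add0r ?mulN1r ?mul1r ?normrN => /andP[? ?]; rewrite gtr0_norm.
have [xd|xd] := boolP (x \in dpoints); last first.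
  have [sg [d d0 hd]] := IH (T x) (Tmb01 x01).
  exists (~~ sg); exists (Num.min h (d / beta)); first by rewrite lt_min h0 divr_gt0.
  move=> t /andP[t0]; rewrite lt_min => /andP[th]; rewrite ltr_pdivlMr// mulrC => td; cbv zeta.
  have tt : 0 < t < h by rewrite t0.
  split; first exact: y01.
  have E : dg (x + (-1) ^+ (~~ sg) * t) = dg x.
    by apply: (dg_near x01 hh') => //; [exact: y01|exact: yx|rewrite (negbTE xd)].
  have [_ hd'] := hd (beta * t) ltac:(by rewrite mulr_gt0).
  apply: (@sided_step _ _ _ ((-1) ^+ sg * (beta * t))) => //; first exact: y01.
  by rewrite !TmbE// ?E; [case: (sg); rewrite ?expr1 ?expr0; ring|exact: y01].
have xE := dpoint_dg xd x01.
have [c|c] := boolP c1.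
  have Tx : T x = 0 by rewrite TmbE// xE c subrr.
  have [d d0 hd] := sided0 n.
  exists true; exists (Num.min h (d / beta)); first by rewrite lt_min h0 divr_gt0.
  move=> t /andP[t0]; rewrite lt_min => /andP[th]; rewrite ltr_pdivlMr// mulrC => td; cbv zeta.
  have tt : 0 < t < h by rewrite t0.
  split; first exact: y01.
  have E : dg (x + (-1) ^+ true * t) = dg x.
    apply: (dg_near x01 hh') => //; [exact: y01|exact: yx|].
    by rewrite c expr1 mulN1r; lra.
  have [_ hd'] := hd (beta * t) ltac:(by rewrite mulr_gt0).
  apply: (@sided_step _ _ _ (beta * t)) => //; first exact: y01.
    by rewrite Tx add0r.
  by rewrite !TmbE// ?E; [rewrite expr1; ring|exact: y01].
have Tx : T x = 1 by rewrite TmbE// xE (negbTE c) -natr1; ring.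
have [d d0 hd] := sided1 n.
exists false; exists (Num.min h (d / beta)); first by rewrite lt_min h0 divr_gt0.
move=> t /andP[t0]; rewrite lt_min => /andP[th]; rewrite ltr_pdivlMr// mulrC => td; cbv zeta.
have tt : 0 < t < h by rewrite t0.
split; first exact: y01.
have E : dg (x + (-1) ^+ false * t) = dg x.
  apply: (dg_near x01 hh') => //; [exact: y01|exact: yx|].
  by rewrite (negbTE c) expr0 mul1r; lra.
have [_ hd'] := hd (beta * t) ltac:(by rewrite mulr_gt0).
apply: (@sided_step _ _ _ (- (beta * t))) => //; first exact: y01.
  by rewrite Tx.
by rewrite !TmbE// ?E; [rewrite expr0; ring|exact: y01].
Qed.

Lemma expansion n x y : 0 <= x <= 1 -> 0 <= y <= 1 ->
  word T dg n x = word T dg n y ->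
  iter n T x - iter n T y = (- beta) ^+ n * (x - y).
Proof.
move=> x01 y01 /wordE h; elim: n h => [|n IH] h; first by rewrite mul1r.
rewrite !iterS TmbB ?iter01//; last exact: h.
by rewrite IH ?exprS ?mulrA// => i ilt; apply: h; exact: ltnW.
Qed.

Lemma word_dist n x y : 0 <= x <= 1 -> 0 <= y <= 1 ->
  word T dg n x = word T dg n y -> `|x - y| <= beta ^- n.
Proof.
move=> x01 y01 /(expansion x01 y01) E.
have bX : 0 < beta ^+ n by exact: exprn_gt0.
rewrite -[leRHS]mul1r ler_pdivlMr// mulrC.
have <- : `|(- beta) ^+ n * (x - y)| = beta ^+ n * `|x - y|.
  by rewrite normrM normrX normrN (gtr0_norm b0).
rewrite -E; have /andP[? ?] := iter01 n x01; have /andP[? ?] := iter01 n y01.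
by rewrite ler_norml; apply/andP; split; lra.
Qed.

Lemma beta_pow_small (e : R) : 0 < e -> exists k0, forall k, (k0 <= k)%N -> beta ^- k < e.
Proof.
move=> e0; have b1' : `|beta^-1| < 1 by rewrite gtr0_norm ?invr_gt0// invf_lt1.
have /cvgrPdist_lt/(_ _ e0)[k0 _ h] := cvg_geometric 1 b1'.
exists k0 => k /h; rewrite /geometric/= mul1r sub0r normrN exprVn gtr0_norm//.
by rewrite invr_gt0 exprn_gt0.
Qed.

Lemma beta_generating : generating T dg.
Proof.
move=> e e0; have [k0 h] := beta_pow_small e0.
by exists k0 => k /h hk x y x01 y01 w; apply: le_lt_trans hk; exact: word_dist.
Qed.

Lemma wrong_le (e e' : R) x : e <= e' -> wrong e x -> wrong e' x.
Proof.
move=> ee [x01 [s sd h]]; split=> //; exists s => //.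
by move: h; case: c1 => /andP[? ?]; apply/andP; split; lra.
Qed.

Lemma wrong_shrink x : exists2 e : R, 0 < e & ~ wrong e x.
Proof.
have [h h0 hh] := seq_gap dpoints x; exists h => // -[_ [s sd]].
have [->|sx] := eqVneq s x; first by case: c1 => /andP[]; lra.
have := hh s sd sx; rewrite ler_normr; case: c1 => + /andP[]; lra.
Qed.

Lemma iter_gap (N : nat) : exists2 h : R, 0 < h & forall j, (j <= N)%N ->
    forall s, s \in dpoints -> s != a_ j -> h <= `|s - a_ j|.
Proof.
elim: N => [|k [h h0 hh]].
  have [h h0 hh] := seq_gap dpoints (a_ 0).
  by exists h => // j; rewrite leqn0 => /eqP ->.
have [h' h0' hh'] := seq_gap dpoints (a_ k.+1).
exists (Num.min h h'); first by rewrite lt_min h0.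
move=> j; rewrite leq_eqVlt => /orP[/eqP -> s sd sa|]; rewrite ?ge_min.
  by rewrite hh' ?orbT.
by rewrite ltnS => jk s sd sa; rewrite ge_min (hh j).
Qed.

(** The orbit of [1 - t] stays close to that of 1 and has the same digits. A discontinuity with this
    orbit on its wrong side would have to be the point [a_ j] itself, and then the digits would
    differ. *)
Lemma not_wrong_near1 (N : nat) : exists2 d : R, 0 < d & forall t, 0 < t < d ->
  forall j, (j <= N)%N -> ~ wrong d (iter j T (1 - t)).
Proof.
have [h h0 hh] := iter_gap N; have [d d0 hd] := shadow_all N.+1.
have bX k : 0 < beta ^+ k by exact: exprn_gt0.
have bX1 k : 1 <= beta ^+ k by rewrite exprn_ege1// ltW.
(* Two distances of at most [h / 2], to the orbit of 1 and to a discontinuity, force the latter two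
   to coincide. *)
pose d' := Num.min d (h / 2 / beta ^+ N).
have d'0 : 0 < d' by rewrite lt_min d0 !divr_gt0.
have d'h : d' <= h / 2.
  rewrite ge_min; apply/orP; right; rewrite ler_pdivrMr// ler_peMr//; lra.
exists d' => // t /andP[t0]; rewrite {1}lt_min => /andP[td]; rewrite ltr_pdivlMr// mulrC => tb.
move=> j jN [_ [s sd w]]; have [t01 ht] := hd t ltac:(by rewrite t0).
have [E /(_ jN)] := ht j (leqW jN).
have small : beta ^+ j * t < h / 2.
  by rewrite (le_lt_trans _ tb)// ler_wpM2r ?(ltW t0)// ler_weXn2l// ltW.
have ya : `|iter j T (1 - t) - a_ j| < h / 2.
  by rewrite E addrAC subrr add0r normrN shadow_normXt.
have sa : s = a_ j.
  apply/eqP/negPn/negP => sa; have := hh j jN s sd sa; rewrite ler_normr.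
  by move: ya w; rewrite ltr_norml; case: c1 => /andP[? ?] /andP[? ?]; lra.
have sE : beta * s = (if c1 then (dg (a_ j)).+1%:R else (dg (a_ j))%:R).
  by rewrite -sa; apply: dpoint_dg => //; rewrite sa a01.
move=> dE; have := dgW (iter01 j t01); rewrite dE; have := inD_dg (iter01 j t01).
rewrite /inD iter01//= dE; move: sE w; case: c1 => sE /andP[w1 w2].
  have : beta * s < beta * iter j T (1 - t) by rewrite ltr_pM2l.
  by rewrite sE; lra.
have : beta * iter j T (1 - t) < beta * s by rewrite ltr_pM2l.
by rewrite sE; lra.
Qed.

Lemma dg_below (s : R) i t : (1 <= i)%N -> s = i%:R / beta -> 0 < t -> beta * t < 1 ->
  0 <= s - t <= 1 -> T (s - t) = beta * t.
Proof.
move=> i1 sE t0 bt y01; have bs : beta * s = i%:R by rewrite sE mulrC divfK ?lt0r_neq0.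
have iE : (i.-1%:R : R) + 1 = i%:R by rewrite natr1 prednK.
have bt0 := mulr_gt0 b0 t0.
rewrite TmbE// (@dg_open i.-1)// -?natr1 ?iE mulrBr bs; lra.
Qed.

Lemma dg_above (s : R) i t : s = i%:R / beta -> 0 < t -> beta * t < 1 ->
  0 <= s + t <= 1 -> T (s + t) = 1 - beta * t.
Proof.
move=> sE t0 bt y01; have bs : beta * s = i%:R by rewrite sE mulrC divfK ?lt0r_neq0.
have bt0 := mulr_gt0 b0 t0.
rewrite TmbE// (@dg_open i)// -?natr1 mulrDr bs; lra.
Qed.

(** A wrong point is sent next to 1, at once in Case 1 and via a neighbourhood of 0 in Case 2; then
    [not_wrong_near1] applies. Thus wrong visits are more than [N] steps apart. *)
Lemma wrong_return N : exists2 e : R, 0 < e & forall x, wrong e x ->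
  forall j, (1 <= j <= N)%N -> ~ wrong e (iter j T x).
Proof.
have [d d0 hd] := not_wrong_near1 N.
have b20 : 0 < beta ^+ 2 by exact: exprn_gt0.
have bb : beta <= beta ^+ 2 by rewrite expr2 ler_peMr ?(ltW beta1) ?(ltW b0).
(* The bound 1/4 keeps the intermediate point next to 0 away from all discontinuities; the later
   factor [beta ^+ 2] pays for the two steps towards 1. *)
pose d2 := Num.min d (1 / 4).
have d20 : 0 < d2 by rewrite lt_min d0; lra.
have d2d : d2 <= d by rewrite ge_min lexx.
have d24 : d2 <= 1 / 4 by rewrite ge_min lexx orbT.
exists (d2 / beta ^+ 2); first exact: divr_gt0.
have e_le : d2 / beta ^+ 2 <= d2.
  by rewrite ler_pdivrMr// ler_peMr ?(ltW d20)// exprn_ege1// ltW.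
move=> x [x01 [s sd hs]] j /andP[j1 jN] hw.
have /dpointsP[i /andP[i1 ib] sE] := sd.
have hw' := wrong_le (le_trans e_le d2d) hw.
case cc : c1 hs => /andP[h1 h2].
  set t := x - s; have t0 : 0 < t by rewrite subr_gt0.
  have xE : x = s + t by rewrite /t; ring.
  have tb : t * beta ^+ 2 < d2 by rewrite -ltr_pdivlMr// /t; lra.
  have bt : beta * t < d2.
    by rewrite (le_lt_trans _ tb)// mulrC ler_wpM2l ?(ltW t0).
  have Tx : T x = 1 - beta * t by rewrite xE (dg_above sE t0) -?xE//; lra.
  case: j j1 jN hw' {hw} => // j _ jN; rewrite iterSr Tx; apply: hd; last exact: ltnW.
  by rewrite mulr_gt0//=; lra.
set t := s - x; have t0 : 0 < t by rewrite subr_gt0.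
have xE : x = s - t by rewrite /t; ring.
have tb : t * beta ^+ 2 < d2 by rewrite -ltr_pdivlMr// /t; lra.
have bt : beta * t < d2.
  by rewrite (le_lt_trans _ tb)// mulrC ler_wpM2l ?(ltW t0).
have Tx : T x = beta * t by rewrite xE (dg_below i1 sE t0) -?xE//; lra.
have bt0 : 0 < beta * t by exact: mulr_gt0.
have bt01 : 0 <= beta * t <= 1 by apply/andP; split; lra.
have bbt : beta * (beta * t) < d2 by rewrite mulrA -expr2 mulrC.
case: j j1 jN hw' hw => // -[|j] _ jN hw' hw.
  move: hw; rewrite /= Tx => -[_ [s' /dpointsP[i' /andP[i'1 _] s'E]]]; rewrite cc => /andP[w1 _].
  have : 1 <= beta * s' by rewrite s'E mulrC divfK ?lt0r_neq0// ler1n.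
  have h3 : beta * (d2 / beta ^+ 2) <= d2.
    by rewrite mulrA ler_pdivrMr// mulrC ler_wpM2l ?(ltW d20).
  have : beta * (s' - d2 / beta ^+ 2) < beta * (beta * t) by rewrite ltr_pM2l.
  by rewrite mulrBr; lra.
have TTx : T (T x) = 1 - beta * (beta * t).
  rewrite Tx -[X in T X]add0r (@dg_above 0 0) ?mul0r// ?add0r//; lra.
have E : iter j.+2 T x = iter j T (1 - beta * (beta * t)) by rewrite -TTx -iterSr -iterSr.
have tt : 0 < beta * (beta * t) < d by rewrite mulr_gt0//=; exact: lt_le_trans d2d.
have jN' : (j <= N)%N by exact: leq_trans (leq_trans (leqnSn _) (leqnSn _)) jN.
by apply: (hd _ tt _ jN'); rewrite -E.
Qed.

Lemma measurable_wrong (e : R) : measurable [set x | wrong e x].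
Proof.
rewrite (_ : [set x | _] = (`[0, 1] : set R) `&`
  \bigcup_(s in [set s | s \in dpoints]) (if c1 then `]s, s + e[ else `]s - e, s[)%classic).
  apply: measurableI; first exact: measurable_itv.
  apply: fin_bigcup_measurable; first exact: finite_seq.
  by move=> s _; case: c1; exact: measurable_itv.
apply/seteqP; split=> x /=; rewrite in_itv/=.
  by move=> [-> [s sd h]]; split=> //; exists s => //; case: c1 h; rewrite /= in_itv.
by move=> [x01 [s sd h]]; split=> //; exists s => //; case: c1 h; rewrite /= in_itv.
Qed.

Lemma mlab_dg : mlab dg.
Proof.
have m01 : measurable (`[0, 1] : set R) by exact: measurable_itv.
suff mi (i : 'I_b.+1) : measurable [set x | inD i x].
  move=> i; have [->|i0] := eqVneq i ord0.
    rewrite (_ : _ @^-1` _ = [set x | inD (@ord0 b) x] `|` ~` `[0, 1]).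
      by apply: measurableU => //; exact: measurableC.
    apply/seteqP; split=> x /=.
      have [x01|x01] := boolP (0 <= x <= 1); last by right; rewrite in_itv/=; exact/negP.
      by move=> E; left; have := inD_dg x01; rewrite E.
    case=> [h|]; first by apply/val_inj/dg_eq.
    rewrite in_itv/= => /negP x01; rewrite /dg; case: pickP => // j.
    by rewrite /inD (negbTE x01).
  rewrite (_ : _ @^-1` _ = [set x | inD i x])//.
  apply/seteqP; split=> x /=; last by move=> h; apply/val_inj/dg_eq.
  move=> E; rewrite -E; apply: inD_dg; apply: contraT => x01.
  move: E i0; rewrite /dg; case: pickP => [j|_ <-]; first by rewrite /inD (negbTE x01).
  by rewrite eqxx.
rewrite (_ : [set x | _] = (`[0, 1] : set R) `&` (if c1 then
    `]i%:R / beta, i.+1%:R / beta]%classic `|` (if i == ord0 then [set 0] else set0)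
    else `[i%:R / beta, i.+1%:R / beta[%classic)).
  apply: measurableI => //; case: c1; last exact: measurable_itv.
  apply: measurableU; first exact: measurable_itv.
  by case: ifP => _; [exact: measurable_set1|exact: measurable0].
apply/seteqP; split=> x /=; rewrite /inD in_itv/=; case: c1.
- move=> /andP[-> /andP[/orP[h1|/andP[/eqP -> /eqP i0]] h2]]; split=> //.
    by left; rewrite /= in_itv/= ltr_pdivrMr// ler_pdivlMr// ![_ * beta]mulrC h1.
  by right; rewrite (_ : i == ord0)//; apply/eqP/val_inj.
- by move=> /andP[-> /andP[h1 h2]]; split=> //; rewrite /= in_itv/= ler_pdivrMr// ltr_pdivlMr// ![_ * beta]mulrC h1.
- move=> [-> [|]] /=.
    by rewrite /= in_itv/= ltr_pdivrMr// ler_pdivlMr// ![_ * beta]mulrC => /andP[-> ->].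
  by case: ifP => // /eqP -> /= ->; rewrite eqxx mulr0 ler0n orbT.
- by move=> [->]; rewrite /= in_itv/= ler_pdivrMr// ltr_pdivlMr// ![_ * beta]mulrC => /andP[-> ->].
Qed.

Lemma measurable_Tmb (A : set R) : measurable A -> measurable (T @^-1` A).
Proof.
move=> mA; have m01 : measurable (`[0, 1] : set R) by exact: measurable_itv.
have maff (i : nat) : measurable ((fun x => i.+1%:R - beta * x) @^-1` A).
  rewrite -[X in measurable X]setTI.
  have : measurable_fun [set: R] (fun x : R => i.+1%:R - beta * x).
    by apply: measurable_funB; [exact: measurable_cst|apply: measurable_funM; [exact: measurable_cst|exact: measurable_id]].
  exact.
rewrite (_ : _ @^-1` _ = (`[0, 1] `&` \bigcup_(i in [set: 'I_b.+1])
    (dg @^-1` [set i] `&` (fun x => i.+1%:R - beta * x) @^-1` A)) `|`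
    (~` `[0, 1] `&` [set x | A 0])).
  apply: measurableU; apply: measurableI => //.
  - by apply: fin_bigcup_measurable => // i _; apply: measurableI => //; exact: mlab_dg.
  - exact: measurableC.
  - have [A0|A0] := pselect (A 0).
      by rewrite (_ : [set x | _] = setT); [exact: measurableT|apply/seteqP; split].
    by rewrite (_ : [set x | _] = set0); [exact: measurable0|apply/seteqP; split].
have out x : ~ (0 <= x <= 1) -> T x = 0.
  move=> nx; rewrite /Tmb; case: asboolP => [E|n0]; first by case: nx; rewrite E lexx ler01.
  case: asboolP => [E|n1]; first by case: nx; rewrite E lexx ler01.
  case: asboolP => [|nd].
    move=> /discP; rewrite !inE => /orP[/eqP//|/orP[/eqP//|/dpointsP[i /andP[i1 ib] E]]].
    case: nx; rewrite E divr_ge0 ?(ltW b0)//= ler_pdivrMr// mul1r.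
    by have /andP[h _] := b_bounds; rewrite (le_trans _ (ltW h))// ler_nat.
  by case: asboolP => // h; case: nx; case/andP: h => /ltW -> /ltW ->.
apply/seteqP; split=> x /=; rewrite in_itv/=.
  have [x01|/negP x01] := boolP (0 <= x <= 1).
    by rewrite TmbE// => h; left; split=> //; exists (dg x).
  by rewrite out// => h; right; split.
by case=> [[x01 [i _ [/= iE h]]]|[x01 h]]; [rewrite TmbE// iE|rewrite out].
Qed.

Section Yrrap.
Hypothesis yb : yrrap beta.

(** The points are 0 and the orbit of 1. Closure is asked only strictly inside a branch, since the
    branch formula gives 0 or 1 at its ends. *)
Lemma markov_set : exists S : seq R, [/\ 0 \in S, 1 \in S,
  forall s, s \in S -> 0 <= s <= 1 &
  forall s (d : nat), s \in S -> d%:R < beta * s -> beta * s < d.+1%:R ->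
    d.+1%:R - beta * s \in S].
Proof.
have [m [p [p0 E]]] := yb.
exists (0 :: [seq a_ j | j <- iota 0 (m + p)]); split.
- by rewrite inE eqxx.
- rewrite inE; apply/orP; right; apply/mapP; exists 0%N => //.
  by rewrite mem_iota/= add0n addn_gt0 p0 orbT.
- by move=> s; rewrite inE => /orP[/eqP ->|/mapP[j _ ->]]; rewrite ?lexx ?ler01.
- move=> s d; rewrite inE => /orP[/eqP ->|/mapP[j]].
    by rewrite mulr0 ltrn0.
  rewrite mem_iota/= add0n => jm -> h1 h2.
  rewrite inE; apply/orP; right.
  have -> : d.+1%:R - beta * a_ j = a_ j.+1.
    by rewrite iterS TmbE ?a01// (@dg_open d) ?a01.
  (* The image of the last listed point is [a_ (m + p)], which is [a_ m] again. *)
  move: jm; rewrite leq_eqVlt => /orP[/eqP ->|jm]; last first.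
    by apply/mapP; exists j.+1 => //; rewrite mem_iota.
  by apply/mapP; exists m; rewrite ?E// mem_iota/= add0n -[X in (X < _)%N]addn0 ltn_add2l.
Qed.

End Yrrap.

End MinusBetaDigits.

(** * Weak compactness *)

Section Integration.
Variable R : realType.
Implicit Types (nu mu : {measure set R -> \bar R}).

Definition intg nu (f : R -> R) : R := fine (\int[nu]_(x in `[0%R, 1%R]) (f x)%:E)%E.

Let m01 : measurable (`[0, 1] : set R). Proof. exact: measurable_itv. Qed.

Lemma within_integrable nu (f : R -> R) : prob01 nu -> {within `[0, 1], continuous f} ->
  nu.-integrable `[0, 1] (EFin \o f).
Proof.
move=> nu01 cf; apply: measurable_bounded_integrable => //.
- by rewrite (prE nu01.1)// ltry.
- exact: subspace_continuous_measurable_fun.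
- have /compact_bounded[M [_ mrt]] := continuous_compact cf (@segment_compact R 0 1).
  by exists M; split; rewrite ?num_real// => ? ? ? ?; exact: mrt.
Qed.

Section Step.
Variables (nu : {measure set R -> \bar R}) (nu01 : prob01 nu).
Variables (K : finType) (X : R -> K) (mX : mlab X).

Let stepE (u : K -> R) x : (u (X x))%:E =
  (\sum_k (u k)%:E * (\1_(X @^-1` [set k]) x)%:E)%E.
Proof.
under eq_bigr do rewrite -EFinM.
rewrite sumEFin; congr EFin; rewrite (bigD1 (X x))//= big1 ?addr0.
  by rewrite indicE mem_set ?mulr1.
by move=> k kx; rewrite indicE memNset ?mulr0//= => /eqP; rewrite eq_sym (negbTE kx).
Qed.

Let integrable_ind k : nu.-integrable `[0, 1] (fun x => (\1_(X @^-1` [set k]) x)%:E).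
Proof.
apply: measurable_bounded_integrable => //.
- by rewrite (prE nu01.1)// ltry.
- exists 1; split; rewrite ?num_real// => M M1 x _ /=; rewrite indicE.
  by case: (_ \in _); rewrite ?normr1 ?normr0 ltW// (lt_trans _ M1).
Qed.

Lemma step_integrable (u : K -> R) : nu.-integrable `[0, 1] (EFin \o (u \o X)).
Proof.
rewrite (_ : _ \o _ = fun x => (\sum_k (u k)%:E * (\1_(X @^-1` [set k]) x)%:E)%E).
  by apply: integrable_sum => // k _; apply: integrableZl => //; exact: integrable_ind.
by apply/funext => x; exact: stepE.
Qed.

Lemma step_intg (u : K -> R) : intg nu (u \o X) = \sum_k u k * dist nu X k.
Proof.
rewrite /intg (eq_integral _ _ (fun x _ => stepE u x)).
rewrite integral_sum//; last by move=> k; apply: integrableZl => //; exact: integrable_ind.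
under eq_bigr => k _.
  rewrite (integralZl m01 (integrable_ind k)) integral_indic// (prE nu01.1); last exact: measurableI.
  rewrite -EFinM.
  rewrite (pr_eq01 nu01 (B := X @^-1` [set k])); [|exact: measurableI|by []|]; last first.
    by move=> x x01; split=> [[]//|h]; split=> //=; rewrite in_itv.
  over.
by rewrite sumEFin.
Qed.

(** The error may depend on the label: constant for uniform approximation, and 0 or 1 for test
    functions known only on clean points. *)
Lemma intg_approx (f : R -> R) (v e : K -> R) : {within `[0, 1], continuous f} ->
  (forall x, 0 <= x <= 1 -> `|f x - v (X x)| <= e (X x)) ->
  `|intg nu f - \sum_k v k * dist nu X k| <= \sum_k e k * dist nu X k.
Proof.
move=> cf h; have If := within_integrable nu01 cf.
have h1 : intg nu f <= intg nu ((fun k => v k + e k) \o X).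
  apply: le_Rintegral => //; first exact: step_integrable.
  by move=> x /= /itvP x01; have := h x; rewrite !x01 ler_norml => /(_ isT) /andP[]; lra.
have h2 : intg nu ((fun k => v k - e k) \o X) <= intg nu f.
  apply: le_Rintegral => //; first exact: step_integrable.
  by move=> x /= /itvP x01; have := h x; rewrite !x01 ler_norml => /(_ isT) /andP[]; lra.
move: h1 h2; rewrite !step_intg.
rewrite (eq_bigr (fun k => v k * dist nu X k + e k * dist nu X k)); last by move=> k _; rewrite mulrDl.
rewrite big_split/= => h1.
rewrite (eq_bigr (fun k => v k * dist nu X k - e k * dist nu X k)); last by move=> k _; rewrite mulrBl.
rewrite sumrB => h2; rewrite ler_norml; apply/andP; split; lra.
Qed.

End Step.

Lemma unif_cont01 (f : R -> R) (e : R) : {within `[0, 1], continuous f} -> 0 < e ->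
  exists2 d : R, 0 < d & forall x y, 0 <= x <= 1 -> 0 <= y <= 1 -> `|x - y| < d ->
    `|f x - f y| <= e.
Proof.
move=> cf e0; have := @segment_compact R 0 1; rewrite compact_near_coveringP => cov.
pose P (d : R) (x : R) := forall y, 0 <= x <= 1 -> 0 <= y <= 1 -> `|x - y| < d -> `|f x - f y| <= e.
have : \forall d \near (0:R)^'+, `[0, 1] `<=` P d.
  apply: cov => x x01.
  move/subspace_continuousP : cf => /(_ x x01) cfx.
  have e20 : 0 < e / 2 by lra.
  have /cvgrPdist_lt/(_ _ e20) := cfx; rewrite near_withinE => -[r /= r0 hr].
  have hr' y : 0 <= y <= 1 -> `|x - y| < r -> `|f x - f y| < e / 2.
    by move=> y01 xy; apply: hr => //; rewrite /= in_itv.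
  exists (ball x (r / 2), [set d : R | d < r / 2]) => /=.
    split; first by apply: nbhsx_ballx; lra.
    by apply: nbhs_right_lt; lra.
  move=> [x' d] /= [xx' dr] y x'01 y01 x'y.
  have h1 : `|f x - f x'| < e / 2 by apply: hr' => //; move: xx'; rewrite /ball/=; lra.
  have h2 : `|f x - f y| < e / 2.
    apply: hr' => //; have := ler_distD x' x y; move: xx'; rewrite /ball/=; lra.
  have := ler_distD (f x) (f x') (f y); rewrite (distrC (f x') (f x)); move: h1 h2; clear; lra.
move=> nearP.
have [d [d0 hd]] : exists d : R, 0 < d /\ `[0, 1] `<=` P d.
  near (0:R)^'+ => d; exists d; split; first by near: d; exact: nbhs_right_gt.
  by near: d.
exists d => // x y x01 y01 xy; apply: hd => //; by rewrite /= in_itv.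
Unshelve. all: by end_near. Qed.

Definition cdf nu (t : R) : R := pr nu `]-oo, t].

Let mray (t : R) : measurable (`]-oo, t] : set R). Proof. exact: measurable_itv. Qed.

Lemma cdf01 nu t : prob01 nu -> 0 <= cdf nu t <= 1.
Proof. by move=> nu01; rewrite pr_ge0 pr_le1// nu01.1. Qed.

Section Grid.
Variables (N : nat) (g : nat -> R).
Hypothesis g_inc : forall i j, (i < j)%N -> g i < g j.

Definition gridlabel (x : R) : 'I_N.+1 := inord (find (fun k => x <= g k) (iota 0 N)).

Let gridlabel_le x (k : nat) : (k < N)%N -> (gridlabel x <= k)%N = (x <= g k).
Proof.
move=> kN; rewrite /gridlabel inordK; last by rewrite ltnS (leq_trans (find_size _ _))// size_iota.
apply/idP/idP => [fk|xg].
  have h : has (fun k => x <= g k) (iota 0 N) by rewrite has_find size_iota (leq_ltn_trans fk).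
  have := nth_find 0%N h; rewrite nth_iota ?add0n ?(leq_ltn_trans fk)// => xg.
  apply: (le_trans xg); move: fk; rewrite leq_eqVlt => /orP[/eqP ->//|/g_inc/ltW//].
rewrite leqNgt; apply/negP => /(before_find 0%N); rewrite nth_iota ?add0n//.
by rewrite xg.
Qed.

Lemma gridlabel_fiber (k : nat) : (k <= N)%N -> [set x | gridlabel x = k :> nat] =
  (if (k < N)%N then `]-oo, g k]%classic else setT) `\`
  (if k is k'.+1 then `]-oo, g k']%classic else set0).
Proof.
move=> kN; apply/seteqP; split=> x /=.
  move=> E; split.
    by case: ifP => // kl; rewrite /= in_itv/= -gridlabel_le ?E.
  by case: k kN E => [|k'] kN E //; rewrite /= in_itv/= -gridlabel_le// E ltnn.
move=> [h1 h2]; apply/eqP; rewrite eqn_leq; apply/andP; split.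
  case: ifP h1 => [kl|/negbT]; first by rewrite /= in_itv/= -gridlabel_le.
  by rewrite -leqNgt => Nk _; rewrite -ltnS (leq_trans (ltn_ord _)).
case: k kN h1 h2 => [|k'] kN _ //=; rewrite in_itv/= -gridlabel_le// => /negP.
by rewrite -ltnNge.
Qed.

Lemma mlab_gridlabel : mlab gridlabel.
Proof.
move=> k; rewrite (_ : _ @^-1` _ = [set x | gridlabel x = k :> nat]); last first.
  by apply/seteqP; split=> x /=; [move=> ->|exact: val_inj].
have kN : (k <= N)%N by rewrite -ltnS.
rewrite (gridlabel_fiber kN); apply: measurableD.
  by case: ifP => _; [exact: mray|exact: measurableT].
by case: (nat_of_ord k) => [|k']; [exact: measurable0|exact: mray].
Qed.

Lemma dist_gridlabel nu (k : 'I_N.+1) : prob01 nu -> dist nu gridlabel k =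
  (if (k < N)%N then cdf nu (g k) else 1) -
  (if k : nat is k'.+1 then cdf nu (g k') else 0).
Proof.
move=> nu01; rewrite /dist (_ : _ @^-1` _ = [set x | gridlabel x = k :> nat]); last first.
  by apply/seteqP; split=> x /=; [move=> ->|exact: val_inj].
have kN : (k <= N)%N by rewrite -ltnS.
rewrite (gridlabel_fiber kN).
set A := (if (k < N)%N then `]-oo, g k]%classic else [set: R]).
set B := (X in A `\` X).
have mA : measurable A by rewrite /A; case: ifP => _; [exact: mray|exact: measurableT].
have mB : measurable B.
  by rewrite /B; case: (nat_of_ord k) => [|k']; [exact: measurable0|exact: mray].
have BA : B `<=` A.
  rewrite /A /B; case: ifP => // _; case: (nat_of_ord k) => // k' x /=; rewrite !in_itv/=.
  by move=> h; rewrite (le_trans h)// ltW// g_inc.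
have -> : pr nu (A `\` B) = pr nu A - pr nu B.
  by rewrite (prD nu01.1 mA mB) setIidr//; ring.
congr (_ - _); first by rewrite /A /cdf; case: ifP => // _; rewrite (pr_setT nu01.1).
by rewrite /B /cdf; case: (nat_of_ord k) => // ; rewrite pr_set0.
Qed.

End Grid.

(** * Weak limits along an ultrafilter *)

Section Compactness.
Let M := {measure set R -> \bar R}.
Variables (U : set_system M) (UU : UltraFilter U).
Hypothesis Up : U [set nu | prob01 nu].

Definition ulim (g : M -> R) (l : R) := forall e : R, 0 < e -> U [set nu | `|g nu - l| <= e].

Lemma ulim_ex (g : M -> R) : (forall nu, prob01 nu -> 0 <= g nu <= 1) -> exists l, ulim g l.
Proof.
move=> g01; pose I01 := [set r : R | 0 <= r <= 1].
have cI : compact I01 by rewrite /I01 -set_itvcc; exact: segment_compact.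
have FV : ProperFilter (fmap g U) by exact: fmap_proper_filter.
have gU : fmap g U I01.
  by rewrite /fmap/=; apply: (@filterS _ U _ [set nu | prob01 nu]).
have [l [l01 cl]] := cI (fmap g U) FV gU.
exists l => e e0; have lB : nbhs l (ball l e) by exact: nbhsx_ballx.
have [h|UC] := in_ultra_setVsetC (g @^-1` (ball l e)) UU.
  by apply: filterS h => nu; rewrite /ball/= distrC => /ltW.
by have [x [/= nB Bx]] := cl (~` ball l e) _ UC lB.
Qed.

Lemma ulim_le (g h : M -> R) l l' : (forall nu, prob01 nu -> g nu <= h nu) ->
  ulim g l -> ulim h l' -> l <= l'.
Proof.
move=> gh gl hl'; apply/ler_addgt0Pr => e e0; have e20 : 0 < e / 2 by lra.
have [nu [/gh ghn [/= h1 h2]]] := filter_ex (filterI Up (filterI (gl _ e20) (hl' _ e20))).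
by move: h1 h2; rewrite !ler_norml; lra.
Qed.

Lemma ulim_cst c : ulim (fun=> c) c.
Proof. by move=> e e0; apply: filterE => nu /=; rewrite subrr normr0 ltW. Qed.

Lemma ulimD (g h : M -> R) l l' : ulim g l -> ulim h l' -> ulim (fun nu => g nu + h nu) (l + l').
Proof.
move=> gl hl' e e0; have e20 : 0 < e / 2 by lra.
apply: filterS (filterI (gl _ e20) (hl' _ e20)) => nu [] /=.
by rewrite !ler_norml; lra.
Qed.

Lemma ulimN (g : M -> R) l : ulim g l -> ulim (fun nu => - g nu) (- l).
Proof. by move=> gl e /gl; apply: filterS => nu /=; rewrite -opprD normrN. Qed.

Lemma ulimZ (g : M -> R) l c : ulim g l -> ulim (fun nu => c * g nu) (c * l).
Proof.
move=> gl e e0; have c0 : 0 < `|c| + 1 by have := normr_ge0 c; lra.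
apply: filterS (gl _ (divr_gt0 e0 c0)) => nu /=; rewrite -mulrBr normrM => h.
apply: (@le_trans _ _ ((`|c| + 1) * `|g nu - l|)); first by apply: ler_wpM2r => //; lra.
by rewrite mulrC -ler_pdivlMr.
Qed.

Lemma ulim_sum (K : finType) (g : K -> M -> R) l : (forall k, ulim (g k) (l k)) ->
  ulim (fun nu => \sum_k g k nu) (\sum_k l k).
Proof.
move=> h; elim: (index_enum K) => [|k s IH].
  by under eq_fun do rewrite big_nil; rewrite big_nil; exact: ulim_cst.
by under eq_fun do rewrite big_cons; rewrite big_cons; exact: ulimD.
Qed.

Let limcdf_ex t : exists l : R, ulim (fun nu => cdf nu t) l.
Proof. by apply: ulim_ex => nu; exact: cdf01. Qed.

Let G (t : R) : R := projT1 (cid (limcdf_ex t)).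

Let GP t : ulim (fun nu => cdf nu t) (G t).
Proof. by rewrite /G; case: cid. Qed.

Let G_le s t : s <= t -> G s <= G t.
Proof.
move=> st; apply: ulim_le (GP s) (GP t) => nu nu01; apply: pr_le => //; first exact: nu01.1.
by move=> x /=; rewrite !in_itv/= => /le_trans; exact.
Qed.

Let G_ge0 t : 0 <= G t.
Proof. by apply: ulim_le (ulim_cst 0) (GP t) => nu nu01; have /andP[] := cdf01 t nu01. Qed.

Let G_le1 t : G t <= 1.
Proof. by apply: ulim_le (GP t) (ulim_cst 1) => nu nu01; have /andP[] := cdf01 t nu01. Qed.

Let G_1 t : 1 <= t -> G t = 1.
Proof.
move=> t1; apply/eqP; rewrite eq_le G_le1/=.
apply: ulim_le (ulim_cst 1) (GP t) => nu nu01.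
rewrite -(pr_setT nu01.1) /cdf (pr_eq01 nu01 (mray t) measurableT)//.
by move=> x /andP[_ x1]; split=> // _; rewrite /= in_itv/= (le_trans x1).
Qed.

Let G_0 t : t < 0 -> G t = 0.
Proof.
move=> t0; apply/eqP; rewrite eq_le G_ge0 andbT.
apply: ulim_le (GP t) (ulim_cst 0) => nu nu01.
rewrite /cdf (pr_out nu01)//; apply/seteqP; split=> // x [] /=; rewrite !in_itv/=; lra.
Qed.

(** The pointwise limit [G] of the distribution functions is monotone but need not be
    right-continuous; [C] is its right-continuous regularisation and defines the limit measure. *)
Let C (t : R) : R := inf [set G s | s in [set s | t < s]].

Let Cinf t : has_inf [set G s | s in [set s | t < s]].
Proof.
split; first by exists (G (t + 1)), (t + 1) => //=; lra.
by exists 0 => _ [s _ <-]; exact: G_ge0.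
Qed.

Let C_leG t s : t < s -> C t <= G s.
Proof. by move=> ts; apply: ge_inf; [case: (Cinf t)|exists s]. Qed.

Let G_leC t : G t <= C t.
Proof.
apply: lb_le_inf; first by case: (Cinf t).
by move=> _ [s /= /ltW /G_le ts <-].
Qed.

Let C_le s t : s <= t -> C s <= C t.
Proof.
move=> st; apply: lb_le_inf; first by case: (Cinf t).
by move=> _ [u /= tu <-]; apply: C_leG; exact: le_lt_trans tu.
Qed.

Let C_1 t : 1 <= t -> C t = 1.
Proof.
move=> t1; apply/eqP; rewrite eq_le -{2}(G_1 t1) G_leC andbT.
by rewrite -(@G_1 (t + 1)) ?C_leG//; lra.
Qed.

Let C_0 t : t < 0 -> C t = 0.
Proof.
move=> t0; apply/eqP; rewrite eq_le -{2}(G_0 t0) G_leC andbT.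
by rewrite -(@G_0 (t / 2)) ?C_leG//; lra.
Qed.

Let C_nd : nondecreasing C. Proof. by move=> s t; exact: C_le. Qed.

Let C_rc : right_continuous C.
Proof.
move=> t; apply/cvgrPdist_le => e e0.
have [_ [s /= ts <-] hs] := inf_adherent e0 (Cinf t).
near=> y.
have ty : t < y by near: y; exact: nbhs_right_gt.
have ys : y < s by near: y; exact: nbhs_right_lt.
have := C_le (ltW ty); have := C_leG ys; rewrite -/(C t) in hs.
by rewrite ler_distlC => *; apply/andP; split; lra.
Unshelve. all: by end_near. Qed.

Let c : cumulative R R := HB.pack C (isCumulative.Build R _ R C C_nd C_rc).

Let mu0 : measure (measurableTypeR R) R := lebesgue_stieltjes_measure c.

Let mu : {measure set R -> \bar R} := HB.pack (mu0 : set R -> \bar R)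
  (isMeasure.Build _ R R (mu0 : set R -> \bar R) (measure0 mu0) (measure_ge0 mu0)
    (@measure_semi_sigma_additive _ _ _ mu0)).

Let mu_oc a b : a <= b -> mu `]a, b]%classic = (C b - C a)%:E.
Proof.
move=> ab; rewrite /mu /= /lebesgue_stieltjes_measure /measure_extension measurable_mu_extE/=; last exact: is_ocitv.
by rewrite wlength_itv_bnd.
Qed.

Let mu_ray t : mu `]-oo, t]%classic = (C t)%:E.
Proof.
pose F n : set R := `]- n%:R, t]%classic.
have E : \bigcup_n F n = `]-oo, t]%classic.
  apply/seteqP; split=> x /=; first by move=> [n _]; rewrite /F/= !in_itv/= => /andP[].
  rewrite in_itv/= => xt; exists (Num.truncn (- x)).+1 => //=.
  by rewrite /F/= in_itv/= xt andbT ltrNl truncnS_gt.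
have mF n : measurable (F n) by exact: measurable_itv.
have ndF : nondecreasing_seq F.
  move=> n m nm; apply/subsetPset => x; rewrite /F/= !in_itv/= => /andP[h ->]; rewrite andbT.
  by rewrite (le_lt_trans _ h)// lerN2 ler_nat.
have := @nondecreasing_cvg_mu _ _ _ mu F mF _ ndF; rewrite E => /(_ (mray t)) h.
have h' : (mu \o F) n @[n --> \oo] --> (C t)%:E.
  apply: cvg_near_cst; near=> n.
  have n1 : 1 < n%:R :> R by near: n; exact: nbhs_infty_gtr.
  have n2 : - t <= n%:R by near: n; exact: nbhs_infty_ger.
  by rewrite /= mu_oc; [rewrite (@C_0 (- n%:R)) ?subr0//; lra | lra].
exact: (cvg_unique _ h h').
Unshelve. all: by end_near. Qed.

Let mu1 : mu setT = 1%E.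
Proof.
pose F n : set R := `]-oo, n%:R]%classic.
have E : \bigcup_n F n = setT.
  apply/seteqP; split=> x //= _; exists (Num.truncn x).+1 => //=.
  by rewrite /F/= in_itv/= ltW// truncnS_gt.
have mF n : measurable (F n) by exact: measurable_itv.
have ndF : nondecreasing_seq F.
  move=> n m nm; apply/subsetPset => x; rewrite /F/= !in_itv/= => h.
  by rewrite (le_trans h)// ler_nat.
have := @nondecreasing_cvg_mu _ _ _ mu F mF _ ndF; rewrite E => /(_ measurableT) h.
have h' : (mu \o F) n @[n --> \oo] --> 1%:E.
  apply: cvg_near_cst; near=> n.
  have n1 : 1 <= n%:R :> R by near: n; exact: nbhs_infty_ger.
  by rewrite /= mu_ray C_1.
exact: (cvg_unique _ h h').
Unshelve. all: by end_near. Qed.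

Let mu01 : prob01 mu.
Proof.
split; first exact: mu1.
pose F n : set R := `]-oo, - n.+1%:R^-1]%classic.
have E : \bigcup_n F n = `]-oo, 0[%classic.
  apply/seteqP; split=> x /=.
    move=> [n _]; rewrite /F/= !in_itv/= => h; apply: (le_lt_trans h).
    by rewrite oppr_lt0 invr_gt0.
  rewrite in_itv/= => x0; have x0' : 0 < - x by lra.
  exists (Num.truncn (- x)^-1) => //=; rewrite /F/= in_itv/= lerNr invf_ple ?posrE// ltW//.
  exact: truncnS_gt.
have mF n : measurable (F n) by exact: measurable_itv.
have m0 : measurable (`]-oo, 0[ : set R) by exact: measurable_itv.
have F0 n : mu (F n) = 0%E by rewrite mu_ray C_0// oppr_lt0 invr_gt0.
have e0 : mu `]-oo, 0[%classic = 0%E.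
  apply/eqP; rewrite -measure_le0 -E.
  have mU : measurable (\bigcup_n F n) by rewrite E.
  apply: le_trans (measure_sigma_subadditive mu mF mU (@subset_refl _ _)) _.
  by rewrite eseries0.
have e1 : mu (~` `]-oo, 1]%classic) = 0%E.
  rewrite (prE mu1); last exact: measurableC.
  by rewrite (prC mu1)// /pr mu_ray C_1//= subrr.
apply/eqP; rewrite -measure_le0; apply: (@le_trans _ _ (mu (`]-oo, 0[ `|` ~` `]-oo, 1]))).
  apply: le_measure; rewrite ?inE; first exact: measurableC.
    by apply: measurableU => //; exact: measurableC.
  move=> x /=; rewrite !in_itv/= => /negP; rewrite negb_and -!ltNge => /orP[h|h]; [by left|right].
  by apply/negP; rewrite -ltNge.
by rewrite measureU0// ?e0//; exact: measurableC.
Qed.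

(** The jumps []G t, C t[] are disjoint for distinct [t], because [C s <= G t] when [s < t]; a
    rational in each shows that there are countably many. *)
Let good_points a b : a < b -> exists2 t : R, a < t < b & C t = G t.
Proof.
move=> ab; have cA : countable [set t | C t <> G t].
  have hq (t : R) : exists q : rat, C t <> G t -> G t < ratr q < C t.
    have [E|E] := pselect (C t = G t); first by exists 0.
    have lt : G t < C t by rewrite lt_neqAle G_leC andbT; apply/eqP => /esym.
    by have [q] := rat_in_itvoo lt; rewrite in_itv/= => h; exists q.
  have [q hq'] := choice hq; apply/countable_injP; exists (pickle \o q).
  move=> s t; rewrite !inE => /hq' /andP[s1 s2] /hq' /andP[t1 t2] /= /(pcan_inj pickleK) E.
  have [st|st|//] := ltgtP s t; have := C_leG st; rewrite E in s1 s2; lra.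
have [t tab nt] := itv_avoid_countable cA ab; exists t => //.
exact: contrapT.
Qed.

Lemma ultra_weak_limit_aux (f : R -> R) : {within `[0, 1], continuous f} ->
  ulim (fun nu => intg nu f) (intg mu f).
Proof.
move=> cf e e0; have e30 : 0 < e / 3 by lra.
have [d d0 hd] := unif_cont01 cf e30.
(* One grid point is taken in each interval of length [1 / N], at a point where [C] and [G] agree,
   so neighbours are at distance below [2 / N < d]. *)
pose N := (Num.truncn (2 / d)).+1.
have NR : 0 < N%:R :> R by rewrite ltr0n.
have N2 : 2 / N%:R < d.
  by rewrite ltr_pdivrMr// mulrC -ltr_pdivrMr// truncnS_gt.
have ex (i : nat) : exists t : R, i%:R / N%:R < t < i.+1%:R / N%:R /\ C t = G t.
  have h : i%:R / N%:R < i.+1%:R / N%:R :> R by rewrite ltr_pM2r ?invr_gt0// ltr_nat.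
  by have [t h1 h2] := good_points h; exists t.
have [g hg] := choice ex.
have g_inc i j : (i < j)%N -> g i < g j.
  move=> ij; have [/andP[_ h1] _] := hg i; have [/andP[h2 _] _] := hg j.
  by apply: (lt_trans h1); apply: le_lt_trans h2; rewrite ler_pM2r ?invr_gt0// ler_nat.
pose X := gridlabel N g; have mX : mlab X by exact: mlab_gridlabel.
pose pt (k : 'I_N.+1) : R := if (k < N)%N then g k else 1.
have gi i : (i < N)%N -> 0 <= g i <= 1.
  move=> iN; have [/andP[h1 h2] _] := hg i; apply/andP; split.
    by rewrite (le_trans _ (ltW h1))// divr_ge0.
  by rewrite (le_trans (ltW h2))// ler_pdivrMr// mul1r ler_nat.
have step nu : prob01 nu -> `|intg nu f - \sum_k f (pt k) * dist nu X k| <= e / 3.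
  move=> nu01.
  have -> : e / 3 = \sum_k (fun=> e / 3) k * dist nu X k.
    by rewrite -mulr_sumr (sum_dist nu01.1)// mulr1.
  apply: intg_approx => // x x01.
  apply: hd => //; first by rewrite /pt; case: ifP => [/gi//|_]; rewrite ler01 lexx.
  have XE : X x = X x :> nat by [].
  have := @gridlabel_fiber N g g_inc (X x); rewrite -ltnS => /(_ (ltn_ord _)) /seteqP[/(_ x XE) + _].
  move=> [h1 h2]; apply: le_lt_trans N2; rewrite /pt.
  have lo : (X x)%:R / N%:R - 1 / N%:R <= x.
    case: (nat_of_ord (X x)) h2 => [_|k'].
      by rewrite mul0r; have /andP[+ _] := x01; have : 0 <= 1 / N%:R :> R by []; lra.
    rewrite /= in_itv/= => /negP; rewrite -ltNge => h; have [/andP[h3 _] _] := hg k'.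
    by rewrite -mulrBl -natr1 addrK; lra.
  have hi : x <= ((X x)%:R + 1) / N%:R.
    case: ifP h1 => [_|/negbT].
      rewrite /= in_itv/= => h; have [/andP[_ h3] _] := hg (X x).
      by rewrite natr1; lra.
    rewrite -leqNgt => NX _; have /andP[_ x1] := x01; apply: (le_trans x1).
    by rewrite ler_pdivlMr// mul1r natr1 ler_nat (leq_trans NX).
  rewrite ler_norml !mulrDl in hi *; case: ifP => [XN|/negbT].
    have [/andP[h3 h4] _] := hg (X x); rewrite -natr1 mulrDl in h4.
    by apply/andP; split; lra.
  rewrite -leqNgt => NX; have XN : nat_of_ord (X x) = N by apply/eqP; rewrite eqn_leq NX -ltnS ltn_ord.
  rewrite XN divff ?gt_eqF// in lo; have /andP[_ x1] := x01.
  have : 0 <= 1 / N%:R :> R by []; rewrite !div1r in lo *.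
  by move=> ?; apply/andP; split; lra.
have lim : ulim (fun nu => \sum_k f (pt k) * dist nu X k) (\sum_k f (pt k) * dist mu X k).
  apply: ulim_sum => k; apply: ulimZ.
  have muE t : C t = G t -> cdf mu t = G t by rewrite /cdf /pr mu_ray => ->.
  move=> e' e'0; rewrite (dist_gridlabel g_inc k mu01).
  have cl (i : nat) : ulim (fun nu => cdf nu (g i)) (cdf mu (g i)).
    by have [_ E] := hg i; rewrite muE//; exact: GP.
  have h1 : ulim (fun nu => (if (k < N)%N then cdf nu (g k) else 1)) (if (k < N)%N then cdf mu (g k) else 1).
    by case: ifP => _; [exact: cl|exact: ulim_cst].
  have h2 : ulim (fun nu => (if k : nat is k'.+1 then cdf nu (g k') else 0)) (if k : nat is k'.+1 then cdf mu (g k') else 0).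
    by case: (nat_of_ord k) => [|k']; [exact: ulim_cst|exact: cl].
  apply: filterS (filterI Up (ulimD h1 (ulimN h2) e'0)) => nu [nu01 /=].
  by rewrite (dist_gridlabel g_inc k nu01).
apply: filterS (filterI Up (lim _ e30)) => nu [nu01 /= h].
have := step nu nu01; have := step mu mu01; move: h; rewrite !ler_norml; lra.
Qed.

Lemma ultra_weak_limit : exists2 m : {measure set R -> \bar R}, prob01 m &
  forall f : R -> R, {within `[0, 1], continuous f} -> ulim (fun nu => intg nu f) (intg m f).
Proof. by exists mu; [exact: mu01|exact: ultra_weak_limit_aux]. Qed.

End Compactness.
End Integration.

(** * Local upper bound *)

(** Marked times are more than [N] apart, so each occupies [N.+1] places, and only the last may
    overhang, by at most [N]. *)
Lemma sparse_count (P : nat -> bool) (N n : nat) :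
  (forall i j, P i -> (1 <= j <= N)%N -> ~~ P (i + j)%N) ->
  ((\sum_(i < n) P i) * N.+1 <= n + N)%N.
Proof.
move=> hP; elim/ltn_ind: n => -[|n] IH; first by rewrite big_ord0.
rewrite big_ord_recr/=; case Pn : (P n); last first.
  by rewrite addn0 (leq_trans (IH n _))// leq_add2r.
have z m : (m <= N)%N -> (m <= n)%N -> (\sum_(i < n) P i = \sum_(i < n - m) P i)%N.
  elim: m => [|m IHm] mN mn; first by rewrite subn0.
  rewrite IHm; [|exact: ltnW|exact: ltnW].
  have -> : (n - m = (n - m.+1).+1)%N by lia.
  rewrite big_ord_recr/=; case Pm : (P (n - m.+1)%N); last by rewrite addn0.
  have := hP _ m.+1 Pm; rewrite mN/= => /(_ isT).
  by rewrite subnK// Pn.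
have [nN|Nn] := leqP n N.
  have := z n nN (leqnn _); rewrite subnn big_ord0 => ->; lia.
rewrite (z N)//; last exact: ltnW.
have := IH (n - N)%N; rewrite ltnS leq_subr => /(_ isT).
nia.
Qed.

Section Empirical.
Variables (R : realType) (T : R -> R).
Hypothesis T01 : forall x, 0 <= x <= 1 -> 0 <= T x <= 1.

Lemma iterT01 n x : 0 <= x <= 1 -> 0 <= iter n T x <= 1.
Proof. by move=> x01; elim: n => //= n; exact: T01. Qed.

Lemma pr_empirical n x (A : set R) :
  pr (empirical T n x) A = n%:R^-1 * \sum_(j < n) \1_A (iter j T x).
Proof.
by rewrite /pr /empirical /= /mscale /= /dirac/= /msum sumEFin.
Qed.

Lemma empirical_prob01 n x : (0 < n)%N -> 0 <= x <= 1 -> prob01 (empirical T n x).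
Proof.
move=> n0 x01; split.
  rewrite /empirical /= /mscale /= /dirac/= /msum sumEFin -EFinM; congr EFin.
  rewrite (eq_bigr (fun=> 1)); last by move=> i _; rewrite indicT.
  by rewrite sumr_const card_ord mulVf// pnatr_eq0 -lt0n.
rewrite /empirical /= /mscale /= /dirac/= /msum big1 ?mule0// => i _.
change ((\1_(~` `[0%R, 1%R]) (iter i T x))%:E = 0%E :> \bar R).
rewrite indicE memNset//= => h; apply: h; rewrite /= in_itv/=; exact: iterT01.
Qed.

Lemma pr_empirical_shift n x (A : set R) : (0 < n)%N ->
  `|pr (empirical T n x) (T @^-1` A) - pr (empirical T n x) A| <= n%:R^-1.
Proof.
move=> n0; rewrite !pr_empirical -mulrBr normrM ger0_norm ?invr_ge0//.
rewrite -[leRHS]mulr1 ler_wpM2l ?invr_ge0//.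
have -> : \sum_(j < n) \1_(T @^-1` A) (iter j T x) - \sum_(j < n) \1_A (iter j T x) =
    \1_A (iter n T x) - \1_A x :> R.
  rewrite -sumrB (eq_bigr (fun j : 'I_n => \1_A (iter j.+1 T x) - \1_A (iter j T x))).
    by rewrite -(big_mkord xpredT (fun j => \1_A (iter j.+1 T x) - \1_A (iter j T x))) telescope_sumr.
  by move=> j _; congr (_ - _); rewrite !indicE.
by rewrite !indicE; do 2 case: (_ \in _); rewrite ?subrr ?sub0r ?subr0 ?normrN ?normr1 ?normr0.
Qed.

Lemma expect_empirical n x (K : finType) (X : R -> K) (F : K -> R) :
  \sum_k dist (empirical T n x) X k * F k = n%:R^-1 * \sum_(j < n) F (X (iter j T x)).
Proof.
under eq_bigr do rewrite /dist pr_empirical -mulrA mulr_suml.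
rewrite -mulr_sumr exchange_big/=; congr (_ * _); apply: eq_bigr => j _.
rewrite (bigD1 (X (iter j T x)))//= big1 ?addr0; first by rewrite indicE mem_set ?mul1r.
by move=> k kx; rewrite indicE memNset ?mul0r//= => /eqP; rewrite eq_sym (negbTE kx).
Qed.

End Empirical.

Section LocalUpper.
Variables (R : realType) (beta : R).
Hypothesis beta1 : 1 < beta.
Local Notation T := (Tmb beta).
Local Notation D := (@dg R beta).
Local Notation W := (@word R T _ D).

Let b0 : 0 < beta. Proof. exact: lt_trans beta1. Qed.
Let mT := @measurable_Tmb R beta beta1.
Let mD := @mlab_dg R beta beta1.
Let T01 := @Tmb01 R beta beta1.

Lemma freq_wrong (N : nat) : exists2 e : R, 0 < e & forall n x, (0 < n)%N -> 0 <= x <= 1 ->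
  pr (empirical T n x) [set y | wrong beta e y] <= N.+1%:R^-1 + n%:R^-1.
Proof.
have [e e0 he] := wrong_return beta1 N; exists e => // n x n0 x01.
rewrite pr_empirical.
have nR : 0 < n%:R :> R by rewrite ltr0n.
have NR : 0 < N.+1%:R :> R by rewrite ltr0n.
pose P i := `[< wrong beta e (iter i T x) >].
have -> : \sum_(j < n) \1_[set y | wrong beta e y] (iter j T x) = (\sum_(j < n) P j)%:R :> R.
  rewrite natr_sum; apply: eq_bigr => j _; rewrite indicE /P; congr (_%:R).
have : ((\sum_(i < n) P i) * N.+1 <= n + N)%N.
  apply: sparse_count => i j /asboolP Pi jN; apply/asboolP; rewrite addnC iterD; exact: he.
rewrite -(ler_nat R) natrM natrD => h.
rewrite ler_pdivrMl//= mulrDr divff ?gt_eqF// -(ler_pM2r NR).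
rewrite mulrDl mul1r -mulrA mulVf ?gt_eqF// mulr1 (le_trans h)// lerD2l.
by rewrite ler_nat.
Qed.

Section Cells.
Variables (mu : {measure set R -> \bar R}) (mu01 : prob01 mu).

(** The wrong sets decrease to the empty set as [e] shrinks ([wrong_shrink]). As [mu] is an
    arbitrary probability measure, the iterates are treated one by one. *)
Lemma wrong_small (q : nat) (e1 d : R) : 0 < e1 -> 0 < d -> exists2 e : R, 0 < e <= e1 &
  forall j, (j < q)%N -> pr mu (iter j T @^-1` [set y | wrong beta e y]) <= d.
Proof.
move=> e10 d0; elim: q => [|q [e /andP[e0 ee1] IH]]; first by exists e1; rewrite ?e10 ?lexx.
pose F n := iter q T @^-1` [set y | wrong beta n.+1%:R^-1 y].
have mF n : measurable (F n).
  by apply: measurable_iter => //; exact: measurable_wrong.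
have niF : nonincreasing_seq F.
  move=> n m nm; apply/subsetPset => x; apply: wrong_le.
  by rewrite lef_pV2 ?posrE// ler_nat.
have F0 : \bigcap_n F n = set0.
  apply/seteqP; split=> // x Fx; have [h h0] := @wrong_shrink R beta (iter q T x).
  apply; apply: (@wrong_le R beta (Num.truncn h^-1).+1%:R^-1); last exact: Fx.
  by rewrite invf_ple ?posrE// ltW// truncnS_gt.
have cF : mu \o F @ \oo --> 0%:E.
  rewrite -[0%:E]/0%E -(measure0 mu) -F0; apply: nonincreasing_cvg_mu => //.
  - by rewrite (prE mu01.1)// ltry.
  - exact: bigcapT_measurable.
have /fine_cvgP[_ /cvgrPdist_le/(_ _ d0)[n0 _ hn]] := cF.
exists (Num.min e n0.+1%:R^-1); first by rewrite lt_min e0 invr_gt0 ltr0n/= ge_min ee1.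
have mw e' j : measurable (iter j T @^-1` [set y | wrong beta e' y]).
  by apply: measurable_iter => //; exact: measurable_wrong.
move=> j; rewrite ltnS leq_eqVlt => /orP[/eqP ->|jq].
  have := hn n0 (leqnn _); rewrite sub0r normrN/= ger0_norm ?pr_ge0//.
  apply: le_trans; apply: pr_le => //; first exact: mu01.1.
  by move=> x; apply: wrong_le; rewrite ge_min lexx orbT.
apply: le_trans (IH j jq); apply: pr_le => //; first exact: mu01.1.
by move=> x; apply: wrong_le; rewrite ge_min lexx.
Qed.

End Cells.

Section Test.
Variables (q : nat) (e : R).
Hypothesis e0 : 0 < e.

Definition clean (x : R) : bool := [forall j : 'I_q, ~~ `[< wrong beta e (iter j T x) >]].

Lemma measurable_clean : measurable [set x | clean x].
Proof.
rewrite (_ : [set x | _] = \bigcap_(j in [set: 'I_q]) ~` (iter j T @^-1` [set y | wrong beta e y])).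
  apply: fin_bigcap_measurable => // j _; apply: measurableC.
  by apply: measurable_iter => //; exact: measurable_wrong.
apply/seteqP; split=> x /=.
  by move=> /forallP h j _ /=; have /asboolP := h j.
by move=> h; apply/forallP => j; apply/asboolP; exact: h.
Qed.

Lemma clean_word x y : 0 <= x <= 1 -> 0 <= y <= 1 -> clean x -> clean y ->
  `|x - y| < e / beta ^+ q -> W q x = W q y.
Proof.
move=> x01 y01 /forallP cx /forallP cy xy.
suff h j : (j <= q)%N -> W j x = W j y by exact: h.
elim: j => [|j IH] jq; first by apply/wordE.
have E := IH (ltnW jq); apply/wordE => i; rewrite ltnS leq_eqVlt => /orP[/eqP ->|ij].
  have dj : `|iter j T x - iter j T y| < e.
    rewrite (expansion beta1 x01 y01 E) normrM normrX normrN (gtr0_norm b0).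
    have bX : 0 < beta ^+ q by exact: exprn_gt0.
    apply: (@le_lt_trans _ _ (beta ^+ q * `|x - y|)).
      by rewrite ler_wpM2r// ler_weXn2l ?(ltW beta1)// ltnW.
    by rewrite mulrC -ltr_pdivlMr.
  apply/eqP/negPn/negP => /(wrong_of_dg beta1 (iter01 beta1 j x01) (iter01 beta1 j y01) dj).
  by have /asboolP := cx (Ordinal jq); have /asboolP := cy (Ordinal jq) => /= ? ? [].
by move/wordE: E; exact.
Qed.

Variable w : {ffun 'I_q -> 'I_(bnat beta).+1}.

Let A : set R := [set z | [/\ 0 <= z <= 1, clean z & W q z = w]].

(** A bump of slope [beta ^+ q / e] over the clean points with word [w]. By [clean_word] clean
    points with another word lie outside its support. The value 0 is set apart for an empty [A],
    where the infimum says nothing. *)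
Definition test (y : R) : R :=
  if `[< exists z, A z >] then
    Num.max 0 (1 - inf [set `|y - z| | z in A] * (beta ^+ q / e)) else 0.

Let infA (y : R) : (exists z, A z) -> has_inf [set `|y - z| | z in A].
Proof. by move=> [z Az]; split; [exists `|y - z|, z|exists 0 => _ [? _ <-]]. Qed.

Let inf_lip x y : (exists z, A z) -> inf [set `|x - z| | z in A] <= `|x - y| + inf [set `|y - z| | z in A].
Proof.
move=> exA; apply/ler_addgt0Pr => d d0.
have [_ [z Az <-] hz] := inf_adherent d0 (infA y exA).
apply: (@le_trans _ _ `|x - z|); first by apply: ge_inf; [case: (infA x exA)|exists z].
by have := ler_distD y x z; lra.
Qed.

Lemma test_continuous : {within `[0, 1], continuous test}.
Proof.
apply: continuous_subspaceT => x; rewrite /test; case: asboolP => [exA|_]; last exact: cvg_cst.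
apply/cvgrPdist_le => d d0.
have c0 : 0 < beta ^+ q / e by rewrite divr_gt0// exprn_gt0.
near=> y.
have xy : `|x - y| <= d / (beta ^+ q / e).
  near: y; apply: (@cvgr_dist_le _ _ _ (nbhs x) _ id x) => //; exact: divr_gt0.
rewrite ler_pdivlMr// in xy.
have h1 := ler_wpM2r (ltW c0) (inf_lip x y exA).
have h2 := ler_wpM2r (ltW c0) (inf_lip y x exA); rewrite distrC in h2.
rewrite mulrDl in h1; rewrite mulrDl in h2.
by rewrite /Num.max; do 2 case: ifP => ?; rewrite ler_norml; apply/andP; split; lra.
Unshelve. all: by end_near. Qed.

Lemma test_val x : 0 <= x <= 1 -> clean x -> test x = (W q x == w)%:R.
Proof.
move=> x01 cx; have c0 : 0 < beta ^+ q / e by rewrite divr_gt0// exprn_gt0.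
have [E|E] := eqVneq (W q x) w; rewrite /test.
  have Ax : A x by [].
  case: asboolP => [exA|]; last by case; exists x.
  have -> : inf [set `|x - z| | z in A] = 0.
    apply/eqP; rewrite eq_le; apply/andP; split.
      by apply: ge_inf; [case: (infA x exA)|exists x => //; rewrite subrr normr0].
    by apply: lb_le_inf; [case: (infA x exA)|move=> _ [? _ <-]].
  by rewrite mul0r subr0 /Num.max ltr01.
case: asboolP => // exA; apply/eqP; rewrite eq_le le_max lexx andbT ge_max lexx/=.
rewrite subr_le0 -ler_pdivrMr// div1r invfM invrK mulrC.
apply: lb_le_inf; first by case: (infA x exA).
move=> _ [z [z01 cz wz] <-]; rewrite leNgt; apply/negP => h.
by move/eqP: E; apply; rewrite -wz; exact: clean_word.
Qed.

Lemma test01 x : 0 <= test x <= 1.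
Proof.
rewrite /test; case: asboolP => [exA|_]; last by rewrite lexx ler01.
rewrite le_max lexx/= ge_max ler01/= gerBl mulr_ge0//; last by rewrite divr_ge0 ?(ltW e0)// exprn_ge0// ltW.
by apply: lb_le_inf; [case: (infA x exA)|move=> _ [? _ <-]].
Qed.

Lemma intg_test nu : prob01 nu ->
  `|intg nu test - dist nu (W q) w| <= pr nu [set x | ~~ clean x].
Proof.
move=> nu01; have mW : mlab (W q) by exact: mlab_word.
have mc : mlab clean.
  have h : clean @^-1` [set true] = [set x | clean x] by apply/seteqP; split.
  case; first by rewrite h; exact: measurable_clean.
  rewrite (_ : _ @^-1` _ = ~` [set x | clean x]); first by apply: measurableC; exact: measurable_clean.
  by apply/seteqP; split=> x /=; [move=> ->|move=> /negP/negbTE].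
have mX := mlab_pair mW mc.
pose v (k : {ffun 'I_q -> 'I_(bnat beta).+1} * bool) : R := (k.1 == w)%:R.
pose er (k : {ffun 'I_q -> 'I_(bnat beta).+1} * bool) : R := (~~ k.2)%:R.
have := @intg_approx R nu nu01 _ _ mX test v er test_continuous.
have E1 : \sum_k v k * dist nu (fun x => (W q x, clean x)) k = dist nu (W q) w.
  transitivity (pr nu [set x | W q x == w]); last first.
    by congr pr; apply/seteqP; split=> x /eqP.
  rewrite (pr_sumT nu01.1 (fun k => k.1 == w) mX) [RHS]big_mkcond/=; apply: eq_bigr => k _.
  by rewrite /v; case: (k.1 == w); rewrite ?mul0r ?mul1r.
have E2 : \sum_k er k * dist nu (fun x => (W q x, clean x)) k = pr nu [set x | ~~ clean x].
  rewrite (pr_sumT nu01.1 (fun k => ~~ k.2) mX) [RHS]big_mkcond/=; apply: eq_bigr => k _.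
  by rewrite /er; case: (k.2); rewrite ?mul0r ?mul1r.
rewrite E1 E2; apply => x x01; rewrite /v /er/=; case cx : (clean x) => /=.
  by rewrite test_val// subrr normr0.
have /andP[? ?] := test01 x; case: eqP => _; rewrite /= ?mulr0n ?mulr1n ler_norml; apply/andP; split; lra.
Qed.

End Test.

Lemma pr_unclean q (e : R) nu : prob01 nu ->
  pr nu [set x | ~~ clean q e x] <=
  \sum_(j < q) pr nu (iter j T @^-1` [set y | wrong beta e y]).
Proof.
move=> nu01; have mw j : measurable (iter j T @^-1` [set y | wrong beta e y]).
  by apply: measurable_iter => //; exact: measurable_wrong.
have mc k : measurable [set x | ~~ clean k e x].
  rewrite (_ : [set x | _] = ~` [set x | clean k e x]); first by apply: measurableC; exact: measurable_clean.
  by apply/seteqP; split=> x /= /negP.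
elim: q => [|q IH].
  rewrite big_ord0 (_ : [set x | _] = set0) ?pr_set0//.
  by apply/seteqP; split=> // x /=; rewrite /clean; case/negP; apply/forallP => -[].
rewrite big_ord_recr/=; apply: (@le_trans _ _ (pr nu ([set x | ~~ clean q e x] `|` iter q T @^-1` [set y | wrong beta e y]))).
  apply: pr_le => //; [exact: nu01.1|exact: measurableU|].
  move=> x /=; rewrite /clean negb_forall => /existsP[j]; rewrite negbK => /asboolP h.
  have [jq|jq] := eqVneq (nat_of_ord j) q; first by right; rewrite /= -jq.
  left; rewrite /= negb_forall; apply/existsP.
  have jlt : (j < q)%N by rewrite ltn_neqAle jq/= -ltnS ltn_ord.
  by exists (Ordinal jlt); rewrite negbK; apply/asboolP.
by apply: le_trans (prU_le nu01.1 (mc q) (mw q)) _; rewrite lerD2r.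
Qed.

(** On clean points [test] is the indicator of the cell, so integral and cell mass differ at most by
    the unclean mass. That mass is small for [mu] by the choice of [e], and for the empirical
    measures because wrong visits are sparse along every orbit; arbitrary measures near [mu] would
    not qualify. *)
Lemma cell_nbhd (mu : {measure set R -> \bar R}) q (eta : R) : prob01 mu -> 0 < eta ->
  exists (k : nat) (f : nat -> R -> R) (eps : R), 0 < eps /\
    (forall i, (i < k)%N -> {within `[0, 1], continuous (f i)}) /\
    exists n0, forall n x, (n0 <= n)%N -> 0 <= x <= 1 ->
      (forall i, (i < k)%N -> `|intg (empirical T n x) (f i) - intg mu (f i)| < eps) ->
      forall w, `|dist (empirical T n x) (W q) w - dist mu (W q) w| <= eta.
Proof.
(* The [q] iterates share [eta / 4]; the unclean masses of the two measures and the integral error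
   then use three quarters of [eta]. *)
move=> mu01 eta0; pose d := eta / (4 * q.+1%:R).
have q0 : 0 < q.+1%:R :> R by rewrite ltr0n.
have d0 : 0 < d by rewrite divr_gt0// mulr_gt0.
have qd : q%:R * d <= eta / 4.
  have E : q.+1%:R * d = eta / 4 by rewrite /d; field; rewrite gt_eqF.
  by rewrite -E ler_wpM2r ?(ltW d0)// ler_nat.
pose N := (Num.truncn (2 / d)).+1.
have Nd : N.+1%:R^-1 <= d / 2.
  rewrite invf_ple ?posrE; [|by rewrite ltr0n|by lra].
  by rewrite invf_div ltW// (lt_trans (truncnS_gt _))// ltr_nat.
have [e1 e10 he1] := freq_wrong N.
have [e /andP[e0 ee1] he] := wrong_small mu01 q e10 d0.
pose J := {ffun 'I_q -> 'I_(bnat beta).+1}.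
exists #|J|, (fun i => test e (nth [ffun=> ord0] (enum J) i)), (eta / 4); split; first by lra.
split; first by move=> i _; exact: test_continuous.
exists N => n x Nn x01 hf w.
have n0 : (0 < n)%N by exact: leq_trans Nn.
have E01 := empirical_prob01 T01 n0 x01.
have wJ : (enum_rank w < #|J|)%N by exact: ltn_ord.
have := hf _ wJ; rewrite nth_enum_rank => hw.
have h1 := intg_test e0 w mu01; have h2 := intg_test e0 w E01.
have u1 : pr mu [set x | ~~ clean q e x] <= eta / 4.
  apply: le_trans (pr_unclean q e mu01) _; apply: le_trans qd.
  apply: (@le_trans _ _ (\sum_(j < q) d)); last by rewrite sumr_const card_ord mulr_natl.
  by apply: ler_sum => j _; exact: he.
have u2 : pr (empirical T n x) [set x | ~~ clean q e x] <= eta / 4.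
  apply: le_trans (pr_unclean q e E01) _; apply: le_trans qd.
  apply: (@le_trans _ _ (\sum_(j < q) d)); last by rewrite sumr_const card_ord mulr_natl.
  apply: ler_sum => j _.
  have -> : pr (empirical T n x) (iter j T @^-1` [set y | wrong beta e y]) =
      pr (empirical T n (iter j T x)) [set y | wrong beta e y].
    rewrite !pr_empirical; congr (_ * _); apply: eq_bigr => i _.
    by rewrite !indicE -iterD addnC iterD.
  have x01j := iterT01 T01 j x01; have Ej01 := empirical_prob01 T01 n0 x01j.
  apply: (@le_trans _ _ (pr (empirical T n (iter j T x)) [set y | wrong beta e1 y])).
    by apply: pr_le; [exact: Ej01.1|exact: measurable_wrong|exact: measurable_wrong|move=> y; exact: wrong_le].
  apply: le_trans (he1 _ _ n0 x01j) _.
  have : n%:R^-1 <= d / 2.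
    rewrite invf_ple ?posrE; [|by rewrite ltr0n|by lra].
    by rewrite invf_div ltW// (lt_le_trans (truncnS_gt _))// ler_nat.
  by move=> h3; apply: le_trans (lerD Nd h3) _; lra.
move: h1 h2 hw; rewrite !ler_norml ltr_norml => /andP[? ?] /andP[? ?] /andP[? ?].
by apply/andP; split; lra.
Qed.

Definition wtail q (K : Type) (u : {ffun 'I_q.+1 -> K}) : {ffun 'I_q -> K} :=
  [ffun i => u (lift ord0 i)].
Definition winit q (K : Type) (u : {ffun 'I_q.+1 -> K}) : {ffun 'I_q -> K} :=
  [ffun i => u (widen_ord (leqnSn q) i)].

Lemma wtail_word q x : wtail (W q.+1 x) = W q (T x).
Proof. by apply/ffunP => i; rewrite !ffunE -iterSr. Qed.

Lemma winit_word q x : winit (W q.+1 x) = W q x.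
Proof. by apply/ffunP => i; rewrite !ffunE. Qed.

Lemma dist_comp_close (mu nu : {measure set R -> \bar R}) (K L : finType) (X : R -> K)
    (f : K -> L) (eta : R) b : prob01 mu -> prob01 nu -> mlab X -> 0 <= eta ->
  (forall u, `|dist nu X u - dist mu X u| <= eta) ->
  `|dist nu (f \o X) b - dist mu (f \o X) b| <= #|K|%:R * eta.
Proof.
move=> mu01 nu01 mX eta0 h; rewrite (dist_comp mu01.1)// (dist_comp nu01.1)// -sumrB.
apply: le_trans (ler_norm_sum _ _ _) _.
rewrite mulr_natl -sumr_const big_mkcond/=; apply: ler_sum => u _.
by case: ifP.
Qed.

(** The push-forward of [mu] and [mu] itself are determined by their values on cells. *)
Lemma noninvariant_cell mu : prob01 mu -> ~ Defs.invariant T mu ->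
  exists k (w : {ffun 'I_k -> 'I_(bnat beta).+1}), dist mu (W k \o T) w != dist mu (W k) w.
Proof.
move=> mu01 ninv; apply/not_existsP => h; apply: ninv => A mA.
have mf : measurable_fun [set: R] T by move=> _ B mB; rewrite setTI; exact: mT.
pose nu : {measure set R -> \bar R} := measure_function_pushforward__canonical__measure_function_Measure mu mf.
have nuE B : nu B = mu (T @^-1` B) by [].
have nu01 : prob01 nu.
  split; rewrite nuE; first by rewrite preimage_setT mu01.1.
  apply/eqP; rewrite eq_le measure_ge0 andbT -mu01.2; apply: le_measure; rewrite ?inE.
  - by apply: mT; apply: measurableC; exact: measurable_itv.
  - by apply: measurableC; exact: measurable_itv.
  - by move=> x /= h1 h2; apply: h1; move: h2; rewrite !in_itv/=; exact: T01.
rewrite -nuE; apply/esym; apply: (prob01_eq_words mT mD (beta_generating beta1)) => // k w.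
rewrite nuE; have mW := @mlab_word R T mT _ D k mD.
have mWw := mW w; have := h k => /forallNP/(_ w)/negP; rewrite negbK => /eqP.
by rewrite (prE mu01.1 mWw) (prE mu01.1 (mT mWw)) /dist => <-.
Qed.

Definition weak_nbhd (mu : {measure set R -> \bar R}) (P : nat -> R -> Prop) :=
  exists (k : nat) (f : nat -> R -> R) (eps : R), 0 < eps /\
    (forall i, (i < k)%N -> {within `[0, 1], continuous (f i)}) /\
    exists n0, forall n x, (n0 <= n)%N -> 0 <= x <= 1 ->
      (forall i, (i < k)%N -> `|intg (empirical T n x) (f i) - intg mu (f i)| < eps) -> P n x.

(** Empirical measures are invariant up to [n%:R^-1], whereas [mu] gives different masses to some
    cell and to its preimage, and both masses are read off from [k.+1]-words. *)
Lemma noninvariant_upper mu : prob01 mu -> ~ Defs.invariant T mu -> weak_nbhd mu (fun _ _ => False).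
Proof.
move=> mu01 ninv; have [k [w hw]] := noninvariant_cell mu01 ninv.
set p1 := dist mu (W k \o T) w in hw; set p2 := dist mu (W k) w in hw.
pose d := `|p1 - p2|; have d0 : 0 < d by rewrite normr_gt0 subr_eq0.
pose J := {ffun 'I_k.+1 -> 'I_(bnat beta).+1}.
have J0 : 0 < #|J|%:R :> R by rewrite ltr0n; apply/card_gt0P; exists [ffun=> ord0].
pose eta := d / (4 * #|J|%:R).
have eta0 : 0 < eta by rewrite divr_gt0// mulr_gt0.
have [K [f [eps [eps0 [cf [n0 h]]]]]] := cell_nbhd k.+1 mu01 eta0.
exists K, f, eps; split=> //; split=> //.
exists (maxn n0 (Num.truncn (4 / d)).+1) => n x; rewrite geq_max => /andP[n0n dn] x01 hf.
have n_gt0 : (0 < n)%N by exact: leq_trans dn.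
have E01 := empirical_prob01 T01 n_gt0 x01.
have mW := @mlab_word R T mT _ D k.+1 mD.
have Ej : #|J|%:R * eta = d / 4 by rewrite /eta; field; rewrite gt_eqF.
have W1 : W k \o T = (@wtail k _) \o W k.+1 by apply/funext => y /=; rewrite wtail_word.
have W2 : W k = (@winit k _) \o W k.+1 by apply/funext => y /=; rewrite winit_word.
have h1 := dist_comp_close (@wtail k _) w mu01 E01 mW (ltW eta0) (h n x n0n x01 hf).
have h2 := dist_comp_close (@winit k _) w mu01 E01 mW (ltW eta0) (h n x n0n x01 hf).
rewrite -W1 Ej in h1; rewrite -W2 Ej in h2.
have h3 : `|dist (empirical T n x) (W k \o T) w - dist (empirical T n x) (W k) w| <= n%:R^-1.
  exact: pr_empirical_shift.
have h4 : n%:R^-1 <= d / 4.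
  rewrite invf_ple ?posrE; [|by rewrite ltr0n|by lra].
  by rewrite invf_div ltW// (lt_le_trans (truncnS_gt _))// ler_nat.
have := ler_distD (dist (empirical T n x) (W k \o T) w) p1 p2.
have := ler_distD (dist (empirical T n x) (W k) w) (dist (empirical T n x) (W k \o T) w) p2.
rewrite -/d (distrC p1); rewrite -/p1 in h1; rewrite -/p2 in h2; lra.
Qed.

(** * The smoothed kernel of an invariant measure *)

Section Kernel.
Variables (mu : {measure set R -> \bar R}) (mu01 : prob01 mu) (muT : Defs.invariant T mu).
Variables (q : nat) (kap : R).
Hypothesis kap0 : 0 < kap.
Local Notation A := 'I_(bnat beta).+1.
Local Notation p := (dist mu (W q.+1)).
Local Notation p' := (dist mu (W q)).
Let nA : R := (bnat beta).+1%:R.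
Let nA0 : 0 < nA. Proof. by rewrite ltr0n. Qed.
Let mW n : mlab (W n). Proof. exact: mlab_word. Qed.

(** Conditional probability of the first letter given the following [q]; the added [kap] makes it
    positive on every word and so bounds its logarithm. *)
Definition kernel (u : {ffun 'I_q.+1 -> A}) : R := (p u + kap) / (p' (wtail u) + kap * nA).

Lemma kernel_gt0 u : 0 < kernel u.
Proof. by rewrite divr_gt0// ltr_wpDl ?dist_ge0// mulr_gt0. Qed.

Lemma dist_wtail v : p' v = \sum_(u | wtail u == v) p u.
Proof.
rewrite -(dist_iter mT muT 1 (@mW q)) -(dist_comp mu01.1)//; congr (dist mu _ v).
by apply/funext => x /=; rewrite wtail_word.
Qed.

Lemma kernel_sum (s : seq A) : \sum_a kernel (blk ord0 q.+1 (a :: s)) <= 1.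
Proof.
have wb a : wtail (blk ord0 q.+1 (a :: s)) = blk ord0 q s.
  by apply/ffunP => i; rewrite !ffunE.
under eq_bigr do rewrite /kernel wb.
rewrite -mulr_suml big_split/= sumr_const card_ord -[kap *+ _]mulr_natr.
suff -> : \sum_a p (blk ord0 q.+1 (a :: s)) = p' (blk ord0 q s).
  by rewrite divff// gt_eqF// ltr_wpDl ?dist_ge0// mulr_gt0.
rewrite dist_wtail (reindex (fun a => blk ord0 q.+1 (a :: s)))/=.
  by apply: eq_bigl => a; rewrite wb eqxx.
exists (fun u : {ffun 'I_q.+1 -> A} => u ord0) => [a _|u].
  by rewrite ffunE.
rewrite inE => /eqP h; apply/ffunP => i; rewrite ffunE.
case: (unliftP ord0 i) => [j ->|-> //].
by have /ffunP/(_ j) := h; rewrite !ffunE/= => ->.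
Qed.

(** Without smoothing this is the conditional entropy [H_{q+1} - H_q]. Raising the numerator only
    helps, and [gibbs] bounds the effect on the denominator by the mass added to it. *)
Lemma kernel_cross : - \sum_u p u * ln (kernel u) <=
  wordent mu T D q.+1 - wordent mu T D q + kap * nA * #|{ffun 'I_q -> A}|%:R.
Proof.
have pk0 u : 0 < p u + kap by rewrite ltr_wpDl// dist_ge0.
have pk'0 v : 0 < p' v + kap * nA by rewrite ltr_wpDl ?dist_ge0// mulr_gt0.
have E : \sum_u p u * ln (kernel u) = \sum_u p u * ln (p u + kap) -
    \sum_v p' v * ln (p' v + kap * nA).
  have -> : \sum_v p' v * ln (p' v + kap * nA) = \sum_u p u * ln (p' (wtail u) + kap * nA).
    rewrite (expect_comp mu01.1 (@wtail q _) (fun v => ln (p' v + kap * nA)))//.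
    by apply: eq_bigr => v _; congr (_ * _); rewrite dist_wtail -(dist_comp mu01.1).
  rewrite -sumrB; apply: eq_bigr => u _.
  by rewrite /kernel ln_div ?posrE// mulrBr.
have h1 : \sum_u p u * ln (p u) <= \sum_u p u * ln (p u + kap).
  apply: ler_sum => u _; have [->|pu] := eqVneq (p u) 0; first by rewrite !mul0r.
  have pu0 : 0 < p u by rewrite lt_neqAle eq_sym pu dist_ge0.
  by rewrite ler_wpM2l ?dist_ge0// ler_ln ?posrE// lerDl ltW.
have h2 := @gibbs R _ p' (fun v => p' v + kap * nA) (fun v => dist_ge0 mu (W q) v)
  (fun v => ltW (pk'0 v)).
have {}h2 : \sum_v p' v * ln (p' v + kap * nA) <=
    \sum_v p' v * ln (p' v) + kap * nA * #|{ffun 'I_q -> A}|%:R.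
  apply: le_trans (h2 _) _; first by move=> v /eqP; rewrite gt_eqF.
  by rewrite big_split/= addrAC subrr add0r sumr_const mulr_natr.
rewrite E /wordent /ent; lra.
Qed.

End Kernel.

(** [A] is an arbitrary set, so monotonicity is that of the outer extension defining
    [lebesgue_measure]. *)
Lemma leb_cover (A : set R) (s : seq R) (r : R) : 0 <= r ->
  (forall x, A x -> exists2 c, c \in s & `|x - c| <= r) ->
  (lebesgue_measure A <= (2 * r * (size s)%:R)%:E)%E.
Proof.
move=> r0 h; pose B := \bigcup_(i < size s) `[nth 0 s i - r, nth 0 s i + r]%classic : set R.
have mB : measurable B by apply: bigcup_measurable => i _; exact: measurable_itv.
apply: (@le_trans _ _ (lebesgue_measure B)).
  apply: le_mu_ext => x /h[c cs hc]; exists (index c s); first by rewrite /= index_mem.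
  by rewrite /= nth_index// in_itv/=; move: hc; rewrite ler_norml => /andP[? ?]; apply/andP; split; lra.
rewrite /B bigcup_mkord.
apply: le_trans (@content_subadditive _ _ _ (lebesgue_measure : {measure set _ -> \bar R})
  _ (fun i => `[nth 0 s i - r, nth 0 s i + r]%classic) (size s) _ _ _) _ => //.
  by move: mB; rewrite /B bigcup_mkord.
rewrite (eq_bigr (fun=> (2 * r)%:E)); last first.
  move=> i _; rewrite /= lebesgue_measure_itv/= lte_fin.
  case: ifP => h1; first by rewrite -EFinD; congr EFin; lra.
  by congr EFin; move/negbT: h1; rewrite -leNgt; lra.
by rewrite sumEFin sumr_const card_ord mulr_natr.
Qed.

Lemma local_upper_inv (mu : {measure set R -> \bar R}) (c : R) : prob01 mu ->
  Defs.invariant T mu -> (hmetric T mu - (ln beta)%:E < c%:E)%E ->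
  exists (k : nat) (f : nat -> R -> R) (eps : R), 0 < eps /\
    (forall i, (i < k)%N -> {within `[0, 1], continuous (f i)}) /\
    exists n0, forall n, (n0 <= n)%N ->
      (lebesgue_measure [set x | (0 <= x <= 1)%R /\
        forall i, (i < k)%N -> (`|intg (empirical T n x) (f i) - intg mu (f i)| < eps)%R] <=
      (expR (n%:R * c))%:E)%E.
Proof.
move=> mu01 muT hc.
have [l [cl ll]] := wordent_cvg mu01.1 mT muT mD.
have lc : l < c + ln beta.
  rewrite -ltrBlDr -lte_fin EFinB; apply: le_lt_trans hc; rewrite leeB//.
  apply: ereal_sup_ubound; exists (bnat beta).+1, (fun i => D @^-1` [set i]).
  split; first exact: label_mpartition.
  congr EFin; apply/esym/cvg_lim => //.
  rewrite (_ : (fun n => _) = (fun n => wordent mu T D n / n%:R))//.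
  by apply/funext => n; rewrite Hn_wordent.
(* If all increments were at least [c + ln beta], their means would be too, but these tend to
   [l]. *)
have [q hq] : exists q, wordent mu T D q.+1 - wordent mu T D q < c + ln beta.
  apply/not_existsP => h; have {}h q : c + ln beta <= wordent mu T D q.+1 - wordent mu T D q.
    by rewrite leNgt; apply/negP; exact: h.
  have hn n : n%:R * (c + ln beta) <= wordent mu T D n.
    elim: n => [|n IH]; first by rewrite mul0r wordent_ge0// mu01.1.
    by rewrite -natr1 mulrDl mul1r; have := h n; lra.
  suff : c + ln beta <= l by rewrite leNgt lc.
  rewrite -(cvg_lim _ cl)//; apply: limr_ge; first by apply/cvg_ex; exists l.
  near=> n; rewrite ler_pdivlMr ?ltr0n; first by rewrite mulrC.
  by near: n; exists 1%N.
(* The gap is spent as follows: a quarter on smoothing the kernel, a quarter on the frequency error,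
   and half on the terms that do not grow with [n]. *)
pose g := c + ln beta - (wordent mu T D q.+1 - wordent mu T D q).
have g0 : 0 < g by rewrite subr_gt0.
pose A := 'I_(bnat beta).+1; pose nA : R := (bnat beta).+1%:R.
pose M : R := #|{ffun 'I_q -> A}|%:R.
have nA0 : 0 < nA by rewrite ltr0n.
have M0 : 0 < M by rewrite ltr0n; apply/card_gt0P; exists [ffun=> ord0].
pose kap := g / (4 * nA * M).
have kap0 : 0 < kap by rewrite divr_gt0// !mulr_gt0.
pose K := kernel mu kap; set K1 := K q.
have K0 u : 0 < K1 u by exact: kernel_gt0.
have hK := kernel_cross mu01 muT q kap0; rewrite -/K -/K1 -/nA -/M in hK.
have kE : kap * nA * M = g / 4 by rewrite /kap; field; rewrite !gt_eqF.
rewrite kE in hK.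
pose B : R := \sum_u `|ln (K1 u)|.
have B0 : 0 <= B by exact: sumr_ge0.
have hB u : `|ln (K1 u)| <= B.
  by rewrite /B (bigD1 u)//= lerDl; exact: sumr_ge0.
pose eta := g / (4 * (B + 1)).
have B1 : 0 < B + 1 by lra.
have eta0 : 0 < eta by rewrite divr_gt0// mulr_gt0.
have etaB : eta * B <= g / 4.
  have E : eta * (B + 1) = g / 4 by rewrite /eta; field; rewrite gt_eqF.
  by rewrite -E ler_wpM2l ?(ltW eta0)//; lra.
have [k [f [eps [eps0 [cf [n0 hn0]]]]]] := cell_nbhd q.+1 mu01 eta0.
exists k, f, eps; split=> //; split=> //.
(* The overheads: the factor 2 in the diameter of the covering intervals, the last [q] windows, and
   the [q] uniform letters of [wordweight]. *)
pose C := ln 2 + q%:R * B + q%:R * ln nA.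
exists (maxn (maxn n0 q.+1) (Num.truncn (2 * `|C| / g)).+1) => n.
rewrite !geq_max => /andP[/andP[n0n qn] Cn].
set E := [set x | _].
pose dgs (x : R) : seq A := mkseq (fun j => D (iter j T x)) n.
pose X := seq.filter (fun s => `[< exists2 x, E x & dgs x = s >]) (allwords A n).
have hX s : s \in X -> exists2 x, E x & dgs x = s.
  by rewrite mem_filter => /andP[/asboolP].
pose ctr s := xget 0 [set x | E x /\ dgs x = s].
have hctr s : s \in X -> E (ctr s) /\ dgs (ctr s) = s.
  by move=> /hX[x Ex xs]; rewrite /ctr; case: xgetP => [y -> []//|/(_ x)[]].
have sX : (size X)%:R <= expR (n%:R * (c + ln beta - g / 2) + q%:R * B + q%:R * ln nA).
  have := @word_count R A ord0 q K1 K0 (kernel_sum mu01 muT q kap0) n X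
    (n%:R * (c + ln beta - g / 2) + q%:R * B) (ltnW qn).
  rewrite card_ord; apply; first by rewrite filter_uniq// allwords_uniq.
  move=> s /hX[x [x01 fx] <-]; split; first by rewrite size_mkseq.
  have nR : 0 < n%:R :> R by rewrite ltr0n (leq_trans _ qn).
  have bE (j : 'I_(n - q)) : blk ord0 q.+1 (drop j (dgs x)) = W q.+1 (iter j T x).
    have jlt := ltn_ord j.
    apply/ffunP => i; rewrite !ffunE nth_drop nth_mkseq; last first.
      by move: (ltn_ord i) jlt; clear; lia.
    by rewrite addnC iterD.
  under eq_bigr do rewrite bE.
  have h1 : n%:R^-1 * \sum_(j < n) - ln (K1 (W q.+1 (iter j T x))) <= c + ln beta - g / 2.
    rewrite -(@expect_empirical R T n x _ (W q.+1) (fun u => - ln (K1 u))).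
    have := hn0 n x n0n x01 fx => hd.
    apply: (@le_trans _ _ (- (\sum_u dist mu (W q.+1) u * ln (K1 u)) + \sum_u eta * `|ln (K1 u)|)).
      rewrite -sumrN -big_split/=; apply: ler_sum => u _.
      have : - (dist (empirical T n x) (W q.+1) u - dist mu (W q.+1) u) * ln (K1 u) <= eta * `|ln (K1 u)|.
        by apply: le_trans (ler_norm _) _; rewrite normrM normrN ler_wpM2r.
      by rewrite mulrN; lra.
    rewrite -mulr_sumr -/B /g; rewrite /g in hK etaB g0; lra.
  rewrite ler_pdivrMl// in h1.
  (* The empirical mean runs over [n] windows, the word weight only over the [n - q] contained in
     the word; the excess is bounded by [q%:R * B]. *)
  have -> : \sum_(j < n - q) - ln (K1 (W q.+1 (iter j T x))) =
     \sum_(j < n) - ln (K1 (W q.+1 (iter j T x))) -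
     \sum_(j < q) - ln (K1 (W q.+1 (iter (n - q + j) T x))).
    pose F j := - ln (K1 (W q.+1 (iter j T x))).
    rewrite -(big_mkord xpredT F) -(big_mkord xpredT F) -(big_mkord xpredT (fun j => F (n - q + j)%N)).
    rewrite (@big_cat_nat _ _ _ (n - q) 0 n)//=; last exact: leq_subr.
    have -> : \sum_(n - q <= i < n) F i = \sum_(0 <= j < q) F (n - q + j)%N.
      rewrite -{1}[(n - q)%N]add0n big_addn subKn ?(ltnW qn)//.
      by apply: eq_big_nat => i _; rewrite addnC.
    by rewrite addrK.
  have : \sum_(j < q) ln (K1 (W q.+1 (iter (n - q + j) T x))) <= q%:R * B.
    rewrite mulr_natl -[X in _ <= _ *+ X]card_ord -sumr_const; apply: ler_sum => j _.
    by apply: le_trans (ler_norm _) _.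
  rewrite [\sum_(j < q) - _]sumrN; lra.
have bX : 0 < beta ^+ n by exact: exprn_gt0.
apply: (le_trans (@leb_cover E [seq ctr s | s <- X] (beta ^- n) _ _)).
- by rewrite invr_ge0 ltW.
- move=> x Ex; have sx : dgs x \in X.
    by rewrite mem_filter mem_allwords size_mkseq eqxx andbT; apply/asboolP; exists x.
  exists (ctr (dgs x)); first exact: map_f.
  have [[y01 _] yE] := hctr _ sx; case: Ex => x01 _.
  apply: (word_dist beta1) => //; apply/wordE => i ilt.
  have := congr1 (fun s => nth ord0 s i) yE; rewrite !nth_mkseq//.
rewrite lee_fin size_map.
have -> : 2 * beta ^- n = expR (ln 2 - n%:R * ln beta).
  by rewrite expRD lnK ?posrE// expRN expRM_natl lnK ?posrE.
apply: le_trans (ler_wpM2l (expR_ge0 _) sX) _.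
rewrite -expRD ler_expR.
have : C <= n%:R * (g / 2).
  apply: le_trans (ler_norm _) _.
  have : 2 * `|C| / g <= n%:R by rewrite ltW// (lt_le_trans (truncnS_gt _))// ler_nat.
  by rewrite ler_pdivrMr//; lra.
by rewrite /C mulrBr mulrDr; lra.
Unshelve. all: by end_near. Qed.

Lemma local_upper (mu : {measure set R -> \bar R}) (c : R) : prob01 mu ->
  (free_energy beta mu < c%:E)%E ->
  exists (k : nat) (f : nat -> R -> R) (eps : R), 0 < eps /\
    (forall i, (i < k)%N -> {within `[0, 1], continuous (f i)}) /\
    exists n0, forall n, (n0 <= n)%N ->
      (lebesgue_measure [set x | (0 <= x <= 1)%R /\
        forall i, (i < k)%N -> (`|intg (empirical T n x) (f i) - intg mu (f i)| < eps)%R] <=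
      (expR (n%:R * c))%:E)%E.
Proof.
move=> mu01; rewrite /free_energy; case: asboolP => [muT|ninv] hc; first exact: local_upper_inv.
have [k [f [eps [eps0 [cf [n0 h]]]]]] := noninvariant_upper mu01 ninv.
exists k, f, eps; split=> //; split=> //; exists n0 => n n0n.
rewrite (_ : [set x | _] = set0); first by rewrite measure0 lee_fin expR_ge0.
by apply/seteqP; split=> // x [x01 fx]; apply: h n0n x01 fx.
Qed.

End LocalUpper.

(** * Markov structure *)

Section RealSeq.
Variable R : realType.
Implicit Types (L : seq R) (a : R).

Lemma seq_max L : L != [::] -> exists2 s : R, s \in L & forall t, t \in L -> t <= s.
Proof.
elim: L => // t [|u L] IH _; first by exists t; rewrite ?mem_head// => v; rewrite inE => /eqP ->.
have [//|s sL hs] := IH; have [ts|st] := leP t s.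
  exists s; first by rewrite inE sL orbT.
  by move=> v; rewrite inE => /orP[/eqP ->//|/hs].
exists t; first exact: mem_head.
by move=> v; rewrite inE => /orP[/eqP ->//|/hs vs]; exact: le_trans vs (ltW st).
Qed.

Lemma seq_min L : L != [::] -> exists2 s : R, s \in L & forall t, t \in L -> s <= t.
Proof.
move=> L0; have [|s] := @seq_max [seq - t | t <- L]; first by case: L L0.
move=> /mapP[t tL ->] h; exists t => // u uL.
by have := h _ (map_f (fun t => - t) uL); rewrite lerN2.
Qed.

Lemma seq_sep L : exists2 g : R, 0 < g & forall s t, s \in L -> t \in L -> s != t -> g <= `|s - t|.
Proof.
suff h L1 : exists2 g : R, 0 < g & forall s t, s \in L -> t \in L1 -> s != t -> g <= `|s - t|.
  exact: h.
elim: L1 => [|u L1 [g g0 IH]]; first by exists 1.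
have [e e0 he] := seq_gap L u; exists (Num.min g e); first by rewrite lt_min g0.
move=> s t sL; rewrite inE => /orP[/eqP ->|tL] st; rewrite ge_min.
  by rewrite (he s sL st) orbT.
by rewrite IH.
Qed.

Lemma convex_gt (c x y t : R) : 0 <= t <= 1 -> c < x -> c < y -> c < x + t * (y - x).
Proof.
move=> /andP[t0]; rewrite le_eqVlt => /orP[/eqP ->|t1] c1 c2; first by lra.
have h1 : 0 < (1 - t) * (x - c) by rewrite mulr_gt0; lra.
have h2 : 0 <= t * (y - c) by rewrite mulr_ge0; lra.
lra.
Qed.

Lemma between_frac (x z y : R) : (x < z < y) || (y < z < x) ->
  exists2 t : R, 0 <= t <= 1 & z = x + t * (y - x).
Proof.
move=> /orP[]/andP[h1 h2].
  exists ((z - x) / (y - x)); first by rewrite divr_ge0 ?ler_pdivrMr ?mul1r; lra.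
  by rewrite divfK ?gt_eqF//; lra.
exists ((x - z) / (x - y)); first by rewrite divr_ge0 ?ler_pdivrMr ?mul1r; lra.
by rewrite -(opprB x y) mulrN divfK ?gt_eqF//; lra.
Qed.

End RealSeq.

Section Markov.
Variables (R : realType) (beta : R).
Hypothesis beta1 : 1 < beta.
Local Notation T := (Tmb beta).
Local Notation D := (@dg R beta).
Local Notation W := (@word R T _ D).
Variable S : seq R.
Hypotheses (S0 : 0 \in S) (S1 : 1 \in S) (S01 : forall s, s \in S -> 0 <= s <= 1).
Hypothesis Scl : forall s (d : nat), s \in S -> d%:R < beta * s -> beta * s < d.+1%:R ->
  d.+1%:R - beta * s \in S.

Let b0 : 0 < beta. Proof. exact: lt_trans beta1. Qed.
Let mT := @measurable_Tmb R beta beta1.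
Let mD := @mlab_dg R beta beta1.
Let T01 := @Tmb01 R beta beta1.

(** Names the component of the complement of [S] that contains [x], with values in a finite type.
    Discontinuities are not listed in [S]; they enter through the digits. *)
Definition pos x : {ffun 'I_(size S) -> bool} := [ffun i : 'I_(size S) => S`_i < x].

Lemma posP x y : pos x = pos y <-> forall s, s \in S -> (s < x) = (s < y).
Proof.
split=> [/ffunP h s sS|h]; last by apply/ffunP => i; rewrite !ffunE h// mem_nth.
have sl : (index s S < size S)%N by rewrite index_mem.
by have := h (Ordinal sl); rewrite !ffunE/= nth_index.
Qed.

(** As 0 and 1 belong to [S], a generic orbit also avoids the branch ends, which are mapped to 0 or
    1 ([gen_dg]). *)
Definition gen x := 0 <= x <= 1 /\ forall k, iter k T x \notin S.

Lemma gen01 x : gen x -> 0 <= x <= 1. Proof. by case. Qed.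
Lemma gen_notin x : gen x -> x \notin S. Proof. by case=> _ /(_ 0%N). Qed.

Lemma gen_iter n x : gen x -> gen (iter n T x).
Proof.
move=> [x01 h]; split; first exact: iter01.
by move=> k; rewrite -iterD.
Qed.

Lemma gen_T x : gen x -> gen (T x).
Proof. exact: (@gen_iter 1). Qed.

Lemma T_S s : s \in S -> T s \in S.
Proof.
move=> sS; have s01 := S01 sS; rewrite TmbE//.
have /andP[] := dgW beta1 s01; rewrite le_eqVlt => /orP[/eqP <-|h1].
  by rewrite -natr1 addrAC subrr add0r.
by rewrite le_eqVlt => /orP[/eqP ->|h2]; [rewrite subrr|exact: Scl].
Qed.

Lemma iter_S n s : s \in S -> iter n T s \in S.
Proof. by move=> sS; elim: n => //= n; exact: T_S. Qed.

Lemma gen_back n x : 0 <= x <= 1 -> gen (iter n T x) -> gen x.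
Proof.
move=> x01 [_ h]; split=> // k; apply/negP => kS.
have [kn|nk] := leqP k n.
  by move/negP: (h 0%N); apply; rewrite /= -(subnK kn) iterD; exact: iter_S.
by move/negP: (h (k - n)%N); rewrite -iterD subnK// ltnW.
Qed.

Lemma gen_dg x : 0 <= x <= 1 -> T x \notin S -> (D x)%:R < beta * x < (D x).+1%:R.
Proof.
move=> x01; rewrite TmbE// => h; have /andP[] := dgW beta1 x01.
rewrite le_eqVlt => /orP[/eqP E|->].
  by move: h; rewrite -E -natr1 addrAC subrr add0r S1.
by rewrite le_eqVlt => /orP[/eqP E|->//]; move: h; rewrite E subrr S0.
Qed.

Lemma gen_dense x y : 0 <= x -> x < y -> y <= 1 -> exists2 z : R, x < z < y & gen z.
Proof.
move=> x0 xy y1.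
have cS : countable [set s | s \in S] by apply: finite_set_countable; exact: finite_seq.
have cB : countable [set x | [set x | 0 <= x <= 1] x /\ exists k, [set s | s \in S] (iter k T x)].
  apply: (@countable_iter_preimage R [set x | 0 <= x <= 1] T (fun n y => ((n%:~R + 1) - y) / beta)) => //.
  move=> z z01; split; first exact: T01.
  exists (Posz (D z)); rewrite TmbE// -natr1 opprB addrC subrK mulrC mulKf//.
  by rewrite gt_eqF.
have [z zxy hz] := itv_avoid_countable cB xy; exists z => //.
have z01 : 0 <= z <= 1 by case/andP: zxy => ? ?; apply/andP; split; lra.
by split=> // k; apply/negP => kS; apply: hz; split=> //; exists k.
Qed.

Lemma component a : 0 <= a <= 1 -> a \notin S -> exists s s', [/\ s \in S, s' \in S, s < a < s' &
  forall z, s < z < s' -> z \notin S /\ pos z = pos a].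
Proof.
move=> /andP[a0 a1] aS.
have an s : s \in S -> s != a by move=> sS; apply: contraNneq aS => <-.
have [|s] := @seq_max R (seq.filter (fun s => s < a) S).
  apply/eqP => E; have : 0 \in seq.filter (fun s => s < a) S.
    by rewrite mem_filter S0 andbT lt_neqAle a0 an.
  by rewrite E.
rewrite mem_filter => /andP[sa sS] hs.
have [|s'] := @seq_min R (seq.filter (fun s => a < s) S).
  apply/eqP => E; have : 1 \in seq.filter (fun s => a < s) S.
    by rewrite mem_filter S1 andbT lt_neqAle a1 eq_sym an.
  by rewrite E.
rewrite mem_filter => /andP[sa' sS'] hs'.
have side t : t \in S -> t <= s \/ s' <= t.
  move=> tS; have [ta|at_|E] := ltgtP t a.
  - by left; apply: hs; rewrite mem_filter ta.
  - by right; apply: hs'; rewrite mem_filter at_.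
  - by move: (an _ tS); rewrite E eqxx.
exists s, s'; split; rewrite ?sa//.
move=> z /andP[sz zs]; split.
  by apply/negP => /side[]; lra.
apply/posP => t /side[] h.
  by rewrite (le_lt_trans h sz) (le_lt_trans h sa).
by rewrite !ltNge (le_trans (ltW zs) h) (le_trans (ltW sa') h).
Qed.

Lemma notin01 x : 0 <= x <= 1 -> x \notin S -> 0 < x < 1.
Proof.
move=> /andP[x0 x1] xS; rewrite !lt_neqAle x0 x1 !andbT.
by apply/andP; split; [apply: contraNneq xS => <-|apply: contraNneq xS => ->].
Qed.

Lemma pos01 x z : 0 <= x <= 1 -> x \notin S -> z \notin S -> pos z = pos x -> 0 < z < 1.
Proof.
move=> x01 xS zS /posP zx; have /andP[x0 x1] := notin01 x01 xS.
rewrite zx// x0/= lt_neqAle leNgt zx// -leNgt (ltW x1) andbT.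
by apply: contraNneq zS => ->.
Qed.

(** Markov property. The point of the branch of [x] above [z] is in the same component as [x]: a
    point of [S] between them would have its image in [S] between [T x] and [z]. *)
Lemma pull1 x z : 0 <= x <= 1 -> x \notin S -> T x \notin S -> z \notin S -> pos z = pos (T x) ->
  exists y, [/\ 0 <= y <= 1, y \notin S, pos y = pos x, D y = D x & T y = z].
Proof.
move=> x01 xS TxS zS zx; have /andP[d1 d2] := gen_dg x01 TxS.
have z01 := pos01 (T01 x01) TxS zS zx.
move: (TxS) zx; rewrite TmbE//; set d := D x in d1 d2 *; rewrite -natr1 in d2 * => TxS' /posP zx.
pose y := (d%:R + 1 - z) / beta.
have by_ : beta * y = d%:R + 1 - z by rewrite /y mulrC divfK// gt_eqF.
have h s : s \in S -> (beta * s < beta * x) = (beta * s < beta * y) /\ (s != y).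
  move=> sS; have [l1|l1] := leP (beta * s) d%:R.
    split; first by rewrite (le_lt_trans l1 d1); apply/esym; rewrite by_; lra.
    by apply/eqP => E; rewrite E by_ in l1; lra.
  have [l2|l2] := leP d.+1%:R (beta * s); rewrite -natr1 in l2.
    split; first by apply/idP/idP; rewrite ?by_; lra.
    by apply/eqP => E; rewrite E by_ in l2; lra.
  have iS : d%:R + 1 - beta * s \in S by rewrite natr1; apply: Scl => //; rewrite -natr1.
  have := zx _ iS; rewrite by_ => E; split.
    have nz : z != d%:R + 1 - beta * s by apply: contraNneq zS => ->.
    have sx : beta * s != beta * x.
      by apply: contraNneq xS => /mulfI <- //; rewrite gt_eqF.
    have [lz|lz|E2] := ltgtP z (d%:R + 1 - beta * s); last by rewrite E2 eqxx in nz.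
      have : ~~ (d%:R + 1 - beta * s < z) by rewrite -leNgt ltW.
      rewrite E -leNgt => ?; have -> : beta * s < beta * x by rewrite lt_neqAle sx/=; lra.
      by apply/esym; lra.
    by move: lz; rewrite E => ?; apply/idP/idP; lra.
  by apply: contraNneq zS => sy; move: iS; rewrite sy by_ opprB addrC subrK.
have yx : pos y = pos x.
  by apply/posP => s sS; have [+ _] := h s sS; rewrite !ltr_pM2l.
have yS : y \notin S by apply/negP => yS; have [_ /eqP] := h y yS.
have y01 : 0 <= y <= 1 by have /andP[/ltW -> /ltW ->] := pos01 x01 xS yS yx.
have Dy : D y = D x.
  by apply: val_inj => /=; apply: dg_open => //; rewrite by_ -?natr1; lra.
exists y; split=> //; rewrite TmbE// Dy -/d -natr1 by_; lra.
Qed.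

Lemma pull n x z : gen x -> z \notin S -> pos z = pos (iter n T x) ->
  exists y, [/\ 0 <= y <= 1, y \notin S, pos y = pos x, W n y = W n x & iter n T y = z].
Proof.
elim: n x => [|n IH] x gx zS zx.
  exists z; split=> //; last by apply/ffunP => -[].
  by have /andP[/ltW -> /ltW ->] := pos01 (gen01 gx) (gen_notin gx) zS zx.
have [|y1 [y101 y1S y1x Wy1 y1z]] := IH (T x) (gen_T gx) zS; first by rewrite -iterSr.
have [y [y01 yS yx Dy Ty]] :=
  pull1 (gen01 gx) (gen_notin gx) (gen_notin (gen_T gx)) y1S y1x.
exists y; split=> //; last by rewrite iterSr Ty.
apply/wordE => -[|i] il //; rewrite !iterSr Ty.
by move/wordE: Wy1; apply.
Qed.

Lemma pull_gen n x z : gen x -> gen z -> pos z = pos (iter n T x) ->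
  exists y, [/\ gen y, pos y = pos x, W n y = W n x & iter n T y = z].
Proof.
move=> gx gz zx; have [y [y01 _ yx Wy yz]] := pull gx (gen_notin gz) zx.
by exists y; split=> //; apply: (gen_back (n := n)) => //; rewrite yz.
Qed.

(** A relation between components: [x] and [y] enter only through [pos], which lets [pull_gen] prove
    transitivity. *)
Definition reach x y := exists n x', [/\ gen x', pos x' = pos x & pos (iter n T x') = pos y].

Lemma reach_trans x y z : reach x y -> reach y z -> reach x z.
Proof.
move=> [n [x' [gx' xx' xy]]] [n' [y' [gy' yy' yz]]].
have [|u [gu ux _ uy]] := pull_gen (n := n) gx' gy'; first by rewrite yy' xy.
by exists (n' + n)%N, u; split; rewrite ?ux// iterD uy.
Qed.

Lemma reach_iter n x : gen x -> reach x (iter n T x).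
Proof. by move=> gx; exists n, x. Qed.

Lemma reach_pos x y y' : pos y = pos y' -> reach x y -> reach x y'.
Proof. by move=> E [n [x' [gx' xx' xy]]]; exists n, x'; rewrite -E. Qed.

Lemma dg_convex x y z (t : R) : 0 <= x <= 1 -> 0 <= y <= 1 -> 0 <= t <= 1 ->
  z = x + t * (y - x) -> (D x)%:R < beta * x < (D x).+1%:R -> D y = D x -> D z = D x.
Proof.
move=> x01 y01 /andP[t0 t1] zE; rewrite -natr1 => /andP[h1 h2] E; have := dgW beta1 y01; rewrite E -natr1 => /andP[h3 h4].
have [tE|tn] := eqVneq t 1; first by rewrite zE tE mul1r addrC subrK.
have t1' : t < 1 by rewrite lt_neqAle tn.
have z01 : 0 <= z <= 1 by case/andP: x01 => ? ?; case/andP: y01 => ? ?; apply/andP; split; nra.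
have bz : beta * z = (1 - t) * (beta * x) + t * (beta * y) by rewrite zE; ring.
by apply: val_inj => /=; apply: dg_open => //; rewrite bz -?natr1; nra.
Qed.

(** Digit cells are convex and the iterate is affine on them, so segments are followed as long as
    the digits of their ends agree. *)
Lemma word_convex n x y z (t : R) : gen x -> 0 <= y <= 1 -> 0 <= t <= 1 ->
  z = x + t * (y - x) -> W n y = W n x ->
  W n z = W n x /\ iter n T z = iter n T x + t * (iter n T y - iter n T x).
Proof.
elim: n x y z => [|n IH] x y z gx y01 t01 zE; first by split=> //; apply/wordE.
have x01 := gen01 gx.
move=> /wordE h; have Dyx : D y = D x by exact: (h 0%N).
have Dz : D z = D x.
  by apply: dg_convex zE _ Dyx => //; apply: gen_dg => //; exact/gen_notin/gen_T.
have z01 : 0 <= z <= 1 by case/andP: x01 => ? ?; case/andP: y01 => ? ?; case/andP: t01 => ? ?; apply/andP; split; nra.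
have TzE : T z = T x + t * (T y - T x) by rewrite !TmbE// Dz Dyx zE; ring.
have [|/wordE h1 h2] := IH (T x) (T y) (T z) (gen_T gx) (T01 y01) t01 TzE.
  by apply/wordE => i il; rewrite -!(@iterSr _ i); exact: h.
rewrite !(@iterSr _ n); split=> //; apply/wordE => -[|i] il //.
by rewrite !(@iterSr _ i); exact: h1.
Qed.

(** The part of the branch of [x] left of [x] is mapped, orientation reversed, onto everything above
    [T x]. *)
Lemma reach_below x y (a : R) : gen x -> 0 <= a -> beta * a <= (D x)%:R ->
  (forall z, gen z -> a < z < x -> reach y z) -> forall z, gen z -> T x < z -> reach y z.
Proof.
move=> gx a0 ad h z gz xz; have x01 := gen01 gx.
have /andP[d1 d2] := gen_dg x01 (gen_notin (gen_T gx)).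
move: xz; rewrite TmbE//; set d := D x in ad d1 d2 *; rewrite -natr1 in d2 * => xz.
pose u := (d%:R + 1 - z) / beta.
have bu : beta * u = d%:R + 1 - z by rewrite /u mulrC divfK// gt_eqF.
have /andP[z0 z1] := notin01 (gen01 gz) (gen_notin gz).
have ux : u < x by rewrite -(ltr_pM2l b0) bu; lra.
have au : a < u by rewrite -(ltr_pM2l b0) bu; lra.
have u01 : 0 <= u <= 1 by case/andP: x01 => _ ?; apply/andP; split; lra.
have Tu : T u = z.
  rewrite TmbE// (_ : nat_of_ord (D u) = d) -?natr1 ?bu; first by lra.
  by apply: dg_open => //; rewrite bu -?natr1; lra.
have gu : gen u by apply: (gen_back (n := 1)) => //=; rewrite Tu.
have hu : reach y u by apply: h => //; rewrite au.
by apply: reach_trans hu _; rewrite -Tu; exact: (reach_iter 1).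
Qed.

Lemma reach_above x y (a : R) : gen x -> a <= 1 -> (D x).+1%:R <= beta * a ->
  (forall z, gen z -> x < z < a -> reach y z) -> forall z, gen z -> z < T x -> reach y z.
Proof.
move=> gx a1 ad h z gz xz; have x01 := gen01 gx.
have /andP[d1 d2] := gen_dg x01 (gen_notin (gen_T gx)).
move: xz; rewrite TmbE//; set d := D x in ad d1 d2 *; rewrite -natr1 in ad d2 * => xz.
pose u := (d%:R + 1 - z) / beta.
have bu : beta * u = d%:R + 1 - z by rewrite /u mulrC divfK// gt_eqF.
have /andP[z0 z1] := notin01 (gen01 gz) (gen_notin gz).
have ux : x < u by rewrite -(ltr_pM2l b0) bu; lra.
have au : u < a by rewrite -(ltr_pM2l b0) bu; lra.
have u01 : 0 <= u <= 1 by case/andP: x01 => ? _; apply/andP; split; lra.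
have Tu : T u = z.
  rewrite TmbE// (_ : nat_of_ord (D u) = d) -?natr1 ?bu; first by lra.
  by apply: dg_open => //; rewrite bu -?natr1; lra.
have gu : gen u by apply: (gen_back (n := 1)) => //=; rewrite Tu.
have hu : reach y u by apply: h => //; rewrite ux.
by apply: reach_trans hu _; rewrite -Tu; exact: (reach_iter 1).
Qed.

(* The image of the component of [x] stretches until it straddles a discontinuity; one or
   two steps later it covers everything above the orbit point. *)
Lemma reach_top : exists j1, forall x, gen x ->
  exists2 j, (j <= j1)%N & forall y, gen y -> iter j T x <= y -> reach x y.
Proof.
have [g g0 hg] := seq_sep S; have g20 : 0 < g / 3 by lra.
have [n0 hn0] := beta_pow_small beta1 g20.
exists n0.+1 => x gx; have x01 := gen01 gx.
have [s [s' [sS sS' /andP[sx xs] hc]]] := component x01 (gen_notin gx).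
have gss : g <= s' - s.
  have := hg s' s sS' sS; rewrite gtr0_norm; last by lra.
  by apply; rewrite gt_eqF//; lra.
have [s0 _] := andP (S01 sS); have [_ s1] := andP (S01 sS').
(* A second point of the same component, far enough that its digits must differ from those of [x]
   before time [n0]. *)
have [x' [gx' x'c x'x]] : exists x', [/\ gen x', s < x' < s' & g / 3 <= `|x' - x|].
  have [h|h] := lerP (x - s) (g / 2).
    have [z /andP[z1 z2] gz] : exists2 z : R, x + g / 3 < z < s' & gen z.
      by apply: gen_dense s1; lra.
    by exists z; split=> //; [apply/andP; split; lra|rewrite ler_normr; apply/orP; left; lra].
  have [z /andP[z1 z2] gz] : exists2 z : R, s < z < x - g / 3 & gen z.
    by apply: gen_dense s0 _ _; [|case/andP: x01]; lra.
  by exists z; split=> //; [apply/andP; split; lra|rewrite ler_normr; apply/orP; right; lra].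
have x'01 := gen01 gx'.
pose P k := D (iter k T x') != D (iter k T x).
have exP : exists k, P k.
  apply: contrapT => /forallNP h.
  have : `|x' - x| <= beta ^- n0.
    by apply: word_dist => //; apply/wordE => i _; apply/eqP/negPn/negP; exact: h.
  by have := hn0 n0 (leqnn _); lra.
case: (ex_minnP exP) => k Pk kmin.
have Wk : W k x' = W k x.
  by apply/wordE => i ik; apply/eqP/negPn/negP => /kmin; rewrite leqNgt ik.
have kn0 : (k < n0)%N.
  rewrite ltnNge; apply/negP => nk; have := word_dist beta1 x'01 x01 (word_le nk Wk).
  by have := hn0 n0 (leqnn _); lra.
set a := iter k T x in Pk; set a' := iter k T x' in Pk.
have ga : gen a by exact: gen_iter.
have ga' : gen a' by exact: gen_iter.
have a01 := gen01 ga; have a'01 := gen01 ga'.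
have /andP[ad1 ad2] := gen_dg a01 (gen_notin (gen_T ga)).
have /andP[ad1' ad2'] := gen_dg a'01 (gen_notin (gen_T ga')).
have btw z (t : R) : gen z -> 0 <= t <= 1 -> z = a + t * (a' - a) -> reach x z.
  move=> gz t01 zE; pose u := x + t * (x' - x).
  have [_] := word_convex gx x'01 t01 (erefl u) Wk.
  rewrite -/a -/a' -zE => uz.
  have uc : s < u < s'.
    case/andP: x'c => x's x's'; rewrite /u convex_gt//=.
    by have := @convex_gt R (- s') (- x) (- x') t t01; rewrite !ltrN2 => /(_ xs x's'); lra.
  have [uS ux] := hc u uc.
  have u01 : 0 <= u <= 1 by case/andP: uc => ? ?; apply/andP; split; lra.
  exists k, u; split=> //; last by rewrite uz.
  by apply: (gen_back (n := k)) => //; rewrite uz.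
(* The covered segment from [a] to [a'] contains the part of the branch right of [a], whose image is
   everything below [T a]; one more step gives everything above [T (T a)]. *)
have [lt|ge] := ltnP (D a) (D a').
  have hab z : gen z -> a < z < a' -> reach x z.
    move=> gz zb; have [|t t01 zE] := @between_frac R a z a'; first by rewrite zb.
    exact: btw zE.
  have hdd : (D a).+1%:R <= beta * a' by rewrite ltW// (le_lt_trans _ ad1')// ler_nat.
  have h1 := @reach_above a x a' ga _ hdd hab.
  have {}h1 z : gen z -> 0 < z < T a -> reach x z by move=> gz /andP[_]; apply: h1 => //; case/andP: a'01.
  exists k.+2 => // y gy; rewrite le_eqVlt => /orP[/eqP <-|]; first exact: reach_iter.
  by apply: (@reach_below (T a) x 0) => //; [exact: gen_T|rewrite mulr0 ler0n].
(* Here the part of the branch left of [a] is covered, and one step suffices. *)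
have {}ge : (D a' < D a)%N.
  by rewrite ltn_neqAle ge andbT; apply: contraNneq Pk => /val_inj ->.
have hab z : gen z -> a' < z < a -> reach x z.
  move=> gz zb; have [|t t01 zE] := @between_frac R a z a'; first by rewrite zb orbT.
  exact: btw zE.
have hdd : beta * a' <= (D a)%:R by rewrite ltW// (lt_le_trans ad2')// ler_nat.
exists k.+1; first exact: ltnW.
move=> y gy; rewrite le_eqVlt => /orP[/eqP <-|]; first exact: reach_iter.
by apply: (@reach_below a x a') => //; case/andP: a'01.
Qed.

(** By [reach_top] a component reaches everything close enough to 1. The rank counts the thresholds
    in [S] above which something is missed: a smaller rank means that more is reached. *)
Definition covers x s := `[< forall y, gen y -> s < y -> reach x y >].
Definition rk x : nat := count (fun s => ~~ covers x s) S.

Lemma rk_le_size x : (rk x <= size S)%N. Proof. exact: count_size. Qed.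

Lemma rk_T x : gen x -> (rk x <= rk (T x))%N.
Proof.
move=> gx; apply: sub_count => s; apply: contra => /asboolP h; apply/asboolP => y gy sy.
by apply: reach_trans (h y gy sy); exact: (reach_iter 1).
Qed.

Lemma count_lt (U : eqType) (a b : pred U) (L : seq U) u : u \in L -> ~~ a u -> b u ->
  subpred a b -> (count a L < count b L)%N.
Proof.
move=> uL au bu ab; elim: L uL => //= v L IH; rewrite inE => /orP[/eqP <-|uL].
  by rewrite (negbTE au) bu add0n add1n ltnS sub_count.
have := IH uL; case av : (a v); first by rewrite (ab _ av) ltn_add2l.
by move=> h; rewrite add0n (leq_trans h)// leq_addl.
Qed.

(** The covered thresholds are closed upwards in [S], hence nested for different points, and
    comparing their numbers compares the sets. *)
Lemma rk_covers x x' s : s \in S -> (rk x <= rk x')%N -> covers x' s -> covers x s.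
Proof.
move=> sS; rewrite leqNgt => h c'; apply/negPn/negP => nc; move/negP: h; apply.
apply: (count_lt sS); rewrite ?c' ?nc// => t; apply: contra => /asboolP ct.
have [st|ts] := leP s t.
  by apply/asboolP => y gy ty; move/asboolP: c'; apply=> //; exact: le_lt_trans ty.
exfalso; move/negP: nc; apply; apply/asboolP => y gy sy; apply: ct => //; exact: lt_trans sy.
Qed.

(** After [j] steps [x'] is in a component that it covers down to the lower end [s]; by rank so does
    [x], which therefore reaches this component. The remaining [j1 - j] steps make the time
    uniform. *)
Lemma rk_reach : exists j1, forall x x', gen x' -> (rk x <= rk x')%N -> reach x (iter j1 T x').
Proof.
have [j1 hj1] := reach_top; exists j1 => x x' gx' rxx'.
have [j jj1 hj] := hj1 x' gx'; have ga := gen_iter j gx'.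
have [s [s' [sS sS' /andP[sa as'] hc]]] := component (gen01 ga) (gen_notin ga).
have /asboolP c : covers x s.
  apply: rk_covers sS rxx' _; apply/asboolP => y gy sy.
  have [ay|ya] := leP (iter j T x') y; first exact: hj.
  have [|_ E] := hc y; first by rewrite sy (lt_trans ya).
  by apply: reach_pos (esym E) (hj _ ga (lexx _)).
apply: reach_trans (c _ ga sa) _; rewrite -(subnK jj1) iterD; exact: reach_iter.
Qed.

(** Reachability depends only on a pair of components, and there are finitely many pairs. *)
Lemma reach_bounded : exists c0, forall x y, reach x y ->
  exists n x', [/\ (n <= c0)%N, gen x', pos x' = pos x & pos (iter n T x') = pos y].
Proof.
pose PT := {ffun 'I_(size S) -> bool}.
suff /choice[f hf] : forall pq : PT * PT, exists n, forall x y, pos x = pq.1 -> pos y = pq.2 ->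
  reach x y -> exists x', [/\ gen x', pos x' = pos x & pos (iter n T x') = pos y].
  exists (\max_(pq : PT * PT) f pq)%N => x y xy.
  have [x' [h1 h2 h3]] := hf (pos x, pos y) x y erefl erefl xy.
  by exists (f (pos x, pos y)), x'; split=> //; exact: leq_bigmax.
move=> [p1 p2] /=; have [[x [y [<- <- [n [x' h]]]]]|no] := pselect (exists x y, [/\ pos x = p1, pos y = p2 & reach x y]).
  by exists n => x1 y1 -> -> _; exists x'.
by exists 0%N => x y xp yp xy; exfalso; apply: no; exists x, y.
Qed.

Lemma gen_in_cell n x : 0 <= x <= 1 -> exists2 y, gen y & W n y = W n x.
Proof.
move=> x01; have [sg [d d0 h]] := sided_all beta1 n x01.
have hd : 0 < d / 2 < d by apply/andP; split; lra.
have [z01 _] := h _ hd.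
case: sg h z01 => h; rewrite ?expr1 ?expr0 ?mulN1r ?mul1r => /andP[z0 z1].
  have [||z /andP[zl zr] gz] := @gen_dense (x - d / 2) x z0; [lra|by case/andP: x01|].
  exists z => //; apply/wordE; have [|_] := h (x - z); first by apply/andP; split; lra.
  by rewrite expr1 mulN1r opprB addrC subrK.
have [z /andP[zl zr] gz] : exists2 z : R, x < z < x + d / 2 & gen z.
  by apply: gen_dense z1; [case/andP: x01|lra].
exists z => //; apply/wordE; have [|_] := h (z - x); first by apply/andP; split; lra.
by rewrite expr0 mul1r addrC subrK.
Qed.

(** By [pull] the [n]-cell covers the whole component of the [n]-th iterate, of length at least the
    separation [g] of [S], with slope [beta ^+ n] in absolute value. *)
Lemma cell_itv : exists2 g : R, 0 < g & forall n x, gen x -> exists u v : R,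
  beta ^- n * g <= v - u /\ forall y, u < y < v -> 0 <= y <= 1 /\ W n y = W n x.
Proof.
have [g g0 hg] := seq_sep S; exists g => // n x gx; have x01 := gen01 gx.
have ga := gen_iter n gx; set a := iter n T x in ga.
have [s [s' [sS sS' /andP[sa as'] hc]]] := component (gen01 ga) (gen_notin ga).
have gss : g <= s' - s.
  have := hg s' s sS' sS; rewrite gtr0_norm; last by lra.
  by apply; rewrite gt_eqF//; lra.
have bX : 0 < beta ^- n by rewrite invr_gt0 exprn_gt0.
have bXn : beta ^- n * beta ^+ n = 1 by rewrite mulVf// expf_neq0// gt_eqF.
pose sgn : R := (-1) ^+ odd n.
have sgnE : (- beta) ^+ n = sgn * beta ^+ n by rewrite exprNn -signr_odd.
have sgn2 : sgn * sgn = 1 by rewrite /sgn; case: (odd n); rewrite ?expr1 ?expr0 ?mulrNN ?mulr1.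
have key y : s < a + (- beta) ^+ n * (y - x) < s' -> 0 <= y <= 1 /\ W n y = W n x.
  move=> /hc[zS zx]; have [y' [y'01 _ _ Wy' y'z]] := pull gx zS zx.
  have := expansion beta1 y'01 x01 Wy'; rewrite y'z -/a => E.
  suff -> : y = y' by [].
  have : (- beta) ^+ n * (y - x) = (- beta) ^+ n * (y' - x) by rewrite -E; lra.
  by move/mulfI => /(_ _)/addIr; apply; rewrite expf_neq0// oppr_eq0 gt_eqF.
have lenE : beta ^- n * g <= beta ^- n * (s' - a) + beta ^- n * (a - s).
  by rewrite -mulrDr ler_pM2l//; lra.
have mb y : beta ^+ n * (beta ^- n * y) = y by rewrite mulrA divff ?mul1r// expf_neq0// gt_eqF.
case on : (odd n).
  have sE : (- beta) ^+ n = - beta ^+ n by rewrite sgnE /sgn on expr1 mulN1r.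
  exists (x - beta ^- n * (s' - a)), (x + beta ^- n * (a - s)); split; first by lra.
  move=> y /andP[y1 y2]; apply: key; rewrite sE.
  have h1 : beta ^+ n * (y - x) < a - s by rewrite -[ltRHS]mb ltr_pM2l ?exprn_gt0//; lra.
  have h2 : beta ^+ n * (x - y) < s' - a by rewrite -[ltRHS]mb ltr_pM2l ?exprn_gt0//; lra.
  by apply/andP; split; lra.
have sE : (- beta) ^+ n = beta ^+ n by rewrite sgnE /sgn on expr0 mul1r.
exists (x - beta ^- n * (a - s)), (x + beta ^- n * (s' - a)); split; first by lra.
move=> y /andP[y1 y2]; apply: key; rewrite sE.
have h1 : beta ^+ n * (y - x) < s' - a by rewrite -[ltRHS]mb ltr_pM2l ?exprn_gt0//; lra.
have h2 : beta ^+ n * (x - y) < a - s by rewrite -[ltRHS]mb ltr_pM2l ?exprn_gt0//; lra.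
by apply/andP; split; lra.
Qed.

Section Blocks.
Variables (mu : {measure set R -> \bar R}) (mu01 : prob01 mu) (muT : Defs.invariant T mu).

(** The rank is monotone along generic orbits only, while [mu] may charge other points; these
    receive the ranks present in all of their digit cells. *)
Definition highrk r : set R := [set x | forall n, exists y, [/\ gen y, W n y = W n x & (r <= rk y)%N]].

Lemma measurable_highrk r : measurable (highrk r).
Proof.
rewrite (_ : highrk r = \bigcap_n [set x | `[< exists y, [/\ gen y, W n y = W n x & (r <= rk y)%N] >]]).
  apply: bigcapT_measurable => n.
  exact: (measurable_word mT (fun w => `[< exists y, [/\ gen y, W n y = w & (r <= rk y)%N] >]) mD).
apply/seteqP; split=> x h n => [_|]; first by apply/asboolP; exact: h.
by have /asboolP := h n I.
Qed.

Lemma highrk_T r x : highrk r x -> highrk r (T x).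
Proof.
move=> h n; have [y [gy Wy ry]] := h (n + 1)%N; exists (T y); split.
- exact: gen_T.
- exact: (word_shift Wy).
- exact: leq_trans ry (rk_T gy).
Qed.

Lemma highrk_iter r n x : highrk r x -> highrk r (iter n T x).
Proof. by move=> h; elim: n => //= n; exact: highrk_T. Qed.

(** The set is contained in its preimage by [highrk_T], and invariance gives both the same finite
    mass. *)
Lemma highrk_null r N : mu.-negligible (iter N T @^-1` highrk r `\` highrk r).
Proof.
have mA := measurable_highrk r; have mB := measurable_iter mT N mA.
exists (iter N T @^-1` highrk r `\` highrk r); split=> //; first exact: measurableD.
have fB : (mu (iter N T @^-1` highrk r) < +oo)%E by rewrite (prE mu01.1 mB) ltry.
have fA : mu (highrk r) \is a fin_num by rewrite (prE mu01.1 mA).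
rewrite measureD//.
rewrite (_ : _ `&` _ = highrk r); last first.
  by apply/seteqP; split=> [x []//|x h]; split=> //; exact: highrk_iter.
by rewrite -[X in (X - _)%E]/(mu (iter N T @^-1` highrk r)) (invariant_iter mT muT)// subee.
Qed.

(* A block of positive measure is realised by a generic point whose rank does not increase
   along it: by invariance the limiting rank of almost every point is constant on its orbit. *)
Lemma block_point j m u : 0 < dist mu (W m) u ->
  exists y, [/\ gen y, W m (iter j T y) = u & (rk (iter (j + m) T y) <= rk y)%N].
Proof.
move=> up; pose N := (j + m)%N.
have [x [x01 xu hx]] : exists x, [/\ 0 <= x <= 1, W m (iter j T x) = u &
    forall r, highrk r (iter N T x) -> highrk r x].
  apply: contrapT => no.
  have neg : mu.-negligible ((W m \o iter j T) @^-1` [set u]).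
    apply: (@negligibleS _ _ _ _ (~` `[0, 1]%classic `|` \bigcup_r (iter N T @^-1` highrk r `\` highrk r))).
      move=> x /= xu; have [x01|x01] := pselect (0 <= x <= 1); last by left; rewrite /= in_itv.
      right; apply: contrapT => nb; apply: no; exists x; split=> // r hr.
      by apply: contrapT => nr; apply: nb; exists r.
    apply: negligibleU; last by apply: negligible_bigcup => r; exact: highrk_null.
    by exists (~` `[0, 1]%classic); split=> //; [apply: measurableC; exact: measurable_itv|exact: mu01.2].
  have mW := @mlab_word R T mT _ D m mD; have := measure_negligible (mlab_iter mT j mW u) neg => E.
  by move: up; rewrite -(dist_iter mT muT j mW) /dist /pr E ltxx.
have ex0 : highrk 0 x.
  by move=> n; have [y gy Wy] := gen_in_cell n x01; exists y.
have hb r : `[< highrk r x >] -> (r <= size S)%N.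
  by move=> /asboolP/(_ 0%N)[y [_ _ h]]; apply: leq_trans h (rk_le_size y).
have exr : exists r, `[< highrk r x >] by exists 0%N; apply/asboolP.
case: (ex_maxnP exr hb) => r /asboolP xr rmax.
have : ~ highrk r.+1 (iter N T x).
  by move=> /hx/asboolP/rmax; rewrite ltnn.
(* Rank [r.+1] is already excluded in the [n1]-cell of the [N]-th iterate. A generic point of rank
   at least [r] in the [(n1 + N)]-cell of [x] thus has rank at most [r] after [N] steps. *)
move=> /existsNP[n1 hn1].
have [y [gy Wy ry]] := xr (n1 + N)%N; exists y; split=> //.
  rewrite -xu; have mN : (m <= n1 + m)%N by exact: leq_addl.
  by apply: (word_le mN); apply: word_shift; rewrite -addnA (addnC m).
apply: leq_trans ry; rewrite leqNgt; apply/negP => h; apply: hn1.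
exists (iter N T y); split=> //; first exact: gen_iter.
exact: word_shift.
Qed.

End Blocks.

End Markov.

(** * Local lower bound *)

Lemma sorted_const (U : Type) (r : U -> nat) k (s : seq U) :
  all (fun u => r u == k) s -> sorted (relpre r leq) s.
Proof.
case: s => //= u s /andP[/eqP ru]; elim: s u ru => //= v s IH u ru /andP[/eqP rv h].
by rewrite ru rv leqnn/=; exact: IH.
Qed.

Lemma shuffle_eq (U : eqType) (r : U -> nat) (s s' : seq U) : map r s = map r s' ->
  (forall k, [seq u <- s | r u == k] = [seq u <- s' | r u == k]) -> s = s'.
Proof.
elim: s s' => [|a s IH] [|a' s'] //= [ra rs] h.
have aa' : a = a' by have := h (r a); rewrite eqxx ra eqxx => -[].
subst a'; congr (_ :: _); apply: IH => // k.
by have := h k; case: ifP => // _ [].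
Qed.

(** Sorting is stable, so it keeps every subsequence of constant rank, and these together with the
    list of ranks determine the sequence. This limits the loss from sorting blocks. *)
Lemma sort_shuffle_eq (U : eqType) (r : U -> nat) (s s' : seq U) : map r s = map r s' ->
  sort (relpre r leq) s = sort (relpre r leq) s' -> s = s'.
Proof.
move=> rs ss; apply: (shuffle_eq rs) => k.
have tot : total (relpre r leq) by move=> u v; exact: leq_total.
have tr : transitive (relpre r leq) by move=> u v w; exact: leq_trans.
have f t : [seq u <- t | r u == k] = [seq u <- sort (relpre r leq) t | r u == k].
  by rewrite filter_sort// sorted_sort// (sorted_const (k := k))// filter_all.
by rewrite f ss -f.
Qed.

Section RateEstimates.
Variable R : realType.

Lemma rate_estimate (n N m c h H E lnK : R) : N * (m + c) <= n <= N * (m + c) + (m + c) ->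
  0 <= N -> 0 <= m -> 0 <= c -> (m + c) * H <= E - 1 - lnK ->
  n * h + (m + c) * `|H| + ln 2 <= n * H -> n * h <= N * (E - 1 - lnK) - ln 2.
Proof.
move=> /andP[n1 n2] N0 m0 c0 hE hn.
have h1 := ler_wpM2l N0 hE.
have h2 : (n - N * (m + c)) * H <= (m + c) * `|H|.
  apply: le_trans (ler_norm _) _; rewrite normrM ler_wpM2r// ger0_norm; lra.
have E1 : (n - N * (m + c)) * H = n * H - N * ((m + c) * H) by ring.
lra.
Qed.

(** In the application [a] counts the occurrences along the orbit, [s] those inside blocks, and [c]
    is the number of positions that the blocks offer. *)
Lemma freq_estimate (n a s c N p eta : R) : 0 < n -> 0 <= p <= 1 -> s <= a -> a <= n - c + s ->
  `|s - c * p| <= N -> c <= n -> n - c + N <= eta * n -> `|n^-1 * a - p| <= eta.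
Proof.
move=> n0 /andP[p0 p1] sa an; rewrite ler_norml => /andP[h1 h2] cn hn.
have e1 : 0 <= (n - c) * p by rewrite mulr_ge0// subr_ge0.
have e2 : 0 <= (n - c) * (1 - p) by rewrite mulr_ge0// subr_ge0.
have -> : n^-1 * a - p = (a - n * p) / n by field; rewrite gt_eqF.
rewrite ler_norml ler_pdivlMr// ler_pdivrMr//; apply/andP; split; nra.
Qed.

End RateEstimates.

Section Counting.
Variables (R : realType) (beta : R).
Hypothesis beta1 : 1 < beta.
Local Notation T := (Tmb beta).
Local Notation D := (@dg R beta).
Local Notation W := (@word R T _ D).
Local Notation A := 'I_(bnat beta).+1.
Variable S : seq R.
Hypotheses (S0 : 0 \in S) (S1 : 1 \in S) (S01 : forall s, s \in S -> 0 <= s <= 1).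
Hypothesis Scl : forall s (d : nat), s \in S -> d%:R < beta * s -> beta * s < d.+1%:R ->
  d.+1%:R - beta * s \in S.
Local Notation gen := (gen beta S).
Local Notation rk := (rk beta S).
Local Notation pos := (pos S).

Let mT := @measurable_Tmb R beta beta1.
Let mD := @mlab_dg R beta beta1.

Section Follow.
Variables (m : nat).
Local Notation J := {ffun 'I_m -> A}.

(** Each block [u] of length [m] is followed by a connector of length [l]. *)
Fixpoint follows (x : R) (us : seq J) (ls : seq nat) : Prop :=
  match us, ls with
  | u :: us', l :: ls' => W m x = u /\ follows (iter (l + m) T x) us' ls'
  | [::], [::] => True
  | _, _ => False
  end.

Definition span_length (ls : seq nat) := sumn [seq (l + m)%N | l <- ls].

Lemma span_length_le c ls : all (fun l => l <= c)%N ls -> (span_length ls <= size ls * (m + c))%N.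
Proof.
elim: ls => //= l ls IH /andP[lc /IH h]; rewrite /span_length/= mulSn leq_add//.
by rewrite addnC leq_add2l.
Qed.

Lemma follows_word n x x' us ls : (span_length ls <= n)%N -> W n x = W n x' ->
  follows x us ls -> follows x' us ls.
Proof.
elim: us ls n x x' => [|u us IH] [|l ls] n x x' //=; rewrite /span_length/= => hn E [<- hf].
have lmn : (l + m <= n)%N by exact: leq_trans (leq_addr _ _) hn.
split; first by apply/esym; apply: word_le E; apply: leq_trans lmn; exact: leq_addl.
apply: (IH ls (n - (l + m))%N) hf; first by rewrite leq_subRL.
by apply: word_shift; rewrite subnK.
Qed.

Lemma follows_inj x us us' ls : follows x us ls -> follows x us' ls -> us = us'.
Proof.
elim: ls x us us' => [|l ls IH] x [|u us] [|u' us'] //= [<- h] [<- h'].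
by rewrite (IH _ _ _ h h').
Qed.

Variable q : nat.

Definition wsub t (u : J) : {ffun 'I_q -> A} := [ffun i : 'I_q => oapp u ord0 (insub (t + i)%N)].

Lemma wsub_word t x : (t + q <= m)%N -> wsub t (W m x) = W q (iter t T x).
Proof.
move=> tq; apply/ffunP => i; rewrite !ffunE.
have tim : (t + i < m)%N by rewrite (leq_trans _ tq)// ltn_add2l.
by rewrite insubT/= ffunE/= addnC iterD.
Qed.

Definition block_sum (F : {ffun 'I_q -> A} -> R) (u : J) := \sum_(t < m - q) F (wsub t u).

(** Windows inside blocks are among those of the orbit. Applied to an indicator and to its
    complement, this bounds a frequency from both sides. *)
Lemma follows_sum (F : {ffun 'I_q -> A} -> R) n x us ls : (forall w, 0 <= F w) ->
  (span_length ls <= n)%N -> follows x us ls ->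
  \sum_(u <- us) block_sum F u <= \sum_(j < n) F (W q (iter j T x)).
Proof.
move=> F0; elim: us ls n x => [|u us IH] [|l ls] n x //=.
  by move=> _ _; rewrite big_nil; exact: sumr_ge0.
rewrite /span_length/= => hn [<- hf].
have lmn : (l + m <= n)%N by exact: leq_trans (leq_addr _ _) hn.
rewrite big_cons; have := IH ls (n - (l + m))%N _ _ hf; rewrite leq_subRL// => /(_ hn) h.
pose f j := F (W q (iter j T x)).
rewrite -(big_mkord xpredT f) (@big_cat_nat _ _ _ (l + m) 0 n)//=.
apply: lerD.
  rewrite (@big_cat_nat _ _ _ (m - q) 0 (l + m))//=; last first.
    by rewrite (leq_trans (leq_subr _ _))// leq_addl.
  rewrite big_mkord /block_sum (eq_bigr (fun t : 'I_(m - q) => f t)).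
    by rewrite lerDl; apply: sumr_ge0 => i _; exact: F0.
  by move=> t _; rewrite wsub_word//; have := ltn_ord t; clear; lia.
apply: le_trans h _.
rewrite -[X in \sum_(X <= _ < _) _]add0n big_addn big_mkord.
by apply: ler_sum => j _; rewrite /f (iterD j (l + m)).
Qed.

Lemma block_sum_compl (F : {ffun 'I_q -> A} -> R) u :
  block_sum (fun w => 1 - F w) u = (m - q)%:R - block_sum F u.
Proof. by rewrite /block_sum sumrB sumr_const card_ord. Qed.

Lemma expect_block_sum (mu : {measure set R -> \bar R}) (v : {ffun 'I_q -> A}) :
  prob01 mu -> Defs.invariant T mu ->
  \sum_u dist mu (W m) u * block_sum (fun w => (w == v)%:R) u = (m - q)%:R * dist mu (W q) v.
Proof.
move=> mu01 muT; have mWm := @mlab_word R T mT _ D m mD; have mWq := @mlab_word R T mT _ D q mD.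
under eq_bigr do rewrite /block_sum mulr_sumr.
rewrite exchange_big/= (eq_bigr (fun=> dist mu (W q) v)); first by rewrite sumr_const card_ord mulr_natl.
move=> t _; rewrite -(dist_iter mT muT t mWq).
have -> : W q \o iter t T = wsub t \o W m.
  by apply/funext => x /=; rewrite wsub_word//; have := ltn_ord t; clear; lia.
rewrite (dist_comp mu01.1)// [RHS]big_mkcond/=; apply: eq_bigr => u _.
by case: eqP; rewrite ?mulr1 ?mulr0.
Qed.

End Follow.

Section Glue.
Variables (j1 c0 m : nat) (y : {ffun 'I_m -> A} -> R) (P : pred {ffun 'I_m -> A}).
Hypothesis hj1 : forall x x', gen x' -> (rk x <= rk x')%N -> reach beta S x (iter j1 T x').
Hypothesis hc0 : forall x x', reach beta S x x' -> exists n z,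
  [/\ (n <= c0)%N, gen z, pos z = pos x & pos (iter n T z) = pos x'].
Hypothesis hy : forall u, P u ->
  [/\ gen (y u), W m (iter j1 T (y u)) = u & (rk (iter (j1 + m) T (y u)) <= rk (y u))%N].

(** Built from the right: the continuation is pulled back along a connector, then along the block
    [u]. The connector exists because the rank after [u] is at most that of [y u], hence of [y v],
    and [rk_reach] leads to time [j1] of [y v], where the block [v] begins. *)
Lemma glue_path u us : all P (u :: us) -> path (relpre (rk \o y) leq) u us ->
  exists x ls, [/\ gen x, pos x = pos (iter j1 T (y u)), size ls = (size us).+1,
    all (fun l => l <= c0)%N ls & follows x (u :: us) ls].
Proof.
elim: us u => [|v us IH] u.
  rewrite /= andbT => Pu _; have [gy Wy _] := hy Pu.
  exists (iter j1 T (y u)), [:: 0%N]; split=> //=; exact: gen_iter.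
move=> /andP[Pu Pvs] /andP[ruv pvs]; have [gu Wu ru] := hy Pu.
have [gv _ _] : [/\ gen (y v), W m (iter j1 T (y v)) = v & (rk (iter (j1 + m) T (y v)) <= rk (y v))%N].
  by case/andP: Pvs => /hy.
have [x1 [ls [gx1 x1v sls als fx1]]] := IH v Pvs pvs.
have rc : reach beta S (iter m T (iter j1 T (y u))) (iter j1 T (y v)).
  by apply: hj1 => //; rewrite -iterD addnC; exact: leq_trans ru ruv.
have [n [z [nc gz zu zv]]] := hc0 rc.
have [|x2 [gx2 x2z _ x2x1]] := pull_gen beta1 S0 S1 S01 Scl (n := n) gz gx1; first by rewrite zv.
have [||x [gx xu Wx xx2]] := pull_gen beta1 S0 S1 S01 Scl (n := m) (x := iter j1 T (y u)) _ gx2.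
- exact: gen_iter.
- by rewrite x2z.
exists x, (n :: ls); split=> //=; rewrite ?sls ?nc//; split; first by rewrite Wx.
by rewrite iterD xx2 x2x1.
Qed.

Lemma glue us : all P us -> sorted (relpre (rk \o y) leq) us ->
  exists x ls, [/\ gen x, size ls = size us, all (fun l => l <= c0)%N ls & follows x us ls].
Proof.
case: us => [|u us] Pu su; last first.
  by have [x [ls [? _ ? ? ?]]] := glue_path Pu su; exists x, ls.
have [x _ gx] := gen_dense beta1 S (lexx 0) ltr01 (lexx 1).
by exists x, [::].
Qed.

End Glue.

(** Frequencies are controlled at every point with a given word, not just at the glued one, because
    the lower bound uses a whole interval of such points. *)
Lemma many_words (mu : {measure set R -> \bar R}) q (eta h l : R) : prob01 mu -> Defs.invariant T mu ->
  0 < eta -> (forall m, (0 < m)%N -> l <= wordent mu T D m / m%:R) -> h < l ->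
  exists n0, forall n, (n0 <= n)%N -> exists Y : {set {ffun 'I_n -> A}},
    expR (n%:R * h) <= #|Y|%:R /\
    forall w, w \in Y -> (exists2 x, gen x & W n x = w) /\
      forall x, W n x = w -> forall v,
        `|dist (empirical T n x) (W q) v - dist mu (W q) v| <= eta.
Proof.
move=> mu01 muT eta0 hl hlt.
have [j1 hj1] := rk_reach beta1 S0 S1 S01 Scl.
have [c0 hc0] := reach_bounded beta S.
(* Number of pairs of a rank and a connector length: the loss of multiplicity per block. *)
pose K : nat := ((size S).+1 * c0.+1)%N; pose kap : R := ln K%:R.
have K0 : 0 < K%:R :> R by rewrite ltr0n.
have kap0 : 0 <= kap by rewrite ln_ge0// ler1n.
pose dl := (l - h) / 2; have dl0 : 0 < dl by rewrite /dl; lra.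
pose H := h + dl.
(* [C1] collects the entropy lost per block through typicality, tags and connectors; [C2] is twice
   the positions lost per block, including the typicality error 1. Both are dominated by taking
   blocks long. *)
pose C1 := 1 + kap + c0%:R * `|H|; pose C2 : R := 2 * (c0 + q).+1%:R.
pose m := maxn q.+1 (maxn (Num.truncn (C1 / dl)).+1 (Num.truncn (C2 / eta)).+1).
have qm : (q < m)%N by rewrite leq_max leqnn.
have m0 : (0 < m)%N by exact: leq_trans qm.
have mC1 : C1 <= m%:R * dl.
  rewrite -ler_pdivrMr// ltW// (lt_le_trans (truncnS_gt _))// ler_nat.
  by rewrite !leq_max leqnn/= orbT.
have mC2 : C2 <= m%:R * eta.
  rewrite -ler_pdivrMr// ltW// (lt_le_trans (truncnS_gt _))// ler_nat.
  by rewrite !leq_max leqnn/= !orbT.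
have mW n := @mlab_word R T mT _ D n mD.
pose J := {ffun 'I_m -> A}; pose p (u : J) := dist mu (W m) u.
have p0 u : 0 <= p u by exact: dist_ge0.
have p1 : \sum_u p u = 1 by apply: sum_dist => //; exact: mu01.1.
have [y hy] : {y : J -> R & forall u, 0 < p u ->
    [/\ gen (y u), W m (iter j1 T (y u)) = u & (rk (iter (j1 + m) T (y u)) <= rk (y u))%N]}.
  apply: (@choice J R (fun u y => 0 < p u -> [/\ gen y, W m (iter j1 T y) = u &
    (rk (iter (j1 + m) T y) <= rk y)%N])) => u.
  have [up|up] := ltP 0 (p u); last by exists 0.
  by have [z hz] := block_point beta1 S0 S1 S01 Scl mu01 muT j1 up; exists z.
pose g (v : {ffun 'I_q -> A}) (u : J) : R := block_sum (fun w => (w == v)%:R) u.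
have [N0 hN0] := @typical_count R J _ p g 1 ltr01 p0 p1.
pose mc := (m + c0)%N.
have mc0 : (0 < mc)%N by rewrite addn_gt0 m0.
pose C3 := mc%:R * `|H| + ln 2.
exists (maxn (N0.+1 * mc) (maxn (Num.truncn (C3 / dl)).+1 (Num.truncn (2 * mc%:R / eta)).+1)) => n.
rewrite !geq_max => /and3P[nN0 nC3 nmc].
have {}nC3 : C3 <= n%:R * dl.
  by rewrite -ler_pdivrMr// ltW// (lt_le_trans (truncnS_gt _))// ler_nat.
have {}nmc : 2 * mc%:R <= n%:R * eta.
  by rewrite -ler_pdivrMr// ltW// (lt_le_trans (truncnS_gt _))// ler_nat.
pose N := (n %/ mc)%N.
have NN0 : (N0 <= N)%N by rewrite leq_divRL// (leq_trans _ nN0)// leq_mul2r leqnSn orbT.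
have n0 : (0 < n)%N by rewrite (leq_trans _ nN0)// muln_gt0.
have Nn : (N * mc <= n)%N by exact: leq_divM.
have nN : (n <= N * mc + mc)%N.
  by rewrite {1}(divn_eq n mc) leq_add2l ltnW// ltn_mod.
have [X [Xp Xg Xc]] := hN0 N NN0.
pose us (s : {ffun 'I_N -> J}) := sort (relpre (rk \o y) leq) [seq s i | i <- enum 'I_N].
have us_size s : size (us s) = N by rewrite size_sort size_map size_enum_ord.
have [f hf] : {f : {ffun 'I_N -> J} -> R * seq nat & forall s, s \in X ->
    [/\ gen (f s).1, size (f s).2 = N, all (fun l => l <= c0)%N (f s).2 & follows (f s).1 (us s) (f s).2]}.
  apply: (@choice {ffun 'I_N -> J} (R * seq nat) (fun s xl => s \in X ->
    [/\ gen xl.1, size xl.2 = N, all (fun l => l <= c0)%N xl.2 & follows xl.1 (us s) xl.2])) => s.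
  have [sX|sX] := boolP (s \in X); last by exists (0, [::]).
  have [||x [ls [h1 h2 h3 h4]]] := @glue j1 c0 m y (fun u => 0 < p u) hj1 hc0 hy (us s).
  - by rewrite all_sort; apply/allP => u /mapP[i _ ->]; exact: Xp.
  - by apply: sort_sorted => u v; exact: leq_total.
  by exists (x, ls); split=> //=; rewrite h2.
have fspan s : s \in X -> (span_length m (f s).2 <= n)%N.
  by move=> /hf[_ sz hs _]; apply: leq_trans (span_length_le m hs) _; rewrite sz.
(* Ranks are recorded in the original order and connector lengths in the sorted order. The word and
   the lengths give back the sorted blocks, and the ranks then give back [s]. *)
pose tag (s : {ffun 'I_N -> J}) : {ffun 'I_N -> 'I_(size S).+1 * 'I_c0.+1} :=
  [ffun i : 'I_N => (inord (rk (y (s i))), inord (nth 0%N (f s).2 i))].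
pose Y := [set W n (f s).1 | s in X]%SET.
have inj : {in X &, injective (fun s => (W n (f s).1, tag s))}.
  move=> s s' sX sX' [WE /ffunP tE].
  have [_ sz al fl] := hf s sX; have [_ sz' al' fl'] := hf s' sX'.
  have rE i : rk (y (s i)) = rk (y (s' i)).
    have := congr1 (fun t : 'I__ * 'I__ => nat_of_ord t.1) (tE i).
    by rewrite !ffunE /= !inordK// ltnS rk_le_size.
  have lE : (f s).2 = (f s').2.
    apply: (@eq_from_nth _ 0%N); first by rewrite sz sz'.
    rewrite sz => i iN.
    have := congr1 (fun t : 'I__ * 'I__ => nat_of_ord t.2) (tE (Ordinal iN)).
    rewrite !ffunE /= !inordK// ltnS.
      by move/all_nthP: al' => /(_ 0%N i); rewrite sz'; exact.
    by move/all_nthP: al => /(_ 0%N i); rewrite sz; exact.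
  have E : us s = us s'.
    have fl2 := follows_word (fspan s sX) WE fl; rewrite lE in fl2.
    exact: follows_inj fl2 fl'.
  have Es : [seq s i | i <- enum 'I_N] = [seq s' i | i <- enum 'I_N].
    apply: sort_shuffle_eq E; rewrite -!map_comp; apply: eq_map => i /=; exact: rE.
  by apply/ffunP => i; have /eq_in_map/(_ i) := Es; apply; rewrite mem_enum.
have cX : (#|X| <= #|Y| * K ^ N)%N.
  rewrite -(card_in_imset inj).
  have -> : (#|Y| * K ^ N)%N = #|finset.setX Y [set: {ffun 'I_N -> 'I_(size S).+1 * 'I_c0.+1}]%SET|.
    by rewrite cardsX cardsT card_ffun card_prod !card_ord.
  apply/subset_leq_card/fintype.subsetP => _ /imsetP[s sX ->].
  by rewrite finset.in_setX finset.in_setT andbT; apply/imsetP; exists s.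
exists Y; split.
  have hE : (m%:R + c0%:R) * H <= ent p - 1 - kap.
    have : l * m%:R <= ent p by rewrite -ler_pdivlMr ?ltr0n//; exact: hl.
    have : c0%:R * H <= c0%:R * `|H| by rewrite ler_wpM2l// ler_norm.
    rewrite /C1 in mC1; rewrite mulrDl.
    have -> : m%:R * H = l * m%:R - m%:R * dl by rewrite /H /dl; lra.
    lra.
  have h1 : n%:R * h <= N%:R * (ent p - 1 - kap) - ln 2.
    apply: (@rate_estimate R _ _ m%:R c0%:R _ H) => //.
      by rewrite -natrD -!natrM -natrD !ler_nat Nn.
    by rewrite -natrD -/mc; rewrite /C3 in nC3; rewrite /H mulrDr; lra.
  have h2 : expR (N%:R * (ent p - 1)) <= 2 * (#|Y|%:R * expR (N%:R * kap)).
    apply: le_trans Xc _; rewrite ler_pM2l// expRM_natl lnK ?posrE// -natrX -natrM ler_nat.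
    exact: cX.
  have {}h2 : expR (N%:R * (ent p - 1 - kap) - ln 2) <= #|Y|%:R.
    rewrite mulrBr !expRD !expRN lnK ?posrE// ler_pdivrMr// ler_pdivrMr ?expR_gt0//.
    by rewrite -mulrA mulrCA.
  by apply: le_trans h2; rewrite ler_expR.
move=> _ /imsetP[s sX ->]; have [gx sz al fl] := hf s sX; split; first by exists (f s).1.
move=> x Wx v; have {}fl : follows x (us s) (f s).2.
  by apply: follows_word fl; [exact: fspan|rewrite Wx].
have F0 w : 0 <= (w == v)%:R :> R by [].
have F1 w : 0 <= 1 - (w == v)%:R :> R by rewrite subr_ge0 lern1 leq_b1.
have h1 := follows_sum F0 (fspan s sX) fl.
have h2 := follows_sum F1 (fspan s sX) fl.
rewrite (eq_bigr _ (fun u _ => block_sum_compl (fun w => (w == v)%:R) u)) sumrB in h2.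
rewrite big_tnth/= sumr_const card_ord us_size sumrB sumr_const card_ord in h2.
have usE : \sum_(u <- us s) block_sum (fun w => (w == v)%:R) u = \sum_i g v (s i).
  by rewrite (perm_big _ (permEl (perm_sort _ _)))/= big_map big_enum.
have h3 := Xg s sX v; rewrite expect_block_sum// in h3; rewrite usE in h1 h2.
have -> : dist (empirical T n x) (W q) v = n%:R^-1 * \sum_(j < n) (W q (iter j T x) == v)%:R.
  rewrite -(@expect_empirical R T n x _ (W q) (fun w => (w == v)%:R)).
  by rewrite (bigD1 v)//= eqxx mulr1 big1 ?addr0// => w /negbTE ->; rewrite mulr0.
apply: (@freq_estimate R n%:R _ _ (N%:R * (m - q)%:R) N%:R) h1 _ _ _ _.
- by rewrite ltr0n.
- by rewrite dist_ge0 dist_le1//; exact: mu01.1.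
- by rewrite mulr_natl; lra.
- by rewrite -mulrA -[X in _ <= X]mulr1.
- rewrite -natrM ler_nat (leq_trans _ Nn)// leq_mul2l /mc; apply/orP; right.
  by rewrite (leq_trans (leq_subr _ _))// leq_addr.
have mq : (m - q)%:R = m%:R - q%:R :> R by rewrite natrB// ltnW.
have e1 : n%:R <= N%:R * (m%:R + c0%:R) + (m%:R + c0%:R) :> R by rewrite -natrD -natrM -natrD ler_nat.
have e2 : N%:R * (m%:R + c0%:R) <= n%:R :> R by rewrite -natrD -natrM ler_nat.
have e3 : N%:R * C2 <= N%:R * (m%:R * eta) by rewrite ler_wpM2l.
have e4 : N%:R * (m%:R * eta) <= n%:R * eta.
  rewrite mulrA ler_pM2r//; apply: le_trans e2; rewrite ler_wpM2l// lerDl//.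
have c2E : C2 = 2 * (c0%:R + q%:R + 1) by rewrite /C2 -[(c0 + q).+1%:R]natr1 natrD.
have mcE : mc%:R = m%:R + c0%:R :> R by rewrite natrD.
rewrite c2E in e3; rewrite mcE in nmc; rewrite mq; move: nmc e1 e2 e3 e4; clear; lra.
Qed.

End Counting.

Section LebesgueMeasure.
Variable R : realType.

Lemma leb_le (A B : set R) : A `<=` B -> (lebesgue_measure A <= lebesgue_measure B)%E.
Proof. by move=> AB; apply: le_mu_ext. Qed.

Lemma leb_pack (I : choiceType) (s : seq I) (u v : I -> R) (d : R) (E : set R) : uniq s ->
  (forall i, i \in s -> 0 <= d <= v i - u i /\ forall x, u i < x < v i -> E x) ->
  (forall i j x, i \in s -> j \in s -> i != j -> u i < x < v i -> ~ u j < x < v j) ->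
  (((size s)%:R * d)%:E <= lebesgue_measure E)%E.
Proof.
move=> us hE dj; pose F i : set R := `]u i, v i[%classic.
suff : (((size s)%:R * d)%:E <= lebesgue_measure (\bigcup_(i in [set` s]) F i))%E.
  move/le_trans; apply; apply: leb_le => x [i /= is_ ]; rewrite /F /= in_itv/= => h.
  by have [_] := hE i is_; exact.
elim: s us hE dj => [|i s IH] us hE dj; first by rewrite mul0r measure_ge0.
have mF j : measurable (F j) by exact: measurable_itv.
have -> : \bigcup_(j in [set` i :: s]) F j = F i `|` \bigcup_(j in [set` s]) F j.
  apply/seteqP; split=> x.
    by move=> [j /=]; rewrite inE => /orP[/eqP ->|js] h; [left|right; exists j].
  by move=> [h|[j js h]]; [exists i => //=; exact: mem_head|exists j => //=; rewrite inE js orbT].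
rewrite measureU//; first last.
- apply/seteqP; split=> // x [/= h1 [j js h2]]; move: h1 h2; rewrite /F /= !in_itv/= => h1.
  apply: (dj i j x) h1 => //; [exact: mem_head|by rewrite inE js orbT|].
  by apply: contraTneq us => ->; rewrite /= js.
- by apply: fin_bigcup_measurable; [exact: finite_seq|move=> j _; exact: mF].
- exact: mF.
rewrite /= -natr1 mulrDl mul1r addrC EFinD; apply: leeD.
  have [/andP[d0 h] _] := hE i (mem_head _ _).
  rewrite lebesgue_measure_itv/= lte_fin; case: ifP => uv; first by rewrite -EFinD lee_fin.
  by rewrite lee_fin; move/negbT: uv; rewrite -leNgt; lra.
apply: IH; first by case/andP: us.
- by move=> j js; apply: hE; rewrite inE js orbT.
- by move=> j k x js ks; apply: dj; rewrite inE ?js ?ks orbT.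
Qed.

Lemma leb_setU (A B : set R) :
  (lebesgue_measure (A `|` B) <= lebesgue_measure A + lebesgue_measure B)%E.
Proof.
by rewrite /lebesgue_measure /lebesgue_stieltjes_measure /measure_extension; apply: outer_measureU2.
Qed.

Lemma leb01 (A : set R) : (forall x, A x -> 0 <= x <= 1) -> (lebesgue_measure A <= 1)%E.
Proof.
move=> h; apply: (@le_trans _ _ (lebesgue_measure (`[0, 1]%classic : set R))).
  by apply: leb_le => x /h; rewrite /= in_itv.
by rewrite lebesgue_measure_itv/= lte_fin ltr01 sube0.
Qed.

Lemma ereal_dense (x y : \bar R) : (x < y)%E -> exists r : R, (x < r%:E < y)%E.
Proof.
case: x y => [x| |] [y| |]//=.
- by rewrite lte_fin => xy; exists ((x + y) / 2); rewrite !lte_fin; apply/andP; split; lra.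
- by move=> _; exists (x + 1); rewrite ltry lte_fin andbT; lra.
- by move=> _; exists (y - 1); rewrite ltNyr lte_fin/=; lra.
- by move=> _; exists 0; rewrite ltNyr ltry.
Qed.

Lemma limn_esup_le_ev (u : nat -> \bar R) (c : \bar R) n0 :
  (forall n, (n0 <= n)%N -> (u n <= c)%E) -> (limn_esup u <= c)%E.
Proof.
move=> h; apply: (@le_trans _ _ (ereal_sup (u @` [set n | (n0 <= n)%N]))).
  by apply: ereal_inf_lbound; exists [set n | (n0 <= n)%N] => //; exists n0.
by apply: ge_ereal_sup => _ [n /= n0n <-]; exact: h.
Qed.

Lemma limn_einf_ge_ev (u : nat -> \bar R) (c : \bar R) n0 :
  (forall n, (n0 <= n)%N -> (c <= u n)%E) -> (c <= limn_einf u)%E.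
Proof.
by move=> h; rewrite /limn_einf leeNr; apply: (limn_esup_le_ev (n0 := n0)) => n /h; rewrite leeN2.
Qed.

Lemma eln_le (a : \bar R) n (r : R) : (0 < n)%N -> (0 <= a)%E -> (a <= (expR (n%:R * r))%:E)%E ->
  ((n%:R^-1)%:E * eln a <= r%:E)%E.
Proof.
move=> n0 a0 h; have nR : 0 < n%:R^-1 :> R by rewrite invr_gt0 ltr0n.
rewrite /eln; case: eqP => [_|/eqP an]; first by rewrite mulrNy gtr0_sg// mul1e leNye.
case: a a0 h an => [a| |]//; rewrite lee_fin => a0; rewrite lee_fin => h an.
have a_gt0 : 0 < a by rewrite lt_neqAle a0 andbT eq_sym.
rewrite /= -EFinM lee_fin ler_pdivrMl ?ltr0n// -(expRK (n%:R * r)).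
by rewrite ler_ln ?posrE ?expR_gt0.
Qed.

Lemma eln_ge (a : \bar R) n (r : R) : (0 < n)%N -> ((expR (n%:R * r))%:E <= a)%E ->
  (r%:E <= (n%:R^-1)%:E * eln a)%E.
Proof.
move=> n0 h; have nR : 0 < n%:R^-1 :> R by rewrite invr_gt0 ltr0n.
have a0 : (0 < a)%E by apply: lt_le_trans h; rewrite lte_fin expR_gt0.
rewrite /eln gt_eqF//; case: a h a0 => [a| |]//.
  rewrite lee_fin lte_fin => h a0; rewrite /= -EFinM lee_fin ler_pdivlMl ?ltr0n//.
  by rewrite -(expRK (n%:R * r)) ler_ln ?posrE ?expR_gt0.
by move=> _ _; rewrite eqxx mulry gtr0_sg// mul1e leey.
Qed.

End LebesgueMeasure.

(** * Large deviations *)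

Section Main.
Variables (R : realType) (beta : R).
Hypothesis beta1 : 1 < beta.
Local Notation T := (Tmb beta).
Local Notation D := (@dg R beta).
Local Notation W := (@word R T _ D).
Local Notation A := 'I_(bnat beta).+1.
Local Notation M := {measure set R -> \bar R}.

Let b0 : 0 < beta. Proof. exact: lt_trans beta1. Qed.
Let mT := @measurable_Tmb R beta beta1.
Let mD := @mlab_dg R beta beta1.
Let T01 := @Tmb01 R beta beta1.

Definition wball (mu : M) (k : nat) (f : nat -> R -> R) (eps : R) : set M :=
  [set nu | forall i, (i < k)%N -> `|intg nu (f i) - intg mu (f i)| < eps].

Lemma wball_open (mu : M) k (f : nat -> R -> R) (eps : R) : (forall i, (i < k)%N -> {within `[0, 1], continuous (f i)}) ->
  Defs.wopen (wball mu k f eps).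
Proof.
move=> cf nu nu01 hnu.
have [d d0 hd] : exists2 d : R, 0 < d & forall i, (i < k)%N ->
    d <= eps - `|intg nu (f i) - intg mu (f i)|.
  have {}hnu : forall i, (i < k)%N -> `|intg nu (f i) - intg mu (f i)| < eps := hnu.
  elim: k hnu {cf} => [|k IH] h; first by exists 1.
  have [|d d0 hd] := IH; first by move=> i ik; apply: h; exact: ltnW.
  have hk := h k (ltnSn k).
  exists (Num.min d (eps - `|intg nu (f k) - intg mu (f k)|)); first by rewrite lt_min d0 subr_gt0.
  move=> i; rewrite ltnS leq_eqVlt ge_min => /orP[/eqP ->|/hd ->//]; by rewrite lexx orbT.
exists k, f, d; split=> //; split=> // nu' _ h i ik.
apply: le_lt_trans (ler_distD (intg nu (f i)) _ _) _.
by have := hd i ik; have := h i ik; rewrite -/(intg nu' (f i)) -/(intg nu (f i)); lra.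
Qed.

Lemma osc_word k (f : nat -> R -> R) (e : R) : 0 < e ->
  (forall i, (i < k)%N -> {within `[0, 1], continuous (f i)}) ->
  exists q, forall i x y, (i < k)%N -> 0 <= x <= 1 -> 0 <= y <= 1 -> W q x = W q y ->
    `|f i x - f i y| <= e.
Proof.
move=> e0; elim: k => [|k IH] cf; first by exists 0%N.
have [|q1 h1] := IH; first by move=> i ik; apply: cf; exact: ltnW.
have [d d0 hd] := unif_cont01 (cf k (ltnSn k)) e0.
have [q2 h2] := beta_generating beta1 d0.
exists (maxn q1 q2) => i x y; rewrite ltnS leq_eqVlt => /orP[/eqP ->|ik] x01 y01 Wxy.
  by apply: hd => //; apply: (h2 q2) => //; apply: word_le Wxy; exact: leq_maxr.
by apply: h1 => //; apply: word_le Wxy; exact: leq_maxl.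
Qed.

(** Converse of [cell_nbhd], valid for all probability measures: by generation the functions [f i]
    are almost constant on long cells. *)
Lemma cells_wball (mu : M) k (f : nat -> R -> R) (eps : R) : prob01 mu -> 0 < eps ->
  (forall i, (i < k)%N -> {within `[0, 1], continuous (f i)}) ->
  exists q (eta : R), 0 < eta /\ forall nu, prob01 nu ->
    (forall v, `|dist nu (W q) v - dist mu (W q) v| <= eta) -> wball mu k f eps nu.
Proof.
move=> mu01 eps0 cf; have e40 : 0 < eps / 4 by lra.
have [q hq] := osc_word e40 cf.
pose rep w := xget 0 [set x | 0 <= x <= 1 /\ W q x = w].
pose V i w := f i (rep w).
pose B i := \sum_w `|V i w|; pose C := \sum_(i < k) B i.
have B0 i : 0 <= B i by exact: sumr_ge0.
have BC i : (i < k)%N -> B i <= C.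
  by move=> ik; rewrite /C (bigD1 (Ordinal ik))//= lerDl; exact: sumr_ge0.
have C0 : 0 <= C by exact: sumr_ge0.
pose eta := eps / (4 * (C + 1)).
have C1 : 0 < C + 1 by lra.
have eta0 : 0 < eta by rewrite divr_gt0// mulr_gt0.
have etaC : eta * C <= eps / 4.
  have E : eta * (C + 1) = eps / 4 by rewrite /eta; field; rewrite gt_eqF.
  by rewrite -E ler_wpM2l ?(ltW eta0)//; lra.
exists q, eta; split=> // nu nu01 h i ik.
have mW := @mlab_word R T mT _ D q mD.
have ap (nu' : M) : prob01 nu' -> `|intg nu' (f i) - \sum_w V i w * dist nu' (W q) w| <= eps / 4.
  move=> nu'01; have := @intg_approx R nu' nu'01 _ (W q) mW (f i) (V i) (fun=> eps / 4) (cf i ik).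
  rewrite -mulr_sumr (sum_dist nu'01.1 mW) mulr1; apply => x x01; apply: hq => //; rewrite /rep.
    by case: xgetP => [y -> []//|/(_ x)[]].
  by case: xgetP => [y -> []//|/(_ x)[]].
have h1 := ap nu nu01; have h2 := ap mu mu01.
have h3 : `|\sum_w V i w * dist nu (W q) w - \sum_w V i w * dist mu (W q) w| <= eps / 4.
  rewrite -sumrB; apply: le_trans (ler_norm_sum _ _ _) _.
  apply: (@le_trans _ _ (eta * B i)); last by apply: le_trans etaC; rewrite ler_pM2l// BC.
  rewrite /B mulr_sumr; apply: ler_sum => w _.
  by rewrite -mulrBr normrM mulrC ler_wpM2r.
have := ler_distD (\sum_w V i w * dist nu (W q) w) (intg nu (f i)) (intg mu (f i)).
have := ler_distD (\sum_w V i w * dist mu (W q) w) (\sum_w V i w * dist nu (W q) w) (intg mu (f i)).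
rewrite (distrC (\sum_w V i w * dist mu (W q) w)); lra.
Qed.

(** The digit partition generates, so by [kolmogorov_sinai] no other partition has a larger entropy
    rate. *)
Lemma hmetric_le (mu : M) l : prob01 mu -> Defs.invariant T mu ->
  ((fun n => wordent mu T D n / n%:R) @ \oo --> l) -> (hmetric T mu <= l%:E)%E.
Proof.
move=> mu01 muT cl; apply: ge_ereal_sup => _ [k [P [mP ->]]].
have [X [mX PX]] := mpartition_label mP.
have -> : P = fun i => X @^-1` [set i] by apply/funext.
have [lX [cX _]] := wordent_cvg mu01.1 mT muT mX.
have -> : hpart T mu (fun i => X @^-1` [set i]) = lX.
  apply/cvg_lim => //; rewrite (_ : (fun n => _) = (fun n => wordent mu T X n / n%:R))//.
  by apply/funext => n; rewrite Hn_wordent.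
rewrite lee_fin; apply/ler_addgt0Pr => e e0.
have [m0 hm0] := kolmogorov_sinai mT mD (beta_generating beta1) mu01 muT mX e0.
have cl' : (fun n => wordent mu T D n / n%:R + e) @ \oo --> l + e by apply: cvgD => //; exact: cvg_cst.
apply: (ler_cvg_to cX cl'); near=> n.
have n0 : 0 < n%:R :> R by rewrite ltr0n; near: n; exists 1%N.
rewrite -[e in leRHS](@mulfK _ n%:R) ?gt_eqF// -mulrDl ler_pM2r ?invr_gt0// mulrC [_ * e]mulrC.
by rewrite mulrC; apply: hm0; near: n; exists m0.
Unshelve. all: by end_near. Qed.

Hypothesis yb : yrrap beta.

Lemma local_lower (mu : M) (G : set M) (c : R) : prob01 mu -> Defs.wopen G -> G mu ->
  (c%:E < free_energy beta mu)%E ->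
  exists n0, forall n, (n0 <= n)%N -> ((expR (n%:R * c))%:E <=
    lebesgue_measure [set x : R | (0 <= x <= 1)%R /\ G (empirical T n x)])%E.
Proof.
move=> mu01 oG Gmu; rewrite /free_energy; case: asboolP => // muT hc.
have [S [S0 S1 S01 Scl]] := markov_set beta1 yb.
have [l [cl ll]] := wordent_cvg mu01.1 mT muT mD.
have lc : c + ln beta < l.
  rewrite -lte_fin; apply: lt_le_trans (hmetric_le mu01 muT cl).
  by rewrite EFinD -lteBrDr.
pose h := (c + ln beta + l) / 2.
have [k [f [eps [eps0 [cf hG]]]]] := oG mu mu01 Gmu.
have [q [eta [eta0 hcell]]] := cells_wball mu01 eps0 cf.
have [|n1 hn1] := @many_words R beta beta1 S S0 S1 S01 Scl mu q eta h l mu01 muT eta0 ll.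
  by rewrite /h; lra.
have [g g0 hg] := cell_itv beta1 S0 S1 Scl.
(* The surplus of the rate [h] over [c + ln beta] absorbs the constant [g] in the interval
   lengths. *)
pose d := h - ln beta - c; have d0 : 0 < d by rewrite /d /h; lra.
exists (maxn n1 (Num.truncn (`|ln g| / d)).+1) => n; rewrite geq_max => /andP[n1n dn].
have n0 : (0 < n)%N by exact: leq_trans dn.
have {}dn : `|ln g| <= n%:R * d.
  by rewrite -ler_pdivrMr// ltW// (lt_le_trans (truncnS_gt _))// ler_nat.
have [Y [cY hY]] := hn1 n n1n.
have /choice[uv huv] : forall w : {ffun 'I_n -> A}, exists uv : R * R, w \in Y ->
    beta ^- n * g <= uv.2 - uv.1 /\ forall y, uv.1 < y < uv.2 -> 0 <= y <= 1 /\ W n y = w.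
  move=> w; have [wY|wY] := boolP (w \in Y); last by exists (0, 0).
  have [[x gx <-] _] := hY w wY; have [u [v [h1 h2]]] := hg n x gx.
  by exists (u, v).
have bX : 0 < beta ^- n by rewrite invr_gt0 exprn_gt0.
have := @leb_pack R _ (enum Y) (fun w => (uv w).1) (fun w => (uv w).2) (beta ^- n * g)
  [set x : R | (0 <= x <= 1)%R /\ G (empirical T n x)] (enum_uniq _).
move=> lp; apply: le_trans (lp _ _); last 2 first.
- move=> w; rewrite mem_enum => wY; have [h1 h2] := huv w wY; split; first by rewrite h1 mulr_ge0 ?(ltW bX) ?(ltW g0).
  move=> x /h2[x01 Wx]; split=> //; have E01 := empirical_prob01 T01 n0 x01.
  apply: hG => //; have [_ hd] := hY w wY; apply: hcell => //; exact: hd.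
- move=> w w' x; rewrite !mem_enum => wY wY' ww' /(proj2 (huv w wY))[_ E] /(proj2 (huv w' wY'))[_ E'].
  by move/eqP: ww'; apply; rewrite -E -E'.
rewrite lee_fin -cardE; apply: (@le_trans _ _ (expR (n%:R * h) * (beta ^- n * g))).
  have -> : beta ^- n * g = expR (ln g - n%:R * ln beta).
    by rewrite expRD lnK ?posrE// expRN expRM_natl lnK ?posrE// mulrC.
  rewrite -expRD ler_expR.
  have : - ln g <= `|ln g| by rewrite -normrN ler_norm.
  by rewrite /d in dn; lra.
by rewrite ler_wpM2r// mulr_ge0// ltW.
Qed.

(** A positive value would, by the local lower bound on the whole space, give [[0,1]] a mass above
    1. *)
Lemma free_energy_le0 mu : prob01 mu -> (free_energy beta mu <= 0)%E.
Proof.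
move=> mu01; rewrite leNgt; apply/negP => /ereal_dense[r /andP[r0 hr]].
rewrite lte_fin in r0.
have oT : Defs.wopen [set: M].
  by move=> nu _ _; exists 0%N, (fun _ _ => 0), 1; split.
have [n0 h] := local_lower mu01 oT I hr.
have := h n0.+1 (leqnSn _) => h1.
have : ((expR (n0.+1%:R * r))%:E <= 1%:E :> \bar R)%E.
  by apply: le_trans h1 _; apply: leb01 => x [].
rewrite lee_fin leNgt => /negP; apply; by rewrite -expR0 ltr_expR mulr_gt0// ltr0n.
Qed.

Lemma local_upper_wball (mu : M) (c : R) : prob01 mu -> (free_energy beta mu < c%:E)%E ->
  exists k (f : nat -> R -> R) (eps : R), [/\ 0 < eps, forall i, (i < k)%N -> {within `[0, 1], continuous (f i)} &
    exists n0, forall n, (n0 <= n)%N -> (lebesgue_measure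
      [set x : R | (0 <= x <= 1)%R /\ wball mu k f eps (empirical T n x)] <= (expR (n%:R * c))%:E)%E].
Proof.
by move=> mu01 hc; have [k [f [eps [e0 [cf hn]]]]] := local_upper beta1 mu01 hc; exists k, f, eps.
Qed.

(** A measure of larger free energy inside the ball around [mu] would by the lower bound give that
    ball more mass than the upper bound allows. *)
Lemma free_energy_usc (c : \bar R) : wclosed [set mu | (c <= free_energy beta mu)%E].
Proof.
move=> mu mu01 /negP; rewrite -ltNge => /ereal_dense[r /andP[mr rc]].
have [k [f [eps [e0 cf [n0 hn0]]]]] := local_upper_wball mu01 mr.
exists k, f, eps; split=> //; split=> // nu nu01 hnu hc.
have [r' /andP[rr' r'n]] := ereal_dense (lt_le_trans rc hc); rewrite lte_fin in rr'.
have [n1 hn1] := local_lower nu01 (@wball_open mu k f eps cf) hnu r'n.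
pose n := (maxn n0 n1).+1.
have := le_trans (hn1 n (leqW (leq_maxr _ _))) (hn0 n (leqW (leq_maxl _ _))).
rewrite lee_fin ler_expR ler_pM2l ?ltr0n// => h; have := lt_le_trans rr' h; by rewrite ltxx.
Qed.

(** The rate is strictly below [c], which leaves room for the factor 2 in [rareU]. *)
Definition rare (c : R) (B : set M) := exists2 r, r < c & exists n0, forall n, (n0 <= n)%N ->
  (lebesgue_measure [set x : R | (0 <= x <= 1)%R /\ B (empirical T n x)] <= (expR (n%:R * r))%:E)%E.

Lemma rareS c B B' : (forall n x, (0 < n)%N -> 0 <= x <= 1 ->
  B (empirical T n x) -> B' (empirical T n x)) -> rare c B' -> rare c B.
Proof.
move=> BB' [r rc [n0 h]]; exists r => //; exists n0.+1 => n n0n.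
apply: le_trans (h n (ltnW n0n)); apply: leb_le => x [x01 Bx]; split=> //.
by apply: BB' => //; exact: leq_trans n0n.
Qed.

Lemma rareU c B B' : rare c B -> rare c B' -> rare c (B `|` B').
Proof.
move=> [r rc [n1 h1]] [r' rc' [n2 h2]].
pose r0 := Num.max r r'; pose r1 := (r0 + c) / 2.
have r0c : r0 < c by rewrite gt_max rc.
have d0 : 0 < (c - r0) / 2 by lra.
exists r1; first by rewrite /r1; lra.
exists (maxn (maxn n1 n2) (Num.truncn (ln 2 / ((c - r0) / 2))).+1) => n.
rewrite !geq_max => /andP[/andP[n1n n2n] dn].
have {}dn : ln 2 <= n%:R * ((c - r0) / 2).
  by rewrite -ler_pdivrMr// ltW// (lt_le_trans (truncnS_gt _))// ler_nat.
set E1 := [set x : R | (0 <= x <= 1)%R /\ B (empirical T n x)] in h1.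
apply: (@le_trans _ _ (lebesgue_measure ([set x : R | (0 <= x <= 1)%R /\ B (empirical T n x)] `|`
    [set x : R | (0 <= x <= 1)%R /\ B' (empirical T n x)]))).
  by apply: leb_le => x [x01 [Bx|Bx]]; [left|right].
apply: le_trans (leb_setU _ _) _; apply: le_trans (leeD (h1 n n1n) (h2 n n2n)) _.
rewrite -EFinD lee_fin.
have e1 : expR (n%:R * r) <= expR (n%:R * r0) by rewrite ler_expR ler_wpM2l// le_max lexx.
have e2 : expR (n%:R * r') <= expR (n%:R * r0) by rewrite ler_expR ler_wpM2l// le_max lexx orbT.
have e3 : 2 * expR (n%:R * r0) <= expR (n%:R * r1).
  rewrite -{1}[2](@lnK R) ?posrE// -expRD ler_expR /r1; lra.
lra.
Qed.

(** Were [F] not rare, an ultrafilter ignoring all rare parts of [F] would have a weak limit [m] in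
    [F], whereas the local bound makes a whole ball around [m] rare. *)
Lemma upper_bound (F : set M) : wclosed F ->
  (limn_esup (fun n : nat => ((n%:R^-1)%R)%:E *
        eln (lebesgue_measure [set x : R | (0 <= x <= 1)%R /\ F (empirical T n x)]))
     <= ereal_sup (free_energy beta @` [set mu | prob01 mu /\ F mu]))%E.
Proof.
move=> cF; rewrite leNgt; apply/negP => /ereal_dense[c /andP[sc cl]].
have nr : ~ rare c F.
  move=> [r rc [n0 h]]; move: cl; rewrite ltNge => /negP; apply.
  apply: (@le_trans _ _ r%:E); last by rewrite lee_fin ltW.
  apply: (limn_esup_le_ev (n0 := n0.+1)) => n n0n; apply: eln_le.
  - exact: leq_trans n0n.
  - exact: measure_ge0.
  - by apply: h; exact: ltnW.
(* The sets that contain all of [F] up to a rare part; the filter is proper exactly because [F]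
   itself is not rare. *)
pose FF : set_system M := [set B | rare c (F `&` ~` B)].
have FFp : ProperFilter FF.
  apply: Build_ProperFilter; first by rewrite /FF /= setC0 setIT.
  apply: Build_Filter => [|B B' hB hB'|B B' BB' hB].
  - rewrite /FF /= setCT setI0; exists (c - 1); first by lra.
    exists 0%N => n _; rewrite (_ : [set x | _] = set0) ?measure0 ?lee_fin ?expR_ge0//.
    by apply/seteqP; split=> // x [].
  - by rewrite /FF /= setCI setIUr; exact: rareU.
  - by apply: rareS hB => n x _ _ [Fx h]; split=> // /BB'.
have [U [UU FU]] := ultraFilterLemma FFp.
have UP : ProperFilter U := @ultra_proper _ _ UU.
have UI (B B' : set M) : U B -> U B' -> U (B `&` B') by move=> hB hB'; exact: filterI.
have Uex (B : set M) : U B -> exists nu, B nu by exact: filter_ex.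
have re0 (B : set M) : (forall n x, (0 < n)%N -> 0 <= x <= 1 -> F (empirical T n x) ->
    B (empirical T n x)) -> U B.
  move=> h; apply: FU; apply: (@rareS _ _ set0).
    by move=> n x n0 x01 [Fx]; apply; exact: h.
  exists (c - 1); first by lra.
  exists 0%N => n _; rewrite (_ : [set x | _] = set0) ?measure0 ?lee_fin ?expR_ge0//.
  by apply/seteqP; split=> // x [].
have Up : U [set nu | prob01 nu] by apply: re0 => n x n0 x01 _; exact: empirical_prob01.
have UF : U F by apply: re0.
have [m m01 hm] := ultra_weak_limit UU Up.
have Uball k (f : nat -> R -> R) (eps : R) : 0 < eps -> (forall i, (i < k)%N -> {within `[0, 1], continuous (f i)}) ->
    U (wball m k f eps).
  move=> eps0; elim: k => [|k IH] cf.
    by apply: filterS filterT => nu _ i.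
  have h1 : U (wball m k f eps) by apply: IH => i ik; apply: cf; exact: ltnW.
  have e20 : 0 < eps / 2 by lra.
  have h2 := hm (f k) (cf k (ltnSn k)) _ e20.
  apply: filterS (UI _ _ h1 h2) => nu [n1 n2] i; rewrite ltnS leq_eqVlt => /orP[/eqP ->|]; last exact: n1.
  by apply: le_lt_trans n2 _; lra.
have Fm : F m.
  apply: contrapT => nF; have [k [f [eps [eps0 [cf h]]]]] := cF m m01 nF.
  have [nu [[nB np] nFF]] := Uex _ (UI _ _ (UI _ _ (Uball k f eps eps0 cf) Up) UF).
  exact: (h nu np nB).
have mc : (free_energy beta m < c%:E)%E.
  by apply: le_lt_trans sc; apply: ereal_sup_ubound; exists m.
have [r /andP[mr rc]] := ereal_dense mc; rewrite lte_fin in rc.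
have [k [f [eps [eps0 cf [n0 hn0]]]]] := local_upper_wball m01 mr.
(* The ball around [m] is rare, so its complement lies in the filter, although convergence to [m]
   puts the ball in [U]. *)
have UN : U (~` wball m k f eps).
  apply: FU; apply: (@rareS _ _ (wball m k f eps)); first by move=> n x _ _ [_ /contrapT].
  by exists r => //; exists n0.
by have [nu []] := Uex _ (UI _ _ (Uball k f eps eps0 cf) UN).
Qed.

Lemma lower_bound (G : set M) : Defs.wopen G ->
  (ereal_sup (free_energy beta @` [set mu | prob01 mu /\ G mu]) <=
     limn_einf (fun n : nat => ((n%:R^-1)%R)%:E *
        eln (lebesgue_measure [set x : R | (0 <= x <= 1)%R /\ G (empirical T n x)])))%E.
Proof.
move=> oG; apply: ge_ereal_sup => _ [mu [mu01 Gmu] <-].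
rewrite leNgt; apply/negP => /ereal_dense[c /andP[lc cm]].
have [n0 h] := local_lower mu01 oG Gmu cm.
move: lc; rewrite ltNge => /negP; apply; apply: (limn_einf_ge_ev (n0 := n0.+1)) => n n0n.
by apply: eln_ge; [exact: leq_trans n0n|apply: h; exact: ltnW].
Qed.

End Main.

Theorem theoremB (R : realType) (beta : R) :
  1 < beta -> yrrap beta ->
  level2_LDP (@lebesgue_measure R) (Tmb beta) (free_energy beta).
Proof.
move=> beta1 yb; split; first exact: free_energy_le0.
by split; [exact: free_energy_usc|split; [exact: lower_bound|exact: upper_bound]].
Qed.
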